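(* Let $n\in\mathbb{N}$, $h>0$, let $U$ be an open neighborhood of $0$ in $C^{1}=C^{1}([-h,0],\mathbb{R}^{n})$, and let $f:U\to\mathbb{R}^{n}$ satisfy $f(0)=0$ and the following two conditions: (S1) $f$ is continuously differentiable; (S2) for each $\varphi\in U$ the derivative $Df(\varphi):C^{1}\to\mathbb{R}^{n}$ extends to a linear map $D_{e}f(\varphi):C\to\mathbb{R}^{n}$ such that the map $U\times C\ni(\varphi,\psi)\mapsto D_{e}f(\varphi)\psi\in\mathbb{R}^{n}$ is continuous. Let $F$ be the semiflow on the solution manifold $X_{f}$ generated by $x'(t)=f(x_{t})$, let $G_{e}$ be the generator of the semigroup on $C$ given by $v'(t)=D_{e}f(0)v_{t}$, and let $C=C_{u}\oplus C_{c}\oplus C_{s}$ be the associated decomposition of $C$ into unstable, center and stable spaces, with $C^{1}_{s}=C^{1}\cap C_{s}$. Suppose that $\sigma(G_{e})\cap i\mathbb{R}\neq\emptyset$, that is, $\dim C_{c}\geq 1$. Let $W_{cs}$ be a local center-stable manifold of $F$ at $0$ (with associated neighborhood $N_{cs}$) and let $W_{cu}$ be a local center-unstable manifold of $F$ at $0$ (with associated neighborhood $N_{cu}$). Then the intersection $W_{cs}\cap W_{cu}$ contains a local center manifold of $F$ at $0$. That is, there exist open neighborhoods $C_{c,0}$ of $0$ in $C_{c}$ and $C^{1}_{su,0}$ of $0$ in $C^{1}_{s}\oplus C_{u}$ with $N_{c}:=C_{c,0}+C^{1}_{su,0}\subset U$, and a continuously differentiable map $w_{c}:C_{c,0}\to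 C^{1}_{su,0}$ with $w_{c}(0)=0$ and $Dw_{c}(0)=0$, such that the graph $$W_{c}=\{\varphi+w_{c}(\varphi)\mid\varphi\in C_{c,0}\}$$ satisfies $W_{c}\subset W_{cs}\cap W_{cu}$ and the following hold: (C 1) $W_{c}\subset X_{f}$, and $W_{c}$ is a $\dim C_{c}$-dimensional continuously differentiable submanifold of $X_{f}$. (C 2) $W_{c}$ is positively invariant with respect to $F$ relative to $N_{c}$; that is, for all $\varphi\in W_{c}$ and all $0\leq t<t_{+}(\varphi)$ with $F([0,t]\times\{\varphi\})\subset N_{c}$ we have $F(s,\varphi)\in W_{c}$ for $0\leq s\leq t$. (C 3) If $\gamma:\mathbb{R}\to X_{f}$ is a trajectory of $F$ with $\gamma(\mathbb{R})\subset N_{c}$, then $\gamma(t)\in W_{c}$ for all $t\in\mathbb{R}$.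
   Context: **Spaces.** Fix a norm on $\mathbb{R}^{n}$. $C$ is the Banach space of continuous functions $\varphi:[-h,0]\to\mathbb{R}^{n}$ with $\|\varphi\|_{C}=\sup_{-h\leq s\leq 0}\|\varphi(s)\|$. $C^{1}$ is the Banach space of continuously differentiable $\varphi:[-h,0]\to\mathbb{R}^{n}$ with $\|\varphi\|_{C^{1}}=\|\varphi\|_{C}+\|\varphi'\|_{C}$. For a function $x$ defined on an interval containing $[t-h,t]$, the segment $x_{t}:[-h,0]\to\mathbb{R}^{n}$ is $x_{t}(s)=x(t+s)$. **Equation and semiflow.** A solution of $x'(t)=f(x_{t})$ on $[t_{0}-h,t_{+})$ with $t_{0}<t_{+}\leq\infty$ is a continuously differentiable function $x:[t_{0}-h,t_{+})\to\mathbb{R}^{n}$ with $x_{t}\in U$ for $t_{0}\leq t<t_{+}$ that satisfies the equation for $t_{0}<t<t_{+}$. The solution manifold is $X_{f}=\{\varphi\in U\mid\varphi'(0)=f(\varphi)\}$. Under (S1)-(S2) the following is known: $X_{f}$ is a continuously differentiable submanifold of $U$ of codimension $n$; each $\varphi\in X_{f}$ uniquely determines a noncontinuable solution $x^{\varphi}:[-h,t_{+}(\varphi))\to\mathbb{R}^{n}$ with $x^{\varphi}_{0}=\varphi$; all its segments $x^{\varphi}_{t}$, $0\leq t<t_{+}(\varphi)$, lie in $X_{f}$; and $F(t,\varphi):=x^{\varphi}_{t}$ for $\varphi\in X_{f}$, $0\leq t<t_{+}(\varphi)$, defines a continuous semiflow on $X_{f}$ with $C^{1}$-smooth time-$t$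 maps. Since $f(0)=0$, the point $0\in X_{f}$ is stationary. The tangent space of $X_{f}$ at $0$ is $T_{0}X_{f}=\{\chi\in C^{1}\mid\chi'(0)=Df(0)\chi\}$. A trajectory of $F$ is a map $\gamma:I\to X_{f}$, $I\subset\mathbb{R}$ an interval, with $\gamma(t)=F(t-s,\gamma(s))$ whenever $s,t\in I$ and $t\geq s$. **Spectral decomposition.** The linear retarded equation $v'(t)=D_{e}f(0)v_{t}$ generates a strongly continuous semigroup on $C$ with generator $G_{e}\varphi=\varphi'$ on $\mathcal{D}(G_{e})=\{\chi\in C^{1}\mid\chi'(0)=D_{e}f(0)\chi\}=T_{0}X_{f}$. The spectrum $\sigma(G_{e})\subset\mathbb{C}$ (of the complexification) is discrete and consists of eigenvalues with finite-dimensional generalized eigenspaces; for each $\beta\in\mathbb{R}$ only finitely many of them have real part $\geq\beta$. The spaces $C_{u}$ (unstable) and $C_{c}$ (center) are the realified generalized eigenspaces associated with the eigenvalues with $\Re\lambda>0$ and with $\Re\lambda=0$, respectively; they are finite-dimensional subspaces of $T_{0}X_{f}\subset C^{1}$. The space $C_{s}$ (stable) is the realified spectral subspace associated with the eigenvalues with $\Re\lambda<0$, i.e. the closed complement of $C_{u}\oplus C_{c}$ in $C$ given by the kernel of the spectral projection of $G_{e}$ associated with $\{\lambda\in\sigma(G_{e})\mid\Re\lambda\geq 0\}$. One has $C=C_{u}\oplus C_{c}\oplus C_{s}$, $C^{1}=C_{u}\oplus C_{c}\oplus C^{1}_{s}$ with $C^{1}_{s}=C^{1}\cap C_{s}$ closed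 in $C^{1}$, and $T_{0}X_{f}=C_{u}\oplus C_{c}\oplus(C^{1}_{s}\cap T_{0}X_{f})$. **Local center-stable manifold.** A local center-stable manifold of $F$ at $0$ is a continuously differentiable submanifold $W_{cs}$ of $X_{f}$ with $0\in W_{cs}$ and $T_{0}W_{cs}=C_{c}\oplus(C^{1}_{s}\cap T_{0}X_{f})$, together with an open neighborhood $N_{cs}$ of $0$ in $U$, such that: (CS 1) for all $\varphi\in W_{cs}$ and all $0\leq t<t_{+}(\varphi)$ with $F([0,t]\times\{\varphi\})\subset N_{cs}$ we have $F(s,\varphi)\in W_{cs}$ for $0\leq s\leq t$; (CS 2) $W_{cs}$ contains all $\varphi\in X_{f}$ with $F(t,\varphi)\in N_{cs}$ for all $0\leq t<\infty$; (CS 3) if $\gamma:[t,0]\to X_{f}$, $t<0$, is a trajectory of $F$ with $\gamma(0)\in W_{cs}$ and $\gamma([t,0])\subset N_{cs}$, then $\gamma(s)\in W_{cs}$ for $t\leq s\leq 0$. **Local center-unstable manifold.** A local center-unstable manifold of $F$ at $0$ is a continuously differentiable submanifold $W_{cu}$ of $X_{f}$ of dimension $\dim(C_{u}\oplus C_{c})$ with $0\in W_{cu}$ and $T_{0}W_{cu}=C_{u}\oplus C_{c}$, together with an open neighborhood $N_{cu}$ of $0$ in $U$, such that: (CU 1) for all $\varphi\in W_{cu}$ and all $0\leq t<t_{+}(\varphi)$ with $F([0,t]\times\{\varphi\})\subset N_{cu}$ we have $F(s,\varphi)\in W_{cu}$ for $0\leq s\leq t$; (CU 2) if $\gamma:(-\infty,0]\to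 X_{f}$ is a trajectory of $F$ with $\gamma((-\infty,0])\subset N_{cu}$, then $\gamma(t)\in W_{cu}$ for all $t\leq 0$. Submanifolds are embedded submanifolds. *)

(* Defs.v *)
From HB Require Import structures.
From mathcomp Require Import all_boot all_order all_algebra.
From mathcomp Require Import all_classical all_reals all_analysis.
From mathcomp Require Import complex.
From mathcomp Require Import lra.

Set Implicit Arguments.
Unset Strict Implicit.
Unset Printing Implicit Defensive.

Import Order.TTheory GRing.Theory Num.Theory.
Import numFieldNormedType.Exports.

Local Open Scope classical_set_scope.
Local Open Scope ring_scope.

Record vnorm (R : realType) (n : nat) := VNorm {
  vnorm_fun :> 'rV[R]_n -> R;
  vnorm_triangle : forall x y, vnorm_fun (x + y) <= vnorm_fun x + vnorm_fun y;
  vnorm_homogeneous : forall (a : R) x, vnorm_fun (a *: x) = `|a| * vnorm_fun x;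
  vnorm_definite : forall x, vnorm_fun x = 0 -> x = 0 }.

(* The alias carries the norm [N] and its topology, not the sup norm which the
   library puts on 'rV[R]_n. *)
Definition Rn (R : realType) (n : nat) (N : vnorm R n) : Type := 'rV[R]_n.

HB.instance Definition _ (R : realType) (n : nat) (N : vnorm R n) :=
  GRing.Lmodule.copy (Rn N) 'rV[R]_n.
HB.instance Definition _ (R : realType) (n : nat) (N : vnorm R n) :=
  @Lmodule_isNormed.Build R (Rn N) N
    (vnorm_triangle N) (vnorm_homogeneous N) (@vnorm_definite _ _ N).

(* Difference quotients are taken inside [I], hence one-sided at an end point
   belonging to [I]. *)
Definition derivative_on (R : realType) (E : normedModType R) (I : set R)
    (x dx : R -> E) :=
  forall t, I t ->
    (fun r => r^-1 *: (x (t + r) - x t)) @ within [set r | I (t + r)] 0^'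
      --> dx t.

Definition C1_on (R : realType) (E : normedModType R) (I : set R) (x : R -> E) :=
  exists dx, derivative_on I x dx /\ {within I, continuous dx}.

Section ContinuousFunctions.
Context {R : realType} (h : {posnum R}) (E : normedModType R).

Definition clamp (s : R) : R := Num.max (- h%:num) (Num.min s 0).

Definition Cpred : {pred (R -> E)} :=
  [pred phi | `[< continuous phi /\ forall s, phi s = phi (clamp s) >] ].

(* A continuous function on [-h, 0] is represented by its extension to the real
   line which is constant on ]-oo, -h] and on [0, +oo[; two elements are thus
   equal iff they coincide on [-h, 0]. *)
Record Cspace := MkC { Cfun :> R -> E; Cfun_subproof : Cfun \in Cpred }.

HB.instance Definition _ := [isSub for Cfun].
HB.instance Definition _ := [Choice of Cspace by <:].

Fact Cpred_submod : GRing.submod_closed Cpred.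
Proof.
split; first by apply/asboolP; split=> //; exact: cst_continuous.
move=> a u v /asboolP[cu eu] /asboolP[cv ev]; apply/asboolP; split.
  by move=> s; apply: cvgD; [apply: cvgZl_tmp; exact: cu|exact: cv].
by move=> s; rewrite /= -/(_ + _) !fctE eu ev.
Qed.
HB.instance Definition _ := GRing.isSubmodClosed.Build R (R -> E) Cpred
  Cpred_submod.
HB.instance Definition _ := [SubChoice_isSubLmodule of Cspace by <:].

Definition Cnorm (phi : Cspace) : R := sup [set `|phi s| | s in `[- h%:num, 0]].

Lemma Cspace_continuous (phi : Cspace) : continuous phi.
Proof. by case: phi => phi /= /asboolP[]. Qed.

Lemma Cspace_clamp (phi : Cspace) s : phi s = phi (clamp s).
Proof. by case: phi => phi /= /asboolP[]. Qed.

Lemma clamp_itv s : `[- h%:num, 0]%classic (clamp s).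
Proof.
rewrite /= in_itv /= /clamp le_max lexx /= ge_max oppr_le0 ge0 /=.
by rewrite ge_min lexx orbT.
Qed.

Lemma Cnorm_has_sup (phi : Cspace) :
  has_sup [set `|phi s| | s in `[- h%:num, 0]].
Proof.
split; first by exists `|phi (clamp 0)|, (clamp 0) => //; exact: clamp_itv.
have /compact_bounded[M [_ HM]] : compact (phi @` `[- h%:num, 0]).
  apply: continuous_compact; last exact: segment_compact.
  by apply: continuous_subspaceT; exact: Cspace_continuous.
exists (M + 1) => _ [s hs <-]; apply: (HM (M + 1)); first by rewrite ltrDl.
by exists s.
Qed.

Lemma Cnorm_ub (phi : Cspace) s : `|phi s| <= Cnorm phi.
Proof.
rewrite Cspace_clamp; apply: (sup_upper_bound (Cnorm_has_sup phi)).
by exists (clamp s) => //; exact: clamp_itv.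
Qed.

Lemma Cnorm_le (phi : Cspace) (M : R) :
  (forall s, `|phi s| <= M) -> Cnorm phi <= M.
Proof.
move=> H; apply: ge_sup; first by have [] := Cnorm_has_sup phi.
by move=> _ [s _ <-].
Qed.

Fact Cnorm_triangle (phi psi : Cspace) :
  Cnorm (phi + psi) <= Cnorm phi + Cnorm psi.
Proof.
apply: Cnorm_le => s; apply: (le_trans (ler_normD _ _)).
by apply: lerD; exact: Cnorm_ub.
Qed.

Fact Cnorm_homogeneous (a : R) (phi : Cspace) :
  Cnorm (a *: phi) = `|a| * Cnorm phi.
Proof.
have le (b : R) psi : Cnorm (b *: psi) <= `|b| * Cnorm psi.
  apply: Cnorm_le => s; rewrite [X in `|X|](_ : _ = b *: psi s) // normrZ.
  by apply: ler_wpM2l => //; exact: Cnorm_ub.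
apply/eqP; rewrite eq_le le /=; have [->|a0] := eqVneq a 0.
  by rewrite normr0 mul0r; exact: le_trans (normr_ge0 _) (Cnorm_ub _ 0).
rewrite -ler_pdivlMl ?normr_gt0 // -normfV.
by have := le a^-1 (a *: phi); rewrite scalerA mulVf // scale1r.
Qed.

Fact Cnorm_definite (phi : Cspace) : Cnorm phi = 0 -> phi = 0.
Proof.
move=> H; apply: val_inj; apply/funext => s /=; apply/eqP.
by rewrite -normr_le0 -H Cnorm_ub.
Qed.

HB.instance Definition _ := @Lmodule_isNormed.Build R Cspace Cnorm
  Cnorm_triangle Cnorm_homogeneous Cnorm_definite.

Definition C1pred : {pred (Cspace * Cspace)%type} :=
  [pred p : Cspace * Cspace | `[< derivative_on `[- h%:num, 0] p.1 p.2 >] ].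

(* An element of C^1 is stored together with its derivative, which it
   determines since h > 0. *)
Record C1space := MkC1 {
  C1val : (Cspace * Cspace)%type; C1val_subproof : C1val \in C1pred }.

HB.instance Definition _ := [isSub for C1val].
HB.instance Definition _ := [Choice of C1space by <:].

Fact C1pred_submod : GRing.submod_closed C1pred.
Proof.
have FF (t : R) : Filter (within [set r | `[- h%:num, 0]%classic (t + r)] 0^').
  exact: within_filter.
split.
  apply/asboolP => t _; rewrite [X in X @ _](_ : _ = cst 0); first exact: cvg_cst.
  by apply/funext => r /=; rewrite subrr scaler0.
move=> a u v /asboolP du /asboolP dv; apply/asboolP => t It.
have cu : (fun r => a *: (r^-1 *: (u.1 (t + r) - u.1 t)))
    @ within [set r | `[- h%:num, 0]%classic (t + r)] 0^' --> a *: u.2 t.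
  by apply: cvgZl_tmp; exact: du.
apply: cvg_trans (cvgD cu (dv t It)); apply: near_eq_cvg; apply: nearW => r.
rewrite /= !fctE /= -[RHS]/(r^-1 *: (a *: u.1 (t + r) + v.1 (t + r)
  - (a *: u.1 t + v.1 t))).
by rewrite scalerA mulrC -scalerA -scalerDr scalerBr opprD addrACA.
Qed.
HB.instance Definition _ := GRing.isSubmodClosed.Build R
  (Cspace * Cspace)%type C1pred C1pred_submod.
HB.instance Definition _ := [SubChoice_isSubLmodule of C1space by <:].

Lemma C1val_fst_inj (p q : C1space) : (C1val p).1 = (C1val q).1 -> p = q.
Proof.
move=> e1; apply: val_inj => /=.
rewrite [C1val p]surjective_pairing [C1val q]surjective_pairing e1.
congr (_, _); apply: val_inj; apply/funext => s /=.
rewrite [LHS]Cspace_clamp [RHS]Cspace_clamp.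
have := clamp_itv s; move: (clamp s) => t It.
have /asboolP/(_ t It) dp := C1val_subproof p.
have /asboolP/(_ t It) dq := C1val_subproof q.
move: dp; rewrite e1 => dp; move: dp dq.
set W := within _ _.
suff PW : ProperFilter W by move=> hp hq; exact: (cvg_unique _ hp hq).
have FW : Filter W by exact: within_filter.
apply: Build_ProperFilter_ex => A [e /= e0 HA].
have h0 : 0 < h%:num by [].
pose m := Num.min (e / 2) (h%:num / 2).
have m0 : 0 < m by rewrite lt_min !divr_gt0.
have mh : m <= h%:num / 2 by rewrite ge_min lexx orbT.
have me : m < e by rewrite gt_min; apply/orP; left; lra.
move: It; rewrite /= in_itv /= => /andP[It1 It2].
have [tl|tl] := leP t (- (h%:num / 2)).
  exists m; apply: HA.
  - by rewrite /= sub0r normrN gtr0_norm.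
  - by rewrite gt_eqF.
  - by rewrite /= in_itv /=; apply/andP; split; lra.
exists (- m); apply: HA.
- by rewrite /= sub0r opprK gtr0_norm.
- by rewrite oppr_eq0 gt_eqF.
- by rewrite /= in_itv /=; apply/andP; split; lra.
Qed.

Definition C1incl (phi : C1space) : Cspace := (C1val phi).1.
Definition C1deriv (phi : C1space) : Cspace := (C1val phi).2.

Definition C1norm (phi : C1space) : R := `|C1incl phi| + `|C1deriv phi|.

Fact C1norm_triangle (phi psi : C1space) :
  C1norm (phi + psi) <= C1norm phi + C1norm psi.
Proof. by rewrite /C1norm addrACA lerD // ler_normD. Qed.

Fact C1norm_homogeneous (a : R) (phi : C1space) :
  C1norm (a *: phi) = `|a| * C1norm phi.
Proof. by rewrite /C1norm mulrDr -!normrZ. Qed.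

Fact C1norm_definite (phi : C1space) : C1norm phi = 0 -> phi = 0.
Proof.
move=> /eqP; rewrite /C1norm paddr_eq0 // !normr_eq0 => /andP[/eqP p1 /eqP p2].
apply: val_inj => /=; rewrite [C1val phi]surjective_pairing.
by rewrite -/(C1incl phi) -/(C1deriv phi) p1 p2.
Qed.

HB.instance Definition _ := @Lmodule_isNormed.Build R C1space C1norm
  C1norm_triangle C1norm_homogeneous C1norm_definite.

End ContinuousFunctions.

Coercion C1incl : C1space >-> Cspace.

Section Calculus.
Context {R : realType}.

Definition sumset (V : zmodType) (A B : set V) : set V :=
  [set a + b | a in A & b in B].

Definition has_dim (K : fieldType) (V : lmodType K) (M : set V) (k : nat) :=
  exists b : 'I_k -> V,
    M = [set \sum_i a i *: b i | a in [set: 'I_k -> K]] /\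
    forall a : 'I_k -> K, \sum_i a i *: b i = 0 -> forall i, a i = 0.

(* Continuity of the derivative refers to the operator norm. *)
Definition C1_map (V W : normedModType R) (O : set V) (F : V -> W) :=
  forall x, O x ->
    differentiable F x /\
    forall e, 0 < e ->
      \forall y \near x, forall v, `|'d F y v - 'd F x v| <= e * `|v|.

(* [w] is defined on [O], which is open in the linear subspace [M] of [V], and
   [Dw x] is its derivative at [x], a bounded linear map defined on [M]. *)
Definition C1_map_in (V W : normedModType R) (M O : set V) (w : V -> W)
    (Dw : V -> V -> W) :=
  forall x, O x ->
    [/\ forall (a : R) u v, M u -> M v ->
          Dw x (a *: u + v) = a *: Dw x u + Dw x v,
        exists K, forall v, M v -> `|Dw x v| <= K * `|v|,
        forall e, 0 < e -> exists2 d, 0 < d & forall v, M v -> `|v| < d ->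
          `|w (x + v) - w x - Dw x v| <= e * `|v| &
        forall e, 0 < e -> exists2 d, 0 < d & forall y, O y -> `|y - x| < d ->
          forall v, M v -> `|Dw y v - Dw x v| <= e * `|v|].

Definition open_nbhd0_in (V : normedModType R) (M O : set V) :=
  O 0 /\ exists2 A, open A & O = M `&` A.

Section Submanifolds.
Context {V : normedModType R}.

Definition split_subspace (M : set V) :=
  exists pi : {linear V -> V},
    [/\ continuous pi, forall x, pi (pi x) = pi x & M = range pi].

Definition C1_diffeo (O O' : set V) (Th Ps : V -> V) :=
  [/\ open O, open O', Th @` O = O', forall x, O x -> Ps (Th x) = x &
      C1_map O Th /\ C1_map O' Ps].

(* Near [p], one chart of the ambient space flattens both the manifold [X], to
   the subspace [M], and its subset [W], to the subspace [M'] of [M]. *)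
Definition adapted_chart (X W : set V) (p : V) (M M' : set V) :=
  exists O O' Th Ps,
    [/\ C1_diffeo O O' Th Ps, O p,
        Th @` (O `&` X) = O' `&` M & Th @` (O `&` W) = O' `&` M'].

Definition submanifold_modelled_in (Q : set V -> Prop) (X W : set V) :=
  W `<=` X /\ forall p, W p -> exists M M',
    [/\ split_subspace M, split_subspace M' /\ M' `<=` M, Q M' &
        adapted_chart X W p M M'].

Definition submanifold (X W : set V) :=
  submanifold_modelled_in (fun=> True) X W.

Definition submanifold_dim (k : nat) (X W : set V) :=
  submanifold_modelled_in (fun M' => has_dim M' k) X W.

Definition tangent_space (W : set V) (p : V) : set V :=
  [set v | exists c : R -> V,
    [/\ c 0 = p,
        \forall t \near (0 : R), [/\ W (c t), derivable c t 1 &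
          {for t, continuous (c^`()%classic)}] &
        c^`()%classic 0 = v]].

End Submanifolds.
End Calculus.

(* [(x, y)] stands for x + i y. *)
Definition cplx (R : realType) (X : normedModType R) : Type := (X * X)%type.

Section Complexification.
Context {R : realType} (X : normedModType R).

HB.instance Definition _ :=
  PseudoMetricNormedZmod.copy (cplx X) (X * X)%type.

Definition cscale (l : R[i]) (z : cplx X) : cplx X :=
  (complex.Re l *: z.1 - complex.Im l *: z.2,
   complex.Im l *: z.1 + complex.Re l *: z.2).

Fact cscaleA a b z : cscale a (cscale b z) = cscale (a * b) z.
Proof.
case: a b z => [a a'] [b b'] [x y]; congr (_, _);
  rewrite /= scalerBr scalerDr !scalerA scalerBl scalerDl.
  by rewrite !opprD addrACA.
by rewrite addrC addrACA.
Qed.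

Fact cscale1 : left_id 1 cscale.
Proof. by case=> x y; rewrite /cscale /= !scale1r !scale0r subr0 add0r. Qed.

Fact cscaleDr : right_distributive cscale +%R.
Proof.
move=> a [x y] [x' y']; congr (_, _); rewrite /= !scalerDr.
  by rewrite opprD addrACA.
by rewrite addrACA.
Qed.

Fact cscaleDl z : {morph cscale^~ z : a b / a + b}.
Proof.
case: z => x y [a a'] [b b']; congr (_, _); rewrite /= !scalerDl.
  by rewrite opprD addrACA.
by rewrite addrACA.
Qed.

HB.instance Definition _ := GRing.Zmodule_isLmodule.Build R[i] (cplx X)
  cscaleA cscale1 cscaleDr cscaleDl.

End Complexification.

Section SpectralTheory.
Context {R : realType} {X : normedModType R}.

(* A linear operator is given by its graph, so that its domain may be a proper
   subspace. *)
Definition complexify (A : set (X * X)%type) : set (cplx X * cplx X)%type :=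
  [set z | A (z.1.1, z.2.1) /\ A (z.1.2, z.2.2)].

Local Notation Z := (cplx X).
Implicit Types (A : set (Z * Z)%type) (M : set Z) (S : set R[i]).

Definition part M A : set (Z * Z)%type := [set z | [/\ A z, M z.1 & M z.2]].

(* For the part of [A] in the subspace [M]. *)
Definition resolvent_set M A : set R[i] :=
  [set l | (forall y, M y ->
              exists! x, exists2 Ax, part M A (x, Ax) & l *: x - Ax = y) /\
           exists K, forall x Ax, part M A (x, Ax) ->
              `|x| <= K * `|l *: x - Ax| ].

Definition spectrum M A : set R[i] := ~` resolvent_set M A.

Fixpoint ker_pow A (l : R[i]) (k : nat) : set Z :=
  if k is k'.+1 then
    [set x | exists2 Ax, A (x, Ax) & ker_pow A l k' (Ax - l *: x)]
  else [set 0].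

Definition gen_eigenspace A (l : R[i]) : set Z := \bigcup_k ker_pow A l k.

Definition gen_eigenspaces A S : set Z :=
  [set x | exists (m : nat) (l : 'I_m -> R[i]) (y : 'I_m -> Z),
    (forall i, S (l i) /\ gen_eigenspace A (l i) (y i)) /\ x = \sum_i y i].

Definition realify M : set X := [set x | M ((x, 0) : Z)].

(* [P] is the spectral projection of [A] associated with the subset [S] of the
   spectrum of [A]: the bounded projection commuting with [A] such that the part
   of [A] in the range is bounded with spectrum [S] and the part of [A] in the
   kernel has the remaining spectrum. *)
Definition spectral_projection A S (P : {linear Z -> Z}) :=
  [/\ continuous P /\ forall x, P (P x) = P x,
      forall x Ax, A (x, Ax) -> A (P x, P Ax),
      forall x, exists Ax, A (P x, Ax),
      exists K, forall x Ax, A (P x, Ax) -> `|Ax| <= K * `|P x| &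
      spectrum (range P) A = S /\
      spectrum [set x | P x = 0] A = spectrum setT A `\` S].

End SpectralTheory.

Section DelayEquation.
Context {R : realType} {h : {posnum R}} {E : normedModType R}.

Local Notation C := (Cspace h E).
Local Notation C1 := (C1space h E).

Variables (U : set C1) (f : C1 -> E).

(* [De phi] extends the derivative of [f] at [phi]; the maps [De phi] for [phi]
   outside [U] are irrelevant. *)
Definition derivative_extends (De : C1 -> {linear C -> E}) :=
  (forall phi, U phi -> forall chi : C1, De phi chi = 'd f phi chi) /\
  {within U `*` [set: C], continuous (fun p : C1 * C => De p.1 p.2)}.

Definition is_segment (x : R -> E) (t : R) (phi : C1) :=
  forall s, s \in `[- h%:num, 0] -> phi s = x (t + s).

Definition solution (t0 : R) (T : \bar R) (x : R -> E) :=
  [/\ (t0%:E < T)%E,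
      C1_on [set t | t0 - h%:num <= t /\ (t%:E < T)%E] x,
      forall t, t0 <= t -> (t%:E < T)%E -> exists2 phi, U phi & is_segment x t phi
    & forall t phi, t0 < t -> (t%:E < T)%E -> is_segment x t phi ->
        is_derive t 1 x (f phi)].

(* [x] restricted to [-h, T) is the noncontinuable solution starting at [phi]. *)
Definition noncontinuable_solution (phi : C1) (T : \bar R) (x : R -> E) :=
  [/\ solution 0 T x, is_segment x 0 phi &
      forall T' y, solution 0 T' y ->
        (forall t, - h%:num <= t -> (t%:E < T)%E -> y t = x t) -> (T' <= T)%E].

Definition t_plus (phi : C1) : \bar R :=
  xget 0%E [set T | exists x, noncontinuable_solution phi T x].

(* Meaningful for [phi] in the solution manifold and [0 <= t < t_plus phi]. *)
Definition semiflow (t : R) (phi : C1) : C1 :=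
  xget 0 [set psi | exists T x,
    [/\ noncontinuable_solution phi T x, (t%:E < T)%E & is_segment x t psi]].

Definition solution_manifold : set C1 :=
  [set phi | U phi /\ C1deriv phi 0 = f phi].

Definition tangent0 : set C1 := [set chi | C1deriv chi 0 = 'd f 0 chi].

Definition trajectory (I : set R) (gamma : R -> C1) :=
  (forall t, I t -> solution_manifold (gamma t)) /\
  forall s t, I s -> I t -> s <= t ->
    ((t - s)%:E < t_plus (gamma s))%E /\
    gamma t = semiflow (t - s) (gamma s).

Definition pos_invariant_rel (W N : set C1) :=
  forall phi t, W phi -> 0 <= t -> (t%:E < t_plus phi)%E ->
    (forall s, 0 <= s <= t -> N (semiflow s phi)) ->
    forall s, 0 <= s <= t -> W (semiflow s phi).

(* [T0] is the prescribed tangent space at 0. *)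
Definition local_center_stable (T0 W N : set C1) :=
  [/\ submanifold solution_manifold W, W 0, tangent_space W 0 = T0,
      [/\ open N, N 0 & N `<=` U] &
      [/\ pos_invariant_rel W N,
          forall phi, solution_manifold phi -> t_plus phi = +oo%E ->
            (forall t, 0 <= t -> N (semiflow t phi)) -> W phi &
          forall t gamma, t < 0 -> trajectory `[t, 0] gamma -> W (gamma 0) ->
            (forall s, t <= s <= 0 -> N (gamma s)) ->
            forall s, t <= s <= 0 -> W (gamma s)]].

Definition local_center_unstable (T0 W N : set C1) :=
  [/\ exists2 k, has_dim T0 k & submanifold_dim k solution_manifold W,
      W 0, tangent_space W 0 = T0,
      [/\ open N, N 0 & N `<=` U] &
      pos_invariant_rel W N /\
      forall gamma, trajectory `]-oo, 0] gamma ->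
        (forall t, t <= 0 -> N (gamma t)) -> forall t, t <= 0 -> W (gamma t)].

End DelayEquation.

Section Linearization.
Context {R : realType} {h : {posnum R}} {E : normedModType R}.

Local Notation C := (Cspace h E).
Local Notation C1 := (C1space h E).

(* The generator of the semigroup of v'(t) = L v_t, complexified. *)
Definition generator (L : C -> E) : set (cplx C * cplx C)%type :=
  complexify [set z | exists chi : C1,
    C1deriv chi 0 = L chi /\ z = (chi : C, C1deriv chi)].

Variable L : C -> E.

Definition sigma_gen : set R[i] := spectrum setT (generator L).

Definition sigma_cu : set R[i] := [set l | sigma_gen l /\ 0 <= complex.Re l].

(* The unstable and center spaces lie in the domain of the generator; they are
   regarded as subsets of C^1. *)
Definition unstable_space : set C1 := @C1incl R h E @^-1` realify
  (gen_eigenspaces (generator L) [set l | sigma_gen l /\ 0 < complex.Re l]).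

Definition center_space : set C1 := @C1incl R h E @^-1` realify
  (gen_eigenspaces (generator L) [set l | sigma_gen l /\ complex.Re l = 0]).

(* The intersection of C^1 with the stable space, where [P] is the spectral
   projection associated with [sigma_cu]. *)
Definition stable_space1 (P : cplx C -> cplx C) : set C1 :=
  @C1incl R h E @^-1` realify [set z | P z = 0].

End Linearization.

(* Main.v *)
Require Import Defs.
From HB Require Import structures.
From mathcomp Require Import all_boot all_order all_algebra.
From mathcomp Require Import all_classical all_reals all_analysis.
From mathcomp Require Import complex.
From mathcomp Require Import lra ring.

(** Charts of [Wcs] and [Wcu] at 0 can be normalised to have the identity as
    derivative; they then flatten [Wcs] to the kernel of the unstable projection
    in T_0 X_f and [Wcu] to C_u + C_c.  Hence, inside [Wcu], the set [Wcs] is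
      the
    zero set of a C^1 map into C_u with derivative the unstable projection, and
    [Wcs `&` Wcu] is the graph of a map on C_c.  Only perturbations of the
      identity
    with values in the finite dimensional space C_u + C_c have to be inverted,
      so
    that completeness of C^1 plays no role.  Near 0 the center manifold is all
      of
    [Wcs `&` Wcu], and it inherits invariance from [Wcs] and [Wcu].

    The splitting of C^1 comes from the spectral projection [P]: its range is
    finite dimensional, because the generator is bounded on it and a function
    with [|x'| <= K |x|] that vanishes on a fine grid is zero.  By
    Cayley-Hamilton the range is the sum of the generalised eigenspaces, and [P]
    commutes with complex conjugation, so everything can be done over R. *)

Set Implicit Arguments.
Unset Strict Implicit.
Unset Printing Implicit Defensive.

Import Order.TTheory GRing.Theory Num.Theory.
Import numFieldNormedType.Exports.

Local Open Scope classical_set_scope.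
Local Open Scope ring_scope.

(** * Calculus in normed spaces *)

(** A chart of [Wcs] also flattens [X_f], to some subspace about which nothing is assumed. Curves in
    [X_f] satisfy the differentiated equation, so after normalisation this subspace lies in T_0 X_f.
    That is why an equation in C_u alone decides membership in [Wcs]: a point of [Wcu] near 0 lies
    in [X_f], its image under the chart of [Wcs] is already tangent, and only the unstable component
    remains to be tested.

    The chart built for the intersection coincides with the center projection there; its inverse,
    restricted to C_c, is therefore a section of that projection, that is, a graph. As the graph is
    the whole intersection inside [Nc], and [Nc] lies in [Ncs] and [Ncu], invariance needs no
    estimate on the semiflow.

    A spectral projection is described through resolvents, not eigenvectors. The bridge consists of
    two facts about T - l: it is injective on the range of [P] for l outside the spectral set, and
    bijective from the domain part onto the kernel of [P] for l inside. *)

Lemma diff_linear_bound (R : realType) (V W : normedModType R) (F : V -> W) x :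
  differentiable F x -> exists2 k, 0 < k & forall v, `|'d F x v| <= k * `|v|.
Proof. by move=> /diff_continuous/linear_lipschitz. Qed.

Lemma differentiable_eps (R : realType) (V W : normedModType R) (F : V -> W) x :
  differentiable F x -> forall e, 0 < e -> exists2 d, 0 < d &
    forall v, `|v| < d -> `|F (x + v) - F x - 'd F x v| <= e * `|v|.
Proof.
move=> /diff_locallyP[_] /eqaddoP H e e0.
have /nbhs_norm0P[d /= d0 Hd] := H e e0.
exists d => // v vd; have := Hd v vd.
by rewrite /= !fctE /= opprD addrA [v + x]addrC.
Qed.

(** ['d F x] is a chosen linear map; uniqueness of the derivative identifies it with an explicit
    candidate. *)
Lemma eps_differentiable (R : realType) (V W : normedModType R) (F : V -> W) x
    (J : V -> W) :
  linear J -> (exists K, forall v, `|J v| <= K * `|v|) ->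
  (forall e, 0 < e -> exists2 d, 0 < d &
    forall v, `|v| < d -> `|F (x + v) - F x - J v| <= e * `|v|) ->
  differentiable F x /\ forall v, 'd F x v = J v.
Proof.
move=> lJ [K bJ] H.
pose JL : {linear V -> W} := HB.pack J (GRing.isLinear.Build _ _ _ _ _ lJ).
have cJ : continuous JL.
  apply: bounded_linear_continuous; apply/linear_boundedP.
  exists K; split=> [|r /ltW Kr v]; first exact: num_real.
  by apply: (le_trans (bJ v)); exact: ler_wpM2r.
have HJ : F \o shift x = cst (F x) + JL +o_ 0 id.
  apply/eqaddoP => e e0; have [d d0 Hd] := H e e0.
  apply/nbhs_norm0P; exists d => //= v vd; have := Hd v vd.
  by rewrite !fctE /= opprD addrA [v + x]addrC.
have E := diff_unique cJ HJ.
split=> [|v]; last by rewrite E.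
by apply/diff_locallyP; rewrite E.
Qed.

Lemma open_ball_in (R : realType) (V : normedModType R) (O : set V) x :
  open O -> O x -> exists2 d, 0 < d & forall y, `|y - x| < d -> O y.
Proof.
move=> oO Ox; have /nbhs_normP[d /= d0 Hd] := open_nbhs_nbhs (conj oO Ox).
by exists d => // y yd; apply: Hd; rewrite /= distrC.
Qed.

Lemma near_ballP (R : realType) (V : normedModType R) (x : V) (P : V -> Prop) :
  (\forall y \near x, P y) <-> exists2 d, 0 < d & forall y, `|y - x| < d -> P y.
Proof.
split=> [/nbhs_normP[d /= d0 Hd]|[d d0 Hd]].
  by exists d => // y yd; apply: Hd; rewrite /= distrC.
by apply/nbhs_normP; exists d => //= y; rewrite /= distrC; exact: Hd.
Qed.

Lemma ball_in_open (R : realType) (V : normedModType R) (O : set V) :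
  (forall x, O x -> exists2 d, 0 < d & forall y, `|y - x| < d -> O y) -> open O.
Proof.
by move=> H; rewrite openE => x /H Hx; apply/near_ballP.
Qed.

(* The end points [t] for which the bound holds on [a, t] form a set that is
   closed under suprema and can always be prolonged. *)
Lemma local_lipschitz_increment (R : realType) (E : normedModType R)
    (f : R -> E) (a b K : R) : a <= b ->
  (forall t, a <= t <= b -> exists2 d, 0 < d &
     forall t', a <= t' <= b -> `|t' - t| < d ->
       `|f t' - f t| <= K * `|t' - t|) ->
  `|f b - f a| <= K * (b - a).
Proof.
move=> ab H.
pose S := [set t | a <= t <= b /\ `|f t - f a| <= K * (t - a)].
have Sa : S a by rewrite /S /= lexx ab !subrr normr0 mulr0.
have hS : has_sup S.
  by split; [exists a|exists b => t [/andP[]]].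
have ubS := sup_upper_bound hS.
set s := sup S in ubS *.
have as_ : a <= s by apply: ubS.
have sb : s <= b by apply: ge_sup; [exists a|move=> t [/andP[]]].
have sI : a <= s <= b by rewrite as_ sb.
have [d d0 Hd] := H s sI.
have d2 : 0 < d / 2 by rewrite divr_gt0.
have Ss : S s.
  split=> //; have [t St tS] := sup_adherent d2 hS.
  rewrite -/s in tS; have ts := ubS _ St; case: St => tI Ht.
  have td : `|t - s| < d by rewrite distrC ger0_norm ?subr_ge0 //; lra.
  have {Hd td} := Hd t tI td; rewrite distrC [`|t - s|]distrC.
  rewrite [`|s - t|]ger0_norm ?subr_ge0 // => Hs.
  rewrite -(subrKA (f t)); apply: (le_trans (ler_normD _ _)).
  by rewrite (_ : K * _ = K * (s - t) + K * (t - a)) ?lerD //; ring.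
have [sb'|bs] := ltP s b; last first.
  by have <- : s = b; [apply/eqP; rewrite eq_le sb bs|case: Ss].
pose t := Num.min (s + d / 2) b.
have st : s < t by rewrite lt_min sb' andbT; lra.
have tb : t <= b by rewrite ge_min lexx orbT.
have td : t <= s + d / 2 by rewrite ge_min lexx.
have tI : a <= t <= b by rewrite tb andbT; lra.
suff /ubS : S t by rewrite leNgt st.
split=> //; have := Hd t tI; rewrite ger0_norm; last by rewrite subr_ge0 ltW.
move=> /(_ ltac:(lra)) Ht; case: Ss => _ Hs.
rewrite -(subrKA (f s)); apply: (le_trans (ler_normD _ _)).
by rewrite (_ : K * _ = K * (t - s) + K * (s - a)) ?lerD //; ring.
Qed.

(** Balls are convex, so the increment bound can be applied along the segment from [x] to [y]. *)
Lemma mean_value_ball (R : realType) (V W : normedModType R) (F : V -> W)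
    (c : V) (r K : R) :
  (forall x, `|x - c| < r -> differentiable F x) ->
  (forall x, `|x - c| < r -> forall v, `|'d F x v| <= K * `|v|) ->
  forall x y, `|x - c| < r -> `|y - c| < r -> `|F y - F x| <= K * `|y - x|.
Proof.
move=> dF bF x y xr yr; set v := y - x.
pose p (t : R) := x + t *: v.
have pr t : 0 <= t <= 1 -> `|p t - c| < r.
  move=> /andP[t0 t1].
  have -> : p t - c = (1 - t) *: (x - c) + t *: (y - c).
    have -> : p t = x + (t *: (y - c) - t *: (x - c)).
      by rewrite /p /v -scalerBr opprB addrA subrK.
    by rewrite scalerBl scale1r addrAC -[RHS]addrA; congr (_ + _);
      rewrite addrC.
  apply: le_lt_trans (ler_normD _ _) _; rewrite !normrZ !ger0_norm ?subr_ge0 //.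
  (* Strictness comes from the second summand, which vanishes for [t = 0]. *)
  have [->|t00] := eqVneq t 0; first by rewrite subr0 mul1r mul0r addr0.
  have tp : 0 < t by rewrite lt_def t00.
  have : t * `|y - c| < t * r by rewrite ltr_pM2l.
  have : (1 - t) * `|x - c| <= (1 - t) * r by rewrite ler_wpM2l ?subr_ge0 //
    ltW.
  lra.
apply/ler_addgt0Pr => e e0.
(* Differentiability controls increments only up to a small multiple of their length, so the bound
   is proved for every larger constant. With [K' = K + e / m] and [m = |v| + 1] the surplus is at
   most [e]. *)
suff H K' : K < K' -> `|F y - F x| <= K' * `|v|.
  pose m := `|v| + 1; have m0 : 0 < m by rewrite /m ltr_wpDl.
  have /H/le_trans : K < K + e / m by rewrite ltrDl divr_gt0.
  apply; rewrite mulrDl lerD2l -mulrA ler_piMr ?(ltW e0) //.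
  by rewrite mulrC ler_pdivrMr // mul1r /m lerDl.
move=> KK'.
have := @local_lipschitz_increment R W (F \o p) 0 1 (K' * `|v|) ler01.
rewrite /= /p scale1r scale0r addr0 subr0 mulr1 (_ : x + v = y) ?[x + v]addrC
  ?subrK //; apply.
move=> t tI; have [d d0 Hd] := differentiable_eps (dF _ (pr t tI)) (e := K' -
  K) ltac:(lra).
have m0 : 0 < `|v| + 1 by rewrite ltr_wpDl.
exists (d / (`|v| + 1)); first by rewrite divr_gt0.
move=> t' _ tt'; set w := (t' - t) *: v.
have pw : x + t' *: v = p t + w by rewrite /p /w scalerBl -addrA [_ *: v +
  _]addrC subrK.
have wd : `|w| < d.
  rewrite normrZ; apply: le_lt_trans (_ : `|t' - t| * (`|v| + 1) < d).
    by rewrite ler_wpM2l // lerDl.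
  by rewrite -ltr_pdivlMr.
rewrite pw -/(p t) -(subrK ('d F (p t) w) (_ - _)).
apply: le_trans (ler_normD _ _) _.
have := Hd w wd; have := bF _ (pr t tI) w.
have -> : `|w| = `|t' - t| * `|v| by rewrite normrZ.
set q := `|t' - t| * _; rewrite (_ : K' * _ * _ = K' * q); last by rewrite /q;
  ring.
by move: (_ - _ - _) => z; lra.
Qed.

(** * Finite-dimensional subspaces: coordinates, compactness, closedness *)

Section FiniteDimension.
Context (R : realType) (V : normedModType R).

(** Coefficients form a row vector, unlike in [has_dim], because bounded closed sets of row vectors
    are compact. *)
Definition lincomb k (b : 'I_k -> V) (a : 'rV[R]_k) : V := \sum_i a 0 i *: b i.

Fact lincomb_linear k (b : 'I_k -> V) : linear (lincomb b).
Proof.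
move=> c u v; rewrite /lincomb scaler_sumr -big_split /=.
by apply: eq_bigr => i _; rewrite !mxE scalerDl scalerA.
Qed.

HB.instance Definition _ k (b : 'I_k -> V) :=
  GRing.isLinear.Build R 'rV[R]_k V *:%R (lincomb b) (lincomb_linear b).

Lemma has_dim_lincomb k (Y : set V) : has_dim Y k -> exists2 b : 'I_k -> V,
  (forall y, Y y <-> exists a, y = lincomb b a) &
  forall a, lincomb b a = 0 -> a = 0.
Proof.
move=> [b [-> bi]]; exists b.
  move=> y; split=> [[a _ <-]|[a ->]]; last by exists (a 0).
  by exists (\row_i a i); apply: eq_bigr => i _; rewrite mxE.
by move=> a /bi H; apply/rowP => i; rewrite mxE H.
Qed.

Lemma coord_le_norm k (a : 'rV[R]_k) i : `|a 0 i| <= `|a|.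
Proof.
by rewrite [leRHS]mx_normrE; apply/bigmax_geP; right; exists (0, i).
Qed.

Lemma lincomb_bound k (b : 'I_k -> V) :
  exists2 M, 0 < M & forall a, `|lincomb b a| <= M * `|a|.
Proof.
exists (1 + \sum_i `|b i|); first by rewrite ltr_pwDl // sumr_ge0.
move=> a; apply: (le_trans (ler_norm_sum _ _ _)).
apply: (@le_trans _ _ (\sum_i `|a| * `|b i|)).
  by apply: ler_sum => i _; rewrite normrZ ler_wpM2r // coord_le_norm.
by rewrite -mulr_sumr mulrC ler_wpM2r // lerDr.
Qed.

Lemma lincomb_continuous k (b : 'I_k -> V) : continuous (lincomb b).
Proof.
have [M _ HM] := lincomb_bound b.
apply: bounded_linear_continuous; apply/linear_boundedP.
exists M; split=> [|r /ltW Mr v]; first exact: num_real.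
by apply: (le_trans (HM v)); exact: ler_wpM2r.
Qed.

Lemma lincomb_norm_continuous k (b : 'I_k -> V) :
  continuous (fun a : 'rV[R]_k => `|lincomb b a|).
Proof.
move=> a; apply: (@continuous_comp _ _ _ (lincomb b) (fun x : V => `|x|)).
  exact: lincomb_continuous.
exact: norm_continuous.
Qed.

Lemma comp_lincomb_continuous k (b : 'I_k -> V) (F : V -> V) a :
  {for lincomb b a, continuous F} ->
  {for a, continuous (fun a => `|F (lincomb b a)|)}.
Proof.
move=> cF; apply: (@continuous_comp _ _ _ (F \o lincomb b) (fun x : V => `|x|)).
  by apply: continuous_comp; [exact: lincomb_continuous|exact: cF].
exact: norm_continuous.
Qed.

(** The norm of the combination is continuous and nonzero on the compact unit sphere of
    coefficients; its minimum there is the constant. *)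
Lemma lincomb_coercive k (b : 'I_k -> V) :
  (forall a, lincomb b a = 0 -> a = 0) ->
  exists2 c, 0 < c & forall a, c * `|a| <= `|lincomb b a|.
Proof.
move=> bi; pose S := [set a : 'rV[R]_k | `|a| = 1].
have cS : compact S.
  apply: bounded_closed_compact.
    by exists 1; split=> [|x x1 a /= ->]; [exact: num_real|exact: ltW].
  apply: (@preimage_closed _ _ (fun a : 'rV[R]_k => `|a|) [set x | x = 1]).
    by move=> a _; exact: norm_continuous.
  exact: closed_eq.
have nS a : a != 0 -> S (`|a|^-1 *: a).
  by move=> a0; rewrite /S /= normrZ normfV normr_id mulVf // normr_eq0.
(* For [k = 0] the sphere is empty; then [a = 0] and any constant serves. *)
have [S0|S0] := pselect (S !=set0); last first.
  exists 1 => // a; have [->|/nS Sa] := eqVneq a 0.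
    by rewrite normr0 mulr0.
  by case: S0; exists (`|a|^-1 *: a).
have cf : {within S, continuous (fun a => `|lincomb b a|)}.
  by apply: continuous_subspaceT; exact: lincomb_norm_continuous.
have [a0 a0S Hmin] := compact_EVT_min S0 cS cf; rewrite inE in a0S.
exists `|lincomb b a0|.
  rewrite normr_gt0; apply/eqP => /bi a00; move: a0S.
  by rewrite /S /= a00 normr0 => /eqP; rewrite eq_sym oner_eq0.
move=> a; have [->|an0] := eqVneq a 0; first by rewrite normr0 mulr0.
have := Hmin _ (mem_set (nS a an0)).
rewrite linearZ /= normrZ normfV normr_id ler_pdivlMl ?normr_gt0 //.
by rewrite mulrC.
Qed.

Lemma lincomb_ball_compact k (b : 'I_k -> V) (M : R) :
  (forall a, lincomb b a = 0 -> a = 0) ->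
  compact [set a | `|lincomb b a| <= M].
Proof.
move=> /lincomb_coercive[c c0 Hc]; apply: bounded_closed_compact.
  exists (M / c); split=> [|x Mx a /= aM]; first exact: num_real.
  apply: le_trans (ltW Mx); rewrite ler_pdivlMr // mulrC.
  exact: le_trans (Hc a) aM.
apply: (@preimage_closed _ _ (fun a : 'rV[R]_k =>
  `|lincomb b a|) [set x | x <= M]).
  by move=> a _; exact: lincomb_norm_continuous.
exact: closed_le.
Qed.

Lemma has_dim_submod k (Y : set V) : has_dim Y k ->
  Y 0 /\ forall (a : R) u v, Y u -> Y v -> Y (a *: u + v).
Proof.
move=> /has_dim_lincomb[b YE _]; split.
  by apply/YE; exists 0; rewrite linear0.
move=> a u v /YE[u' ->] /YE[v' ->]; apply/YE; exists (a *: u' + v').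
by rewrite linearP.
Qed.

(** The distance to [x] attains its minimum on a compact set of coefficients, and that minimum is
    0. *)
Lemma has_dim_closed k (Y : set V) x : has_dim Y k ->
  (forall e, 0 < e -> exists2 y, Y y & `|x - y| < e) -> Y x.
Proof.
move=> /has_dim_lincomb[b YE bi] H.
(* Every element of [Y] at distance less than 1 from [x] has its coefficients in this set. *)
pose K := [set a | `|lincomb b a| <= `|x| + 1].
have K0 : K !=set0 by exists 0; rewrite /K /= linear0 normr0 addr_ge0.
have cf : {within K, continuous (fun a => `|x - lincomb b a|)}.
  apply: continuous_subspaceT => a.
  apply: (@comp_lincomb_continuous _ b (fun y => x - y)) => y.
  by apply: cvgB; [exact: cvg_cst|exact: cvg_id].
have [a _ Ha] := compact_EVT_min K0 (lincomb_ball_compact bi) cf.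
apply/YE; exists a; apply/eqP; rewrite -subr_eq0 -normr_le0.
apply/ler_addgt0Pr => e e0; rewrite add0r.
have m0 : 0 < Num.min e 1 by rewrite lt_min e0 ltr01.
have [y /YE[a' ->]] := H _ m0; rewrite lt_min => /andP[/ltW xe x1].
apply: le_trans xe; apply: Ha; rewrite inE /K /=.
have -> : lincomb b a' = x - (x - lincomb b a') by rewrite subKr.
by apply: le_trans (ler_normB _ _) _; rewrite lerD2l ltW.
Qed.

(* Minimising the defect [`|z + r z - w|] over [z] in a bounded part of [w + Y]
   replaces the contraction argument, so that completeness of [V] is not
   required: one fixed point iteration halves the defect. *)
Lemma finite_dim_perturbation_onto k (Y : set V) (r : V -> V) (rho : R) w :
  has_dim Y k -> (forall x, `|x| < rho -> Y (r x)) ->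
  (forall x y, `|x| < rho -> `|y| < rho -> `|r y - r x| <= 2^-1 * `|y - x|) ->
  r 0 = 0 -> `|w| < rho / 2 -> exists2 z, `|z| < rho & z + r z = w.
Proof.
move=> /has_dim_lincomb[b YE bi] rY rL r0 wr.
(* For such [a] the point [w - lincomb b a] has norm at most 2|w|, which is less than [rho]. *)
pose K := [set a | `|lincomb b a| <= `|w|].
have K0 : K !=set0 by exists 0; rewrite /K /= linear0 normr0.
pose g a := `|r (w - lincomb b a) - lincomb b a|.
have zr a : K a -> `|w - lincomb b a| < rho.
  by rewrite /K /= => Ka; apply: le_lt_trans (ler_normB _ _) _; lra.
have cf : {within K, continuous g}.
  apply: continuous_in_subspaceT => a; rewrite inE => /zr za.
  apply: (@comp_lincomb_continuous _ b (fun y => r (w - y) - y)).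
  apply: cvgB; last exact: cvg_id.
  apply: (@continuous_comp _ _ _ (fun y => w - y) r).
    by apply: cvgB; [exact: cvg_cst|exact: cvg_id].
  apply/cvgrPdist_lt => e e0; apply/near_ballP.
  exists (Num.min e (rho - `|w - lincomb b a|)).
    by rewrite lt_min e0 subr_gt0.
  move=> y; rewrite lt_min => /andP[ye yr].
  have yrho : `|y| < rho.
    rewrite -(subrK (w - lincomb b a) y).
    by apply: le_lt_trans (ler_normD _ _) _; lra.
  apply: le_lt_trans (rL _ _ yrho za) _; rewrite distrC.
  by have := normr_ge0 (y - (w - lincomb b a)); lra.
have [a aK Ha] := compact_EVT_min K0 (lincomb_ball_compact bi) cf.
rewrite inE in aK; have za := zr _ aK.
exists (w - lincomb b a) => //.
have /YE[a' a'E] := rY _ za.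
(* The iterate stays admissible: its norm is |r z|, at most half of |z|, and |z| is at most 2|w|. *)
have a'K : K a'.
  have := rL 0 _; rewrite normr0 r0 => /(_ (w - lincomb b a)).
  rewrite !subr0 a'E => /(_ _ za); move: aK; rewrite /K /= => aK.
  have := ler_normB w (lincomb b a); have := normr_ge0 (w - lincomb b a).
  move=> h1 h2 /(_ ltac:(lra)); lra.
have := Ha a' (mem_set a'K); rewrite /g.
have h := rL _ _ za (zr _ a'K).
have e1 : w - lincomb b a' - (w - lincomb b a) = - (lincomb b a' - lincomb b a).
  by rewrite opprB addrC addrA subrK opprB.
rewrite e1 normrN in h; rewrite -{2}a'E in h.
rewrite {2 3}a'E in h *.
rewrite a'E in h *; move=> h'.
have : `|lincomb b a' - lincomb b a| <= 0 by lra.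
rewrite normr_le0 subr_eq0 => /eqP ->.
by rewrite subrK.
Qed.

End FiniteDimension.

(** * Calculus of C^1 maps *)

Section C1Maps.
Context (R : realType).
Implicit Types V W X : normedModType R.

Lemma C1_map_sub V W (O O' : set V) (F : V -> W) :
  O `<=` O' -> C1_map O' F -> C1_map O F.
Proof. by move=> OO' H x /OO' /H. Qed.

Lemma C1_map_eps V W (O : set V) (F : V -> W) x : C1_map O F -> O x ->
  forall e, 0 < e -> exists2 d, 0 < d &
    forall y, `|y - x| < d -> forall v, `|'d F y v - 'd F x v| <= e * `|v|.
Proof. by move=> HF Ox e e0; have [_ /(_ e e0) /near_ballP] := HF x Ox. Qed.

Lemma C1_map_lin V W (O : set V) (F : {linear V -> W}) :
  continuous F -> C1_map O F.
Proof.
move=> cF x _; split; first exact: linear_differentiable.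
move=> e e0; apply: nearW => y v; rewrite !diff_lin // subrr normr0.
by rewrite mulr_ge0 // ltW.
Qed.

Lemma C1_map_cst V W (O : set V) (c : W) : C1_map O (cst c : V -> W).
Proof.
move=> x _; split; first exact: differentiable_cst.
move=> e e0; apply: nearW => y v; rewrite !diff_cst subrr normr0.
by rewrite mulr_ge0 // ltW.
Qed.

Lemma C1_mapD V W (O : set V) (F G : V -> W) : open O ->
  C1_map O F -> C1_map O G -> C1_map O (F + G).
Proof.
move=> oO HF HG x Ox; have [dF cF] := HF x Ox; have [dG cG] := HG x Ox.
split; first exact: (differentiableD dF dG).
move=> e e0; have e2 : 0 < e / 2 by rewrite divr_gt0.
have near_O : \forall y \near x, O y by exact: open_nbhs_nbhs.
apply: filterS3 near_O (cF _ e2) (cG _ e2) => y Oy EF EG v.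
have [dFy _] := HF y Oy; have [dGy _] := HG y Oy.
rewrite (diffD dFy dGy) (diffD dF dG) /= opprD addrACA.
apply: le_trans (ler_normD _ _) _; rewrite (splitr e) mulrDl.
exact: lerD (EF v) (EG v).
Qed.

Lemma C1_map_comp V W X (O : set V) (O' : set W) (F : V -> W) (G : W -> X) :
  open O -> C1_map O F -> C1_map O' G -> (forall x, O x -> O' (F x)) ->
  open O' -> C1_map O (G \o F).
Proof.
move=> oO HF HG OO' oO' x Ox; have [dF cF] := HF x Ox.
have O'x := OO' x Ox; have [dG cG] := HG _ O'x.
split; first exact: (differentiable_comp dF dG).
move=> e e0.
have [k k0 Hk] := diff_linear_bound dF.
have [l l0 Hl] := diff_linear_bound dG.
(* Near [x] the derivative of [F] is bounded by [k + 1], thanks to the 1 in the minimum below; each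
   of the two terms of the product rule then costs [e / 2]. *)
have e1 : 0 < e / 2 / (k + 1) by rewrite !divr_gt0 // addr_gt0.
have e2 : 0 < Num.min 1 (e / 2 / l) by rewrite lt_min ltr01 !divr_gt0.
have near_O : \forall y \near x, O y by exact: open_nbhs_nbhs.
have contF : {for x, continuous F} by exact: differentiable_continuous.
apply: filterS3 near_O (cF _ e2) (contF _ (cG _ e1)) => y Oy EF EG v.
have {}EF := EF v; have [dFy _] := HF y Oy; have [dGy _] := HG _ (OO' y Oy).
rewrite (diff_comp dFy dGy) (diff_comp dF dG) /comp.
have -> : 'd G (F y) ('d F y v) - 'd G (F x) ('d F x v) =
  ('d G (F y) ('d F y v) - 'd G (F x) ('d F y v)) +
  'd G (F x) ('d F y v - 'd F x v) by rewrite linearB /= addrA subrK.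
apply: le_trans (ler_normD _ _) _; rewrite (splitr e) mulrDl; apply: lerD.
  apply: le_trans (EG _) _.
  have bF : `|'d F y v| <= (k + 1) * `|v|.
    rewrite -(subrK ('d F x v) ('d F y v)); apply: le_trans (ler_normD _ _) _.
    rewrite addrC mulrDl mul1r; apply: lerD (Hk v) _; apply: le_trans EF _.
    by rewrite -[leRHS]mul1r ler_wpM2r // ge_min lexx.
  rewrite mulrAC ler_pdivrMr ?addr_gt0 // -[leRHS]mulrA [`|v| * _]mulrC.
  by apply: ler_wpM2l bF; rewrite divr_ge0 // ltW.
apply: le_trans (Hl _) _; rewrite mulrC -ler_pdivlMr //.
apply: le_trans EF _; rewrite [leRHS]mulrAC; apply: ler_wpM2r => //.
by rewrite ge_min lexx orbT.
Qed.

Lemma C1_map_continuous V W (O : set V) (F : V -> W) x :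
  C1_map O F -> O x -> {for x, continuous F}.
Proof. by move=> H /H[] /differentiable_continuous. Qed.

Lemma C1_map_preimage_open V W (O : set V) (F : V -> W) (A : set W) :
  open O -> C1_map O F -> open A -> open (O `&` F @^-1` A).
Proof.
move=> oO HF oA; rewrite openE => x [Ox Ax]; apply: filterI.
  exact: open_nbhs_nbhs.
by apply: (C1_map_continuous HF Ox); exact: open_nbhs_nbhs.
Qed.

End C1Maps.

(** * Inverse function theorem for finite-dimensional perturbations of the identity *)

Section Inversion.
Context (R : realType) (V : normedModType R).

(** Existence is [finite_dim_perturbation_onto]; uniqueness, linearity and the bound 2 all come from
    |v| <= 2 |v + D v|. *)
Lemma perturbed_id_inverse k (Y : set V) (D : {linear V -> V}) :
  has_dim Y k -> (forall v, Y (D v)) -> (forall v, `|D v| <= 2^-1 * `|v|) ->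
  exists J : V -> V, [/\ linear J, forall v, J v + D (J v) = v &
    forall v, `|J v| <= 2 * `|v|].
Proof.
move=> dY YD bD.
have ex w : exists v, v + D v = w.
  have w0 := normr_ge0 w.
  (* [D] is defined everywhere, so the radius may be chosen to make |w| less than half of it. *)
  have [||||v _ <-] := @finite_dim_perturbation_onto _ _ _ _ D (2 * `|w| + 1) w
    dY.
  - by move=> x _; exact: YD.
  - by move=> x y _ _; rewrite -linearB.
  - exact: linear0.
  - by lra.
  by exists v.
have low v : `|v| <= 2 * `|v + D v|.
  have := ler_normB (v + D v) (D v); rewrite addrK; have := bD v; lra.
pose J w := xget 0 [set v | v + D v = w].
have JP w : J w + D (J w) = w.
  by apply: (@xgetPex _ 0 [set v | v + D v = w]); exact: ex.
exists J; split=> // [a u v|v]; last by have := low (J v); rewrite JP.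
apply/eqP; rewrite -subr_eq0 -normr_le0.
set z := _ - _; have := low z; suff -> : z + D z = 0 by rewrite normr0 mulr0.
have -> : D z = D (J (a *: u + v)) - (a *: D (J u) + D (J v)).
  by rewrite /z linearB linearP.
rewrite /z addrACA -opprD JP.
have -> : a *: J u + J v + (a *: D (J u) + D (J v)) = a *: u + v.
  by rewrite addrACA -scalerDr !JP.
by rewrite subrr.
Qed.

(** Difference quotients lie in [Y], and [Y] is closed. *)
Lemma diff_in_subspace k (Y O : set V) (r : V -> V) x : has_dim Y k ->
  open O -> O x -> (forall y, O y -> Y (r y)) -> differentiable r x ->
  forall v, Y ('d r x v).
Proof.
move=> dY oO Ox rY dr v; have [Y0 Ys] := has_dim_submod dY.
apply: (has_dim_closed dY) => e e0.
have v1 : 0 < `|v| + 1 by rewrite ltr_wpDl.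
have e1 : 0 < e / (`|v| + 1) by rewrite divr_gt0.
have [d d0 Hd] := differentiable_eps dr e1.
have [d' d'0 Hd'] := open_ball_in oO Ox.
pose m := Num.min d d'; have m0 : 0 < m by rewrite lt_min d0.
pose t := m / 2 / (`|v| + 1); have t0 : 0 < t by rewrite !divr_gt0.
have tv : `|t *: v| < m.
  rewrite normrZ gtr0_norm // /t mulrAC ltr_pdivrMr //.
  have := normr_ge0 v; nra.
exists (t^-1 *: (r (x + t *: v) - r x)).
  have Yr y : O y -> Y (r y) by exact: rY.
  have := Ys (t^-1) (r (x + t *: v) - r x) 0; rewrite addr0; apply => //.
  rewrite addrC -scaleN1r; apply: Ys; first exact: Yr.
  by apply/Yr/Hd'; rewrite addrC addKr; apply: lt_le_trans tv _;
    rewrite ge_min lexx orbT.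
have : `|t *: v| < d by apply: lt_le_trans tv _; rewrite ge_min lexx.
move=> /Hd; rewrite linearZ /=.
have -> : 'd r x v - t^-1 *: (r (x + t *: v) - r x) =
   - (t^-1 *: (r (x + t *: v) - r x - t *: 'd r x v)).
  by rewrite [in RHS]scalerBr scalerA mulVf ?gt_eqF // scale1r opprB.
rewrite normrN [in X in _ -> X]normrZ normfV gtr0_norm // ltr_pdivrMl // => H.
apply: le_lt_trans H _; rewrite normrZ gtr0_norm // mulrCA ltr_pM2l //.
by rewrite mulrAC ltr_pdivrMr // ltr_pM2l // ltrDl.
Qed.

(** Since ['d r 0] vanishes, [r] is Lipschitz with constant 1/2 on a small ball. There [id + r] is
    injective with Lipschitz inverse and covers the ball of half the radius, and its derivatives are
    again perturbations of the identity with values in [Y], hence invertible. *)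
Theorem finite_dim_perturbation_diffeo k (Y O : set V) (r : V -> V) :
  has_dim Y k -> open O -> O 0 -> C1_map O r ->
  (forall x, O x -> Y (r x)) -> r 0 = 0 -> (forall v, 'd r 0 v = 0) ->
  exists O1 O2 Ps, [/\ C1_diffeo O1 O2 (fun x => x + r x) Ps, O1 0 & O1 `<=` O].
Proof.
move=> dY oO O0 Cr rY r0 dr0.
have half0 : 0 < 2^-1 :> R by rewrite invr_gt0.
have [d1 d10 Hd1] := C1_map_eps Cr O0 half0.
have [d2 d20 Hd2] := open_ball_in oO O0.
pose rho := Num.min d1 d2; have rho0 : 0 < rho by rewrite lt_min d10.
have rO x : `|x| < rho -> O x.
  by rewrite lt_min => /andP[_ xd]; apply: Hd2; rewrite subr0.
have rd x v : `|x| < rho -> `|'d r x v| <= 2^-1 * `|v|.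
  rewrite lt_min => /andP[xd _]; have := Hd1 x; rewrite subr0 => /(_ xd v).
  by rewrite dr0 subr0.
have lip x y : `|x| < rho -> `|y| < rho -> `|r y - r x| <= 2^-1 * `|y - x|.
  move=> xr yr; apply: (@mean_value_ball _ _ _ r 0 rho);
    rewrite ?subr0 // => z; rewrite subr0 => zr; last by move=> v; exact: rd.
  by have [] := Cr z (rO z zr).
pose S x := x + r x.
have low x y : `|x| < rho -> `|y| < rho -> `|y - x| <= 2 * `|S y - S x|.
  move=> xr yr; have := lip x y xr yr.
  have -> : S y - S x = (y - x) + (r y - r x) by rewrite /S opprD addrACA.
  have := ler_normB (y - x + (r y - r x)) (r y - r x); rewrite addrK; lra.
have up x y : `|x| < rho -> `|y| < rho -> `|S y - S x| <= 2 * `|y - x|.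
  move=> xr yr; have := lip x y xr yr.
  have -> : S y - S x = (y - x) + (r y - r x) by rewrite /S opprD addrACA.
  have := ler_normD (y - x) (r y - r x); have := normr_ge0 (y - x); lra.
pose O2 := [set w : V | `|w| < rho / 2].
(* Cutting the ball down to the preimage of [O2] makes [O2] the exact image. *)
pose O1 := [set x : V | `|x| < rho /\ O2 (S x)].
pose Ps w := xget 0 [set z | `|z| < rho /\ S z = w].
have PsP w : O2 w -> `|Ps w| < rho /\ S (Ps w) = w.
  move=> wO; apply: (@xgetPex _ 0 [set z | `|z| < rho /\ S z = w]).
  have [||||z zr zw] := finite_dim_perturbation_onto (rho := rho) (r := r) (w
    := w) dY => //.
    by move=> x /rO /rY.
  by exists z.
have PsK x : O1 x -> Ps (S x) = x.
  move=> [xr /PsP[zr zE]]; apply/eqP; rewrite -subr_eq0 -normr_le0.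
  by have := low _ _ xr zr; rewrite zE subrr normr0 mulr0.
have oO2 : open O2.
  apply: ball_in_open => x xO; exists (rho / 2 - `|x|);
    first by rewrite subr_gt0.
  move=> y yx; rewrite /O2 /= -(subrK x y).
  by apply: le_lt_trans (ler_normD _ _) _; rewrite -ltrBrDr.
have oO1 : open O1.
  apply: ball_in_open => x [xr xO].
  exists (Num.min (rho - `|x|) ((rho / 2 - `|S x|) / 2)).
    by rewrite lt_min subr_gt0 xr divr_gt0 // subr_gt0.
  move=> y; rewrite lt_min => /andP[yx yS].
  have yr : `|y| < rho.
    by rewrite -(subrK x y); apply: le_lt_trans (ler_normD _ _) _;
      rewrite -ltrBrDr.
  split=> //; rewrite /O2 /= -(subrK (S x) (S y)).
  by apply: le_lt_trans (ler_normD _ _) _; have := up _ _ xr yr; lra.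
have O1rho x : O1 x -> `|x| < rho by case.
have PsO1 w : O2 w -> O1 (Ps w).
  by move=> wO; have [zr zE] := PsP w wO; split=> //; rewrite zE.
have Dinv w : O2 w -> exists J : V -> V, [/\ linear J,
    forall v, J v + 'd r (Ps w) (J v) = v & forall v, `|J v| <= 2 * `|v|].
  move=> wO; have [zr zE] := PsP w wO.
  apply: (perturbed_id_inverse dY) => v; last exact: rd.
  by apply: (diff_in_subspace dY oO (rO _ zr) rY); have [] := Cr _ (rO _ zr).
have dPs w J : O2 w -> linear J -> (forall v, J v + 'd r (Ps w) (J v) = v) ->
    (forall v, `|J v| <= 2 * `|v|) ->
    differentiable Ps w /\ forall v, 'd Ps w v = J v.
  move=> wO Jl JE Jb; apply: eps_differentiable => //; first by exists 2.
  move=> e e0; have [zr zE] := PsP w wO.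
  have [dr _] := Cr _ (rO _ zr).
  (* The remainder of [r] costs [e / 4], [J] contributes a factor 2, and |u| <= 2|v| another. *)
  have e4 : 0 < e / 4 by rewrite divr_gt0.
  have [d d0 Hd] := differentiable_eps dr e4.
  have [d' d'0 Hd'] := open_ball_in oO2 wO.
  exists (Num.min (d / 2) d'); first by rewrite lt_min divr_gt0.
  move=> v; rewrite lt_min => /andP[vd vd'].
  have wvO : O2 (w + v) by apply: Hd'; rewrite addrC addKr.
  have [zr' zE'] := PsP _ wvO; set z := Ps w in zr zE dr Hd JE *.
  set z' := Ps (w + v) in zr' zE' *; set u := z' - z.
  have ub : `|u| <= 2 * `|v|.
    by have := low _ _ zr zr'; rewrite zE zE' [w + v]addrC addrK.
  have ud : `|u| < d by lra.
  have := Hd u ud; have -> : z + u = z' by rewrite /u addrC subrK.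
  set q := r z' - r z - 'd r z u => qb.
  pose JL : {linear V -> V} := HB.pack J (GRing.isLinear.Build _ _ _ _ _ Jl).
  (* [J] is given as a right inverse of [id + 'd r z]; it is a left inverse because that map is
     injective. *)
  have JLi x : J (x + 'd r z x) = x.
    have : (J (x + 'd r z x) - x) + 'd r z (J (x + 'd r z x) - x) = 0.
      by rewrite linearB /= addrACA JE -opprD subrr.
    move=> h; apply/eqP; rewrite -subr_eq0 -normr_le0; move: h.
    move: (J _ - x) => y h; have := rd z y zr.
    have -> : 'd r z y = - y by apply/eqP; rewrite -addr_eq0 addrC h.
    rewrite normrN; have := normr_ge0 y; lra.
  have vE : v = (u + 'd r z u) + q.
    have -> : v = S z' - S z by rewrite zE zE' [w + v]addrC addrK.
    rewrite /S /q /u opprD addrACA -[RHS]addrA; congr (_ + _).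
    by rewrite [RHS]addrC subrK.
  have -> : J v = u + J q.
    rewrite {1}vE -[J]/(JL : V -> V) linearD /=; congr (_ + _); exact: JLi.
  rewrite opprD addrA subrr sub0r normrN.
  apply: le_trans (Jb _) _; have := normr_ge0 v; nra.
have CPs : C1_map O2 Ps.
  move=> w wO; have [J [Jl JE Jb]] := Dinv w wO.
  have [dP dPE] := dPs w J wO Jl JE Jb; split=> //.
  move=> e e0; have [zr zE] := PsP w wO.
  have e4 : 0 < e / 4 by rewrite divr_gt0.
  have [d d0 Hd] := C1_map_eps Cr (rO _ zr) e4.
  have [d' d'0 Hd'] := open_ball_in oO2 wO.
  apply/near_ballP; exists (Num.min (d / 2) d');
    first by rewrite lt_min divr_gt0.
  move=> y; rewrite lt_min => /andP[yd yd'] v.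
  have yO := Hd' y yd'; have [zr' zE'] := PsP _ yO.
  have [J' [Jl' JE' Jb']] := Dinv y yO.
  have [_ dPE'] := dPs y J' yO Jl' JE' Jb'; rewrite dPE dPE'.
  have zz : `|Ps y - Ps w| < d by have := low _ _ zr zr'; rewrite zE zE'; lra.
  have := Hd _ zz (J' v); have := Jb' v; have := rd _ (J' v - J v) zr.
  (* Subtracting the equations of [J'] and [J]: the last term is at most half of the left side and
     is absorbed, the first is small by continuity of the derivative. *)
  have E : J' v - J v = - ('d r (Ps y) (J' v) - 'd r (Ps w) (J' v)) - 'd r (Ps
    w) (J' v - J v).
    have -> : 'd r (Ps w) (J' v - J v) = 'd r (Ps w) (J' v) - 'd r (Ps w) (J v).
      exact: linearB.
    have j' : J' v = v - 'd r (Ps y) (J' v) by apply/eqP;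
      rewrite eq_sym subr_eq JE'.
    have j : J v = v - 'd r (Ps w) (J v) by apply/eqP;
      rewrite eq_sym subr_eq JE.
    rewrite {1}j' {1}j; move: ('d r (Ps y) (J' v)) ('d r (Ps w) (J' v)) => a b.
    by move: ('d r (Ps w) (J v)) => c; rewrite !opprB [LHS]addrC [RHS]addrC
      !addrA !subrK.
  move=> h1 h2 h3.
  have : `|J' v - J v| <= `|'d r (Ps y) (J' v) - 'd r (Ps w) (J' v)| + `|'d r
    (Ps w) (J' v - J v)|.
    by rewrite {1}E; apply: le_trans (ler_normB _ _) _; rewrite normrN.
  move: h1 h2 h3; have := normr_ge0 v; have := normr_ge0 (J' v).
  move: `|J' v - J v| `|'d r (Ps y) (J' v) - _| `|'d r _ (_ - _)| `|J' v| `|v|.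
  move=> a1 a2 a3 a4 a5; nra.
exists O1, O2, Ps; split; last 2 first.
- by rewrite /O1 /= /O2 /= /S r0 addr0 normr0 rho0 divr_gt0.
- by move=> x [/rO].
split=> //.
  apply/seteqP; split=> [_ [x [xr xO] <-]//|w wO].
  by have [zr zE] := PsP w wO; exists (Ps w) => //; exact: PsO1.
split=> //; have -> : (fun x => x + r x) = (idfun : V -> V) + r by [].
apply: C1_mapD => //.
  by apply: (@C1_map_lin _ _ _ _ idfun) => x; exact: cvg_id.
by apply: C1_map_sub Cr => x [/rO].
Qed.

End Inversion.

(** * Charts and transversal intersections *)

Section Charts.
Context (R : realType) (V : normedModType R).
Implicit Types (O M X W : set V) (Th Ps : V -> V).

Lemma diff_inverse (V1 V2 : normedModType R) (O : set V1) (F : V1 -> V2)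
    (G : V2 -> V1) x : open O -> O x ->
  differentiable F x -> differentiable G (F x) ->
  (forall y, O y -> G (F y) = y) -> forall v, 'd G (F x) ('d F x v) = v.
Proof.
move=> oO Ox dF dG GF v.
have [||e e0|_ /(_ v)] := @eps_differentiable _ _ _ (G \o F) x idfun.
- by move=> a u w.
- by exists 1 => w; rewrite mul1r.
- have [d d0 Hd] := open_ball_in oO Ox; exists d => // w wd.
  rewrite /= !GF //; last by apply: Hd; rewrite addrC addKr.
  by rewrite [x + w]addrC addrK subrr normr0 mulr_ge0 // ltW.
by rewrite diff_comp.
Qed.

Lemma C1_diffeo_image O O' Th Ps x : C1_diffeo O O' Th Ps -> O x -> O' (Th x).
Proof. by move=> [_ _ <- _ _] Ox; exists x. Qed.

Lemma C1_diffeoK O O' Th Ps y : C1_diffeo O O' Th Ps -> O' y ->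
  O (Ps y) /\ Th (Ps y) = y.
Proof. by move=> [_ _ <- K _] [x Ox <-]; rewrite K. Qed.

(** Turns the image equations of [adapted_chart] into a pointwise criterion, convenient when charts
    are composed or restricted. *)
Lemma flattened_iff O O' Th Ps X M : C1_diffeo O O' Th Ps ->
  Th @` (O `&` X) = O' `&` M <-> forall x, O x -> (X x <-> M (Th x)).
Proof.
move=> dg; have [_ _ _ K _] := dg; split=> [E x Ox|H].
  split=> [Xx|Mx].
    have : (O' `&` M) (Th x) by rewrite -E; exists x.
    by case.
  have : (Th @` (O `&` X)) (Th x) by rewrite E; split=> //;
    exact: C1_diffeo_image dg Ox.
  by move=> [y [Oy Xy] e]; have := congr1 Ps e; rewrite !K // => <-.
apply/seteqP; split=> [z [x [Ox Xx] <-]|y [Hy My]].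
  split; first exact: C1_diffeo_image dg Ox.
  by apply/H.
have [ OP E] := C1_diffeoK dg Hy.
by exists (Ps y) => //; split=> //; apply/H; rewrite ?E.
Qed.

Lemma split_subspace_submod M : split_subspace M ->
  M 0 /\ forall (a : R) u v, M u -> M v -> M (a *: u + v).
Proof.
move=> [pi [_ _ ->]]; split; first by exists 0; rewrite ?linear0.
by move=> a u v [u' _ <-] [v' _ <-]; exists (a *: u' + v'); rewrite ?linearP.
Qed.

(** With derivative the identity at 0, the model space [M'] is the tangent space itself. *)
Definition normal_chart X W O O' Th Ps M M' :=
  [/\ C1_diffeo O O' Th Ps, O 0 /\ Th 0 = 0,
      (forall v, 'd Th 0 v = v) /\ (forall v, 'd Ps 0 v = v),
      forall x, O x -> (X x <-> M (Th x)) /\ (W x <-> M' (Th x)) &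
      split_subspace M /\ split_subspace M' /\ M' `<=` M].

(** The chart is translated by its value at 0 and followed by the derivative of its inverse; the
    model spaces are pulled back accordingly. *)
Lemma normalize_chart X W M M' : W `<=` X -> W 0 ->
  split_subspace M -> split_subspace M' -> M' `<=` M ->
  adapted_chart X W 0 M M' ->
  exists O O' Th Ps M1 M1', normal_chart X W O O' Th Ps M1 M1'.
Proof.
move=> WX W0 sM sM' M'M [ O [ O' [Th [Ps [dg O0 EX EW]]]]].
have HX := (flattened_iff X M dg).1 EX; have HW := (flattened_iff W M' dg).1 EW.
have [oO oO' _ K [CT CP]] := dg.
set q := Th 0.
have Oq : O' q by exact: C1_diffeo_image dg O0.
have Mq' : M' q by apply/HW.
have [dTh _] := CT _ O0; have [dPs _] := CP _ Oq.
pose A : {linear V -> V} := 'd Th 0; pose B : {linear V -> V} := 'd Ps q.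
have cA : continuous A by exact: diff_continuous.
have cB : continuous B by exact: diff_continuous.
have BA v : B (A v) = v by exact: diff_inverse dTh dPs K v.
have AB v : A (B v) = v.
  have Pq : Ps q = 0 by exact: K.
  have := @diff_inverse _ _ O' Ps Th q oO' Oq dPs; rewrite Pq; apply => //.
  by move=> y /(C1_diffeoK dg)[].
pose Th' x := B (Th x - q); pose Ps' z := Ps (A z + q).
pose O'' := [set z | O' (A z + q)].
have CA : C1_map setT ((A : V -> V) + cst q).
  exact: (C1_mapD openT (C1_map_lin cA) (@C1_map_cst _ _ _ _ _)).
have oO'' : open O''.
  have := C1_map_preimage_open openT CA oO'; rewrite setTI.
  by congr open.
have CTq : C1_map O (Th + cst (- q)).
  exact: (C1_mapD oO CT (@C1_map_cst _ _ _ _ _)).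
have CT' : C1_map O Th'.
  exact: (C1_map_comp oO CTq (C1_map_lin (O := setT) cB) (fun _ _ =>
    Logic.I) openT).
have CP' : C1_map O'' Ps'.
  have CA' : C1_map O'' ((A : V -> V) + cst q) by apply: (C1_map_sub _ CA).
  exact: (C1_map_comp oO'' CA' CP (fun _ Hz => Hz) oO').
have K' x : O x -> Ps' (Th' x) = x by move=> Ox; rewrite /Ps' /Th' AB subrK K.
have dg' : C1_diffeo O O'' Th' Ps'.
  split=> //; apply/seteqP; split=> [_ [x Ox <-]|z zO].
    by rewrite /O'' /= /Th' AB subrK; exact: C1_diffeo_image dg Ox.
  have [ OP E] := C1_diffeoK dg zO; exists (Ps' z) => //.
  by rewrite /Th' /Ps' E addrK BA.
have Th0' : Th' 0 = 0 by rewrite /Th' subrr linear0.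
have [sub0 subM] := split_subspace_submod sM.
have [sub0' subM'] := split_subspace_submod sM'.
have dTh' v : 'd Th' 0 v = v.
  have -> : Th' = B \o (Th + cst (- q)) by [].
  have dc : differentiable (cst (- q) : V -> V) 0 by exact: differentiable_cst.
  have dB : differentiable B ((Th + cst (- q)) 0) by exact:
    linear_differentiable.
  rewrite (diff_comp (differentiableD dTh dc) dB) /=.
  by rewrite (diff_lin _ cB) (diffD dTh dc) diff_cst /= addr0; exact: BA.
have dPs' v : 'd Ps' 0 v = v.
  have [dT _] := CT' 0 O0.
  have O''0 : O'' 0 by rewrite /O'' /= linear0 add0r.
  have [dP _] := CP' 0 O''0.
  have := @diff_inverse _ _ O Th' Ps' 0 oO O0 dT; rewrite Th0' => /(_ dP K' v).
  by move: dTh' => ->.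
(* Conjugating the projection onto [N] by [A] gives a projection onto the preimage of [N]. *)
have split' N : split_subspace N -> split_subspace [set z | N (A z)].
  move=> [pi [cpi pp NE]]; exists (B \o (pi \o A)); split.
  - move=> x; apply: (@continuous_comp _ _ _ (pi \o A) B).
      by apply: continuous_comp; [exact: cA|exact: cpi].
    exact: cB.
  - by move=> x /=; rewrite AB pp.
  - apply/seteqP; split=> [z|_ [x _ <-]] /=; rewrite NE.
      by move=> [y _ yE]; exists z => //=; rewrite -yE pp yE BA.
    by exists (A x) => //; rewrite AB.
(* [A (Th' x)] is [Th x - q], and subtracting [q] does not affect membership since [q] lies in
   [N]. *)
have sh N x : (forall a u v, N u -> N v -> N (a *: u + v)) -> N q ->
    (N (Th x) <-> N (A (Th' x))).
  move=> sN Nq; rewrite /Th' AB; split=> h.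
    by rewrite addrC -scaleN1r; apply: sN.
  by rewrite -(subrK q (Th x)) -[X in X + q]scale1r; apply: sN.
exists O, O'', Th', Ps', [set z | M (A z)], [set z | M' (A z)]; split=> //.
- move=> x Ox; split.
    by apply: iff_trans (HX x Ox) (sh M x subM _); exact: M'M.
  exact: iff_trans (HW x Ox) (sh M' x subM' _).
- by split; [exact: split'|split; [exact: split'|move=> z /M'M]].
Qed.

(** Inverse chart images of straight lines realise tangent vectors with the regularity that
    [tangent_space] demands. *)
Lemma line_curve O' Ps m : open O' -> C1_map O' Ps -> O' 0 ->
  \forall t \near (0 : R), [/\ O' (t *: m),
     differentiable (fun s : R => Ps (s *: m)) t,
     (fun s : R => Ps (s *: m))^`()%classic t = 'd Ps (t *: m) m &
     {for t, continuous (fun s : R => Ps (s *: m))^`()%classic}].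
Proof.
move=> oO' CP O'0; set c := fun s : R => _.
pose g : R -> V := *:%R ^~ m.
have cg : continuous g by exact: scalel_continuous.
have oU : open (g @^-1` O') by apply: open_comp => // x _; exact: cg.
have U0 : (g @^-1` O') 0 by rewrite /g /= scale0r.
have dc t : O' (g t) -> differentiable c t /\ c^`()%classic t = 'd Ps (g t) m.
  move=> Ot; have [dP _] := CP _ Ot.
  have dg : differentiable g t by exact: ex_diff.
  have dc : differentiable c t by exact: (@differentiable_comp _ _ _ _ g Ps).
  split=> //; rewrite derive1E' //.
  rewrite -[c]/(Ps \o g) (diff_comp dg dP) /=; congr ('d Ps _ _).
  have -> : 'd g t = g :> (R -> V) by exact: diff_val.
  by rewrite /g scale1r.
have : \forall t \near (0 : R), (g @^-1` O') t by exact: open_nbhs_nbhs.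
apply: filterS => t Ut; have [dct cE] := dc t Ut; split=> //.
have nU : \forall s \near t, (g @^-1` O') s by exact: open_nbhs_nbhs.
apply/cvgrPdistC_lt => e e0; rewrite cE.
have [_ CPt] := CP _ Ut.
have e1 : 0 < e / (`|m| + 1) by rewrite divr_gt0 // ltr_wpDl.
have H : \forall s \near t, forall v, `|'d Ps (g s) v - 'd Ps (g t) v| <= e /
  (`|m| + 1) * `|v|.
  exact: (cg t _ (CPt _ e1)).
apply: filterS2 nU H => s Us H.
rewrite (dc s Us).2; apply: le_lt_trans (_ : e / (`|m| + 1) * `|m| < e).
  exact: H.
by rewrite mulrAC ltr_pdivrMr ?ltr_wpDl // ltr_pM2l // ltrDl.
Qed.

(** A curve in [W] has its chart image in [M'], and the chart does not change velocities at 0;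
    conversely [line_curve] realises each vector of [M']. *)
Lemma tangent_space_normal_chart X W O O' Th Ps M M' :
  normal_chart X W O O' Th Ps M M' -> tangent_space W 0 = M'.
Proof.
move=> [dg [ O0 Th0] [dTh dPs] HW [sM [sM' M'M]]].
have [oO oO' _ K [CT CP]] := dg.
have O'0 : O' 0 by rewrite -Th0; exact: C1_diffeo_image dg O0.
have P0 : Ps 0 = 0 by rewrite -{1}Th0 K.
have [sub0 subM] := split_subspace_submod sM'.
have [pi [cpi pp ME]] := sM'.
have Mfix x : M' x -> pi x = x by rewrite ME => -[y _ <-].
apply/seteqP; split=> [v [c [c0 Hc <-]]|m M'm].
  have [_ dc _] := nbhs_singleton Hc.
  have {}dc : differentiable c 0 by apply/derivable1_diffP.
  rewrite derive1E' //.
  have dT : differentiable Th (c 0) by rewrite c0; case: (CT _ O0).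
  have cc : {for 0, continuous c} by exact: differentiable_continuous.
  suff : pi ('d c 0 1) - 'd c 0 1 = 0.
    by move=> /eqP; rewrite subr_eq0 => /eqP <-; rewrite ME; exists ('d c 0 1).
  (* [L] vanishes on [M'], so [L \o (Th \o c)] is zero near 0, while its derivative there is [L]
     applied to the velocity of [c]. *)
  pose L : {linear V -> V} := pi \- idfun.
  have GM x : M' x -> L x = 0 by move=> /Mfix; rewrite /L /= => ->;
    rewrite subrr.
  have cL : continuous L by move=> x; apply: cvgB; [exact: cpi|exact: cvg_id].
  have nO : \forall t \near (0 : R), O (c t).
    by apply: cc; rewrite c0; exact: open_nbhs_nbhs.
  have dLx : differentiable L (Th (c 0)) by exact: linear_differentiable.
  have dF : 'd (L \o (Th \o c)) 0 1 = L ('d c 0 1).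
    rewrite (diff_comp (differentiable_comp dc dT) dLx) /= (diff_lin _ cL).
    by rewrite (diff_comp dc dT) /= c0 dTh.
  rewrite -[LHS]/(L ('d c 0 1)) -dF.
  have [||e e0|_ /(_ 1) -> //] := @eps_differentiable _ _ _ (L \o (Th \o c)) (0
    : R) (cst 0).
  - by move=> a x y; rewrite /cst scaler0 addr0.
  - by exists 0 => x; rewrite mul0r normr0.
  have /near_ballP[d d0 Hd] : \forall t \near (0 : R), O (c t) /\ W (c t).
    by apply: filterS2 nO Hc => t Ot [Wt _ _].
  exists d => // t td.
  have z s : O (c s) /\ W (c s) -> L (Th (c s)) = 0.
    by move=> [Os Ws]; apply: GM; apply/(HW _ Os).2.
  have E0 : (L \o (Th \o c)) 0 = 0.
    by apply: z; apply: Hd; rewrite subrr normr0.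
  have Et : (L \o (Th \o c)) (0 + t) = 0.
    by apply: z; apply: Hd; rewrite addrC addKr.
  by rewrite E0 Et /cst !subr0 normr0 mulr_ge0 // ltW.
exists (fun s : R => Ps (s *: m)); split.
- by rewrite scale0r.
- have := line_curve m oO' CP O'0; apply: filterS => t [ Ot dt _ ct]; split=>
  //.
    have [ OP E] := C1_diffeoK dg Ot; apply/(HW _ OP).2; rewrite E.
    by have := subM t m 0 M'm sub0; rewrite addr0.
  by apply/derivable1_diffP.
- have [_ _ -> _] := nbhs_singleton (line_curve m oO' CP O'0).
  by rewrite scale0r dPs.
Qed.

End Charts.

Section TransversalIntersection.
Context (R : realType) (V : normedModType R).

(* With normalised charts [Th1] of [Wcs] and [Th2] of [Wcu], the map
   [z |-> z - piu z - pic z + pic x + piu (Th1 x)], [x = Th2^-1 z], is the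
   identity up to a perturbation in the finite dimensional space Y; on Wcu its
   center component is [pic x] while its unstable component vanishes precisely
   on Wcs. *)
Lemma transversal_flattening (X Wcs Wcu T N : set V) (piu pic : {linear V -> V})
    (k : nat) :
  let Y := [set x | piu x + pic x = x] in
  continuous piu -> continuous pic ->
  (forall x, piu (piu x) = piu x) -> (forall x, pic (pic x) = pic x) ->
  (forall x, piu (pic x) = 0) -> (forall x, pic (piu x) = 0) ->
  has_dim Y k ->
  (forall c : R -> V, c 0 = 0 -> (\forall t \near (0 : R), X (c t)) ->
     differentiable c 0 -> T ('d c 0 1)) ->
  submanifold X Wcs -> submanifold X Wcu -> Wcs 0 -> Wcu 0 ->
  tangent_space Wcs 0 = [set x | piu x = 0 /\ T x] ->
  tangent_space Wcu 0 = Y ->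
  open N -> N 0 ->
  exists O O' Th Ps M,
    [/\ C1_diffeo O O' Th Ps,
        [/\ O 0, O `<=` N, Th 0 = 0 & forall v, 'd Ps 0 v = v],
        split_subspace M /\ (forall x, M (pic x)),
        forall x, O x -> (X x <-> M (Th x)) &
        forall x, O x -> (Wcs x /\ Wcu x <-> pic (Th x) = Th x) /\
                         (Wcs x -> Wcu x -> Th x = pic x)].
Proof.
move=> Y cu cc uu cc' uc cu' dY HT [WsX subs] [WuX subu] Ws0 Wu0 Ts Tu oN N0.
have [Ms [Ms' [sMs [sMs' MM] _ ads]]] := subs 0 Ws0.
have [Mu [Mu' [sMu [sMu' MMu] _ adu]]] := subu 0 Wu0.
have {Ms Ms' sMs sMs' MM ads} [ O1 [ O1' [Th1 [Ps1 [M1 [M1' nc1]]]]]] :=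
  normalize_chart WsX Ws0 sMs sMs' MM ads.
have {Mu Mu' sMu sMu' MMu adu} [ O2 [ O2' [Th2 [Ps2 [M2 [M2' nc2]]]]]] :=
  normalize_chart WuX Wu0 sMu sMu' MMu adu.
have E1 := tangent_space_normal_chart nc1; rewrite Ts in E1.
have E2 := tangent_space_normal_chart nc2; rewrite Tu in E2.
move: nc1 => [dg1 [ O10 Th10] [dTh1 dPs1] H1 [sM1 _]].
move: nc2 => [dg2 [ O20 Th20] [dTh2 dPs2] H2 [sM2 [sM2' M2M]]].
subst M1' M2'.
have [oO1 oO1' _ K1 [CT1 CP1]] := dg1.
have [oO2 oO2' _ K2 [CT2 CP2]] := dg2.
have O1'0 : O1' 0 by rewrite -Th10; exact: C1_diffeo_image dg1 O10.
have O2'0 : O2' 0 by rewrite -Th20; exact: C1_diffeo_image dg2 O20.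
have P10 : Ps1 0 = 0 by rewrite -{1}Th10 K1.
have P20 : Ps2 0 = 0 by rewrite -{1}Th20 K2.
have [M10 subM1] := split_subspace_submod sM1.
have [M20 subM2] := split_subspace_submod sM2.
have [Y0 subY] := has_dim_submod dY.
(* Lines in [M1] give curves in [X], whose velocities lie in [T]. This supplies the second condition
   in the model space of [Wcs]. *)
have M1T m : M1 m -> T m.
  move=> M1m; have L := line_curve m oO1' CP1 O1'0.
  have [_ dc cE _] := nbhs_singleton L.
  have := HT (fun s => Ps1 (s *: m)); rewrite scale0r => /(_ P10).
  have -> : 'd (fun s : R => Ps1 (s *: m)) 0 1 = m.
    by rewrite -[LHS]derive1E' // cE scale0r dPs1.
  apply=> //; apply: filterS L => t [ Ot _ _ _].
  have [ OP E] := C1_diffeoK dg1 Ot; apply/(H1 _ OP).1; rewrite E.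
  by have := subM1 t m 0 M1m M10; rewrite addr0.
have lL : linear (fun z => - (piu z + pic z)).
  by move=> a x y; rewrite !linearP /= addrACA -scalerDr opprD scalerN.
pose L : {linear V -> V} := HB.pack (fun z => - (piu z + pic z))
  (GRing.isLinear.Build _ _ _ _ _ lL).
have cL : continuous L.
  by move=> x; apply: cvgN; apply: cvgD; [exact: cu|exact: cc].
pose Od := O2' `&` Ps2 @^-1` (O1 `&` N).
have oOd : open Od by apply: C1_map_preimage_open => //; exact: openI.
have Od0 : Od 0 by split=> //=; rewrite P20.
have Od1 z : Od z -> O1 (Ps2 z) by case=> _ [].
have CPd : C1_map Od Ps2 by apply: C1_map_sub CP2 => z [].
have C1a : C1_map Od (pic \o Ps2).
  exact: (C1_map_comp oOd CPd (C1_map_lin (O := setT) cc) (fun _ _ =>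
    Logic.I) openT).
have C1b : C1_map Od (Th1 \o Ps2) by exact: (C1_map_comp oOd CPd CT1 Od1 oO1).
have C1c : C1_map Od (piu \o (Th1 \o Ps2)).
  exact: (C1_map_comp oOd C1b (C1_map_lin (O := setT) cu) (fun _ _ =>
    Logic.I) openT).
(* Both charts have derivative the identity at 0, so the first two terms differentiate to [pic] and
   [piu] there and [L] cancels them. *)
pose r := (pic \o Ps2) + ((piu \o (Th1 \o Ps2)) + (L : V -> V)).
have Cr : C1_map Od r.
  exact: (C1_mapD oOd C1a (C1_mapD oOd C1c (C1_map_lin cL))).
have rE z : r z = pic (Ps2 z) + (piu (Th1 (Ps2 z)) - (piu z + pic z)) by [].
have Yu x : Y (piu x) by rewrite /Y /= uu cu' addr0.
have Yc x : Y (pic x) by rewrite /Y /= cc' uc add0r.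
have YD x y : Y x -> Y y -> Y (x + y).
  by move=> Yx Yy; have := subY 1 x y Yx Yy; rewrite scale1r.
have YN x : Y x -> Y (- x).
  by move=> Yx; have := subY (-1) x 0 Yx Y0; rewrite scaleN1r addr0.
have rY z : Y (r z).
  by rewrite rE; do 2 apply: (YD _ _) => //; apply: (YN _); exact: (YD _ _).
have r0 : r 0 = 0 by rewrite rE P20 Th10 (linear0 piu) (linear0 pic) !addr0
  subrr addr0.
have dr0 v : 'd r 0 v = 0.
  have [da _] := C1a _ Od0; have [db _] := C1b _ Od0; have [dc _] := C1c _ Od0.
  have [dP _] := CPd _ Od0.
  have dL : differentiable L 0 by exact: linear_differentiable.
  have dT : differentiable Th1 (Ps2 0) by rewrite P20; case: (CT1 _ O10).
  have dcc : differentiable pic (Ps2 0) by exact: linear_differentiable.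
  have duu : differentiable piu ((Th1 \o Ps2) 0) by exact:
    linear_differentiable.
  have Ea : 'd (pic \o Ps2) 0 v = pic v.
    by rewrite (diff_comp dP dcc) /= (diff_lin _ cc) dPs2.
  have Eb : 'd (piu \o (Th1 \o Ps2)) 0 v = piu v.
    rewrite (diff_comp db duu) /= (diff_lin _ cu) (diff_comp dP dT) /=.
    by rewrite P20 dTh1 dPs2.
  rewrite (diffD da (differentiableD dc dL)) (diffD dc dL) /=.
  rewrite Ea Eb (diff_lin _ cL) addrA [pic v + _]addrC; exact: subrr.
have [A1 [A2 [Q [dgS A10 A1O]]]] :=
  finite_dim_perturbation_diffeo dY oOd Od0 Cr (fun z _ => rY z) r0 dr0.
have [oA1 oA2 _ KS [CS CQ]] := dgS.
pose S z := z + r z.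
have SE z : S z = (z - (piu z + pic z)) + (pic (Ps2 z) + piu (Th1 (Ps2 z))).
  by rewrite /S rE -[RHS]addrA; congr (_ + _); rewrite [RHS]addrC addrA.
have S0 : S 0 = 0 by rewrite /S r0 addr0.
pose O3 := O2 `&` Th2 @^-1` A1.
have oO3 : open O3 by exact: (C1_map_preimage_open oO2 CT2 oA1).
have A1O2' z : A1 z -> O2' z by move=> /A1O[].
have CT3 : C1_map O3 (S \o Th2).
  have CT23 : C1_map O3 Th2 by apply: C1_map_sub CT2 => x [].
  exact: (C1_map_comp oO3 CT23 CS (fun x (Hx : O3 x) => Hx.2) oA1).
have QA1 y : A2 y -> A1 (Q y) /\ S (Q y) = y.
  by move=> A2y; exact: (C1_diffeoK dgS A2y).
have CP3 : C1_map A2 (Ps2 \o Q).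
  exact: (C1_map_comp oA2 CQ CP2 (fun y Hy => A1O2' _ (QA1 y Hy).1) oO2').
have K3 x : O3 x -> Ps2 (Q (S (Th2 x))) = x.
  by move=> [ O2x A1x]; rewrite KS // K2.
have dg3 : C1_diffeo O3 A2 (S \o Th2) (Ps2 \o Q).
  split=> //; apply/seteqP; split=> [z [x [ O2x A1x] <-]|y A2y].
    by exact: (C1_diffeo_image dgS A1x).
  have [A1Q SQ] := QA1 y A2y; have [ OP TP] := C1_diffeoK dg2 (A1O2' _ A1Q).
  by exists (Ps2 (Q y)); rewrite /= ?TP //; split=> //=; rewrite TP.
have O30 : O3 0 by split=> //=; rewrite Th20.
exists O3, A2, (S \o Th2), (Ps2 \o Q), M2; split.
- exact: dg3.
- have Th30 : (S \o Th2) 0 = 0 by rewrite /= Th20.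
  split; [exact: O30| |exact: Th30|].
    by move=> x [ O2x /A1O[_ []]]; rewrite /= K2.
  move=> v; have [dT3 _] := CT3 _ O30.
  have A20 : A2 0 by rewrite -Th30; exact: C1_diffeo_image dg3 O30.
  have [dP3 _] := CP3 _ A20.
  have := @diff_inverse _ _ _ O3 (S \o Th2) (Ps2 \o Q) 0 oO3 O30 dT3.
  rewrite Th30 => /(_ dP3 K3 v).
  have dS : differentiable S (Th2 0) by rewrite Th20; case: (CS _ A10).
  have dT : differentiable Th2 0 by case: (CT2 _ O20).
  have dr : differentiable r 0 by case: (Cr _ Od0).
  have di : differentiable (id : V -> V) 0 by exact: ex_diff.
  have eS : 'd (id + r) 0 v = 'd (id : V -> V) 0 v + 'd r 0 v.
    by rewrite (diffD di dr).
  have eid : 'd (id : V -> V) 0 = id :> (V -> V) by exact: diff_val.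
  have e3 : 'd (S \o Th2) 0 v = 'd S (Th2 0) ('d Th2 0 v).
    by rewrite (diff_comp dT dS).
  have -> : 'd (S \o Th2) 0 v = v; last by [].
  by rewrite e3 Th20 dTh2; apply: etrans eS _; rewrite eid dr0 addr0.
- by split=> // x; apply: M2M; exact: Yc.
(* [S] alters [Th2 x] by an element of [Y], hence of [M2]: the model space of [X] is kept. *)
- move=> x [ O2x A1x]; apply: (iff_trans (H2 x O2x).1).
  have M2r : M2 (r (Th2 x)) by apply: M2M.
  split=> h.
    by have := subM2 1 _ _ h M2r; rewrite scale1r.
  have := subM2 (-1) _ _ M2r h; rewrite scaleN1r /= /S.
  by rewrite addrC addrK.
move=> x [ O2x A1x] /=.
have [_ [ O1x _]] := A1O _ A1x; rewrite K2 // in O1x.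
have [HX1 HW1] := H1 x O1x; have [HX2 HW2] := H2 x O2x.
set z := Th2 x in A1x HX2 HW2 *.
have Pz : Ps2 z = x by exact: K2.
have cond : Wcs x -> Wcu x -> S z = pic x.
  move=> /HW1[u0 _] /HW2 Yz; rewrite SE Pz u0 addr0.
  by have -> : piu z + pic z = z by []; rewrite subrr add0r.
split=> //; split=> [[ws wu]|h]; first by rewrite cond // cc'.
(* If [pic] fixes [S z], then [z = S z - r z] lies in [Y], which means [Wcu x]. The unstable
   component of [S z] is then [piu (Th1 x)] and vanishes, which together with [M1T] means
   [Wcs x]. *)
have Yz : Y z.
  have -> : z = S z + - r z by rewrite /S addrK.
  by apply: YD; [rewrite -h; exact: Yc|exact: YN].
have wu : Wcu x by apply/HW2.
split=> //; apply/HW1; split; last by apply: M1T; apply/HX1; exact: WuX.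
have ES : S z = pic x + piu (Th1 x).
  by rewrite SE Pz (_ : piu z + pic z = z) // subrr add0r.
have := congr1 piu h; rewrite uc ES linearD /= uc add0r uu.
by move=> <-.
Qed.

End TransversalIntersection.

(** * The intersection as a graph over the center space *)

Section CenterGraph.
Context (R : realType) (V : normedModType R).

Lemma C1_map_C1_map_in (W : normedModType R) (M O O' : set V) (w : V -> W) :
  C1_map O' w -> O `<=` O' -> C1_map_in M O w (fun x v => 'd w x v).
Proof.
move=> Cw OO' x /OO' O'x; have [dw _] := Cw x O'x; split.
- by move=> a u v _ _; exact: linearP.
- by have [K _ HK] := diff_linear_bound dw; exists K.
- move=> e e0; have [d d0 Hd] := differentiable_eps dw e0.
  by exists d => // v _; exact: Hd.
- move=> e e0; have [d d0 Hd] := C1_map_eps Cw O'x e0.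
  by exists d => // y _ yd v _; exact: Hd.
Qed.

Lemma C1_diffeo_restrict (O O' A : set V) (Th Ps : V -> V) : open A ->
  C1_diffeo O O' Th Ps -> C1_diffeo (O `&` A) (O' `&` Ps @^-1` A) Th Ps.
Proof.
move=> oA dg; have [oO oO' _ K [CT CP]] := dg; split.
- exact: openI.
- exact: (C1_map_preimage_open oO' CP oA).
- apply/seteqP; split=> [z [x [ Ox Ax] <-]|y [Hy Ay]].
    by split; [exact: C1_diffeo_image dg Ox|rewrite /= K].
  have [ OP E] := C1_diffeoK dg Hy.
  by exists (Ps y).
- by move=> x [ Ox _]; exact: K.
- by split; [apply: C1_map_sub CT => x []|apply: C1_map_sub CP => x []].
Qed.

(** On the range of [pic] the inverse chart satisfies [pic (Ps c) = c], so [Ps - id] takes values in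
    the kernel of [pic] and serves as [wc]; its derivative at 0 vanishes because that of [Ps] is the
    identity. *)
Lemma center_graph (X Wcs Wcu N O O' M : set V) (Th Ps : V -> V)
    (pic : {linear V -> V}) :
  continuous pic -> (forall x, pic (pic x) = pic x) ->
  C1_diffeo O O' Th Ps -> O 0 -> O `<=` N -> Th 0 = 0 ->
  (forall v, 'd Ps 0 v = v) ->
  split_subspace M -> (forall x, M (pic x)) ->
  (forall x, O x -> (X x <-> M (Th x))) ->
  (forall x, O x -> (Wcs x /\ Wcu x <-> pic (Th x) = Th x) /\
                    (Wcs x -> Wcu x -> Th x = pic x)) ->
  Wcs `<=` X ->
  exists (Cc0 Csu0 : set V) (wc : V -> V) (Dwc : V -> V -> V),
    let Nc := sumset Cc0 Csu0 in
    let Wc := [set phi + wc phi | phi in Cc0] in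
    [/\ open_nbhd0_in (range pic) Cc0, open_nbhd0_in [set x | pic x = 0] Csu0 &
        Nc `<=` N] /\
    [/\ forall phi, Cc0 phi -> Csu0 (wc phi),
        C1_map_in (range pic) Cc0 wc Dwc,
        wc 0 = 0 &
        forall chi, Dwc 0 chi = 0] /\
    Wc = Wcs `&` Wcu `&` Nc /\
    submanifold_modelled_in (fun M' => M' = range pic) X Wc.
Proof.
move=> cc cc' dg O0 ON Th0 dP sM Mc HX HW WsX.
have [oO oO' _ K [CT CP]] := dg.
have O'0 : O' 0 by rewrite -Th0; exact: C1_diffeo_image dg O0.
have P0 : Ps 0 = 0 by rewrite -{1}Th0 K.
have rc x : range pic x <-> pic x = x.
  by split=> [[y _ <-]|<-]; [exact: cc'|exists x].
have [e e0 He] := open_ball_in oO O0.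
have e2 : 0 < e / 2 by rewrite divr_gt0.
have lN : linear (fun z : V => - z).
  by move=> a x y; rewrite opprD scalerN.
pose L : {linear V -> V} := HB.pack (fun z : V => - z)
  (GRing.isLinear.Build _ _ _ _ _ lN).
have cL : continuous L by move=> x; apply: cvgN; exact: cvg_id.
pose wc := Ps + (L : V -> V).
have wcE x : wc x = Ps x - x by [].
have Cwc : C1_map O' wc by exact: (C1_mapD oO' CP (C1_map_lin cL)).
have dwc0 v : 'd wc 0 v = 0.
  have [dP0 _] := CP _ O'0.
  have dL : differentiable L 0 by exact: linear_differentiable.
  by rewrite (diffD dP0 dL) (diff_lin _ cL) /= dP subrr.
(* Two summands in [B] add up to a point of the ball of radius [e], hence of [O]. *)
pose B := [set x : V | `|x| < e / 2].
have oB : open B.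
  apply: ball_in_open => x xB; exists (e / 2 - `|x|); first by rewrite subr_gt0.
  move=> y yx; rewrite /B /= -(subrK x y).
  by apply: le_lt_trans (ler_normD _ _) _; rewrite -ltrBrDr.
(* Besides making [wc] C^1, the restriction keeps the values of [wc] in [B], so that the graph stays
   in [Nc]. *)
pose A := B `&` (O' `&` wc @^-1` B).
have oA : open A by apply: openI => //; exact: (C1_map_preimage_open oO' Cwc
  oB).
have wc0 : wc 0 = 0 by rewrite wcE P0 subr0.
have B0 : B 0 by rewrite /B /= normr0.
have A0 : A 0 by split=> //; split=> //=; rewrite wc0.
pose Cc0 := range pic `&` A; pose Csu0 := [set x | pic x = 0] `&` B.
pose Nc := sumset Cc0 Csu0.
have NcE : Nc = [set x | A (pic x) /\ B (x - pic x)].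
  apply/seteqP; split=> [x [c [/rc pc Ac] [s [ps Bs] <-]]|x [Ax Bx]] /=.
    by rewrite linearD /= pc ps addr0 [c + s]addrC addrK.
  exists (pic x); first by split=> //; exists x.
  exists (x - pic x); last by rewrite addrC subrK.
  by split=> //=; rewrite linearB /= cc' subrr.
have oNc : open Nc.
  rewrite NcE; apply: openI; first by apply: open_comp => // x _; exact: cc.
  apply: (@open_comp _ _ (fun x => x - pic x)) => // x _.
  by apply: cvgB; [exact: cvg_id|exact: cc].
have NcO : Nc `<=` O.
  rewrite NcE => x [[pB _] xB]; apply: He; rewrite subr0 -(subrK (pic x) x).
  by apply: le_lt_trans (ler_normD _ _) _; rewrite [ltRHS]splitr ltrD.
have Ps_graph c : pic c = c -> O' c -> [/\ O (Ps c), Wcs (Ps c), Wcu (Ps c) &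
  pic (Ps c) = c].
  move=> pc O'c; have [ OP TP] := C1_diffeoK dg O'c.
  have [H1 H2] := HW _ OP; rewrite TP in H1 H2.
  by have [ws wu] := H1.2 pc; split=> //; rewrite -(H2 ws wu).
have wcC c : Cc0 c -> Csu0 (wc c).
  move=> [/rc pc [_ [ O'c Bc]]]; split=> //=.
  have [_ _ _ pP] := Ps_graph c pc O'c.
  by rewrite wcE linearB /= pP pc subrr.
pose Wc := [set phi + wc phi | phi in Cc0].
have WcE : Wc = Wcs `&` Wcu `&` Nc.
  apply/seteqP; split=> [x [c Cc <-]|x [[ws wu] Nx]].
    have [/rc pc [_ [ O'c Bc]]] := Cc.
    have -> : c + wc c = Ps c by rewrite wcE addrC subrK.
    have [_ ws wu _] := Ps_graph c pc O'c; split=> //.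
    by exists c => //; exists (wc c); [exact: wcC|rewrite wcE addrC subrK].
  (* On the intersection [Th x = pic x], so [x = Ps (pic x)] is the point of the graph above
     [pic x]. *)
  have Ox := NcO _ Nx; have [_ H2] := HW x Ox; have TE := H2 ws wu.
  exists (pic x).
    by move: Nx; rewrite NcE => -[Ax _]; split=> //; exists x.
  by rewrite wcE addrC subrK -TE K.
exists Cc0, Csu0, wc, (fun x v => 'd wc x v); split; last split; last split.
- split.
  + by split; [split=> //; exists 0 => //; rewrite linear0|exists A].
  + by split; [split=> //=; rewrite linear0|exists B].
  + exact: subset_trans NcO ON.
- split=> //; apply: C1_map_C1_map_in Cwc _.
  by move=> c [_ [_ []]].
- exact: WcE.
rewrite -/Wc; split.
  by rewrite WcE => x [[ws _] _]; exact: WsX.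
move=> p Wp; have Np : Nc p by move: Wp; rewrite WcE => -[].
exists M, (range pic); split=> //.
  by split; [exists pic|move=> _ [x _ <-]].
(* The chart at 0, restricted to [Nc], serves at every point of [Wc]. *)
have dg' := C1_diffeo_restrict oNc dg.
exists (O `&` Nc), (O' `&` Ps @^-1` Nc), Th, Ps; split=> //.
- by split=> //; exact: NcO.
- by apply: (flattened_iff X M dg').2 => x [ Ox _]; exact: HX.
apply: (flattened_iff Wc _ dg').2 => x [ Ox Nx].
have [H1 _] := HW x Ox; rewrite WcE; apply: iff_trans (iff_sym (rc _)).
by apply: iff_trans H1; split=> [[]|].
Qed.

End CenterGraph.

(** * Spectral projections *)

(** Among the matrices whose rows are values of [ev] on [M], one of maximal rank spans all these
    values; a row basis of it lifts to a basis of [M]. *)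
Lemma has_dim_of_injective (K : fieldType) (V : lmodType K) (M : set V) m
    (ev : {linear V -> 'rV[K]_m}) :
  M 0 -> (forall (a : K) u v, M u -> M v -> M (a *: u + v)) ->
  (forall x, M x -> ev x = 0 -> x = 0) -> exists k, has_dim M k.
Proof.
move=> M0 Mlin Minj.
have Msum k (b : 'I_k -> V) (a : 'I_k -> K) :
    (forall i, M (b i)) -> M (\sum_i a i *: b i).
  move=> Mb; apply: (big_ind M) => //.
    by move=> u v Mu Mv; have := Mlin 1 u v Mu Mv; rewrite scale1r.
  by move=> i _; have := Mlin (a i) (b i) 0 (Mb i) M0; rewrite addr0.
pose good r := `[< exists B : 'M[K]_m, \rank B = r /\
  forall i, exists2 x, M x & ev x = row i B >].
have g0 : exists r, good r.
  exists 0%N; apply/asboolP; exists 0; split; first exact: mxrank0.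
  by move=> i; exists 0 => //; rewrite linear0 row0.
have gb r : good r -> (r <= m)%N by move=> /asboolP[B [<- _]];
  exact: rank_leq_row.
have [r /asboolP[B [rB HB]] rmax] := ex_maxnP g0 gb.
have HB' (u : 'rV[K]_m) : (u <= B)%MS -> exists2 x, M x & ev x = u.
  move=> /submxP[D ->]; have ex i : exists x, M x /\ ev x = row i B by have [x]
    := HB i; exists x.
  have [b bP] := choice ex.
  exists (\sum_i D 0 i *: b i).
    by apply: Msum => i; have [] := bP i.
  rewrite linear_sum /= mulmx_sum_row; apply: eq_bigr => i _.
  by rewrite linearZ /= (bP i).2.
(* Otherwise adjoining [ev x] to the row space would raise the rank. *)
have HM x : M x -> (ev x <= B)%MS.
  move=> Mx; apply/negPn/negP => nx.
  have gx : good (\rank (B + ev x)%MS).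
    apply/asboolP; exists (B + ev x)%MS; split=> // i.
    have : (row i (B + ev x)%MS <= B + ev x)%MS by exact: row_sub.
    move=> /sub_addsmxP[[u1 u2] /= ->].
    have [y My yE] := HB' _ (submxMl u1 B).
    exists ((u2 0 0) *: x + y); first exact: Mlin.
    by rewrite linearP /= yE addrC [u2]mx11_scalar mul_scalar_mx mxE eqxx
      mulr1n.
  have := rmax _ gx; rewrite leqNgt => /negP; apply.
  rewrite -rB; apply: rank_ltmx; rewrite /ltmx addsmxSl /=.
  by apply: contra nx => /(submx_trans (addsmxSr B (ev x))).
have ex i : exists x, M x /\ ev x = row i (row_base B).
  have [|x] := HB' (row i (row_base B)); last by exists x.
  by rewrite -(eq_row_base B) row_sub.
have [b bP] := choice ex.
have evb (a : 'I_(\rank B) -> K) :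
    ev (\sum_i a i *: b i) = (\row_i a i) *m row_base B.
  rewrite linear_sum /= mulmx_sum_row; apply: eq_bigr => i _.
  by rewrite linearZ /= (bP i).2 mxE.
exists (\rank B), b; split.
  apply/seteqP; split=> [x Mx|x [a _ <-]]; last first.
    by apply: Msum => i; have [] := bP i.
  have : (ev x <= row_base B)%MS by rewrite eq_row_base; exact: HM.
  move=> /submxP[D xD]; exists (D 0) => //; symmetry; apply/eqP.
  rewrite -subr_eq0; apply/eqP/Minj; last first.
    rewrite linearB /= evb xD; apply/eqP; rewrite subr_eq0; apply/eqP.
    by congr (_ *m _); apply/rowP => i; rewrite mxE.
  rewrite addrC -scaleN1r; apply: Mlin => //.
  by apply: Msum => i; have [] := bP i.
move=> a a0; have := evb a; rewrite a0 linear0 => /esym/eqP.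
rewrite mulmx_free_eq0 ?row_base_free // => /eqP/rowP az i.
by have := az i; rewrite !mxE.
Qed.

Lemma complement_projection (K : pzRingType) (V : lmodType K) (A B : set V) :
  A 0 -> B 0 ->
  (forall (a : K) u v, A u -> A v -> A (a *: u + v)) ->
  (forall (a : K) u v, B u -> B v -> B (a *: u + v)) ->
  (forall x, A x -> B x -> x = 0) -> (forall x, exists2 u, A u & B (x - u)) ->
  exists pi : {linear V -> V}, forall x, A (pi x) /\ B (x - pi x).
Proof.
move=> A0 B0 Alin Blin AB ex.
have AN u v : A u -> A v -> A (u - v).
  by move=> Au Av; rewrite addrC -scaleN1r; exact: Alin.
have BN u v : B u -> B v -> B (u - v).
  by move=> Bu Bv; rewrite addrC -scaleN1r; exact: Blin.
have uniq x u v : A u -> B (x - u) -> A v -> B (x - v) -> u = v.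
  move=> Au Bu Av Bv; apply/eqP; rewrite -subr_eq0; apply/eqP/AB;
    first exact: AN.
  have := BN _ _ Bv Bu; by rewrite opprB addrC addrA subrK.
have ex' x : exists u, A u /\ B (x - u) by have [u] := ex x; exists u.
have [p pP] := choice ex'.
have lp : linear p.
  move=> a x y; have [Ap Bp] := pP (a *: x + y).
  have [Ax Bx] := pP x; have [Ay By] := pP y.
  apply: (uniq (a *: x + y)) => //; first exact: Alin.
  have := Blin a _ _ Bx By; congr B.
  by rewrite scalerBr opprD addrACA.
pose pi : {linear V -> V} := HB.pack p (GRing.isLinear.Build _ _ _ _ _ lp).
by exists pi.
Qed.

Lemma has_dim_linear_bounded (R : realType) (V W : normedModType R) (Y : set V)
  k
    (f : {linear V -> W}) : has_dim Y k ->
  exists2 M, 0 < M & forall y, Y y -> `|f y| <= M * `|y|.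
Proof.
move=> /has_dim_lincomb[b YE /lincomb_coercive[c c0 Hc]].
have [M M0 HM] := lincomb_bound (f \o b).
exists (M / c); first by rewrite divr_gt0.
move=> y /YE[a ->]; have -> : f (lincomb b a) = lincomb (f \o b) a.
  by rewrite linear_sum; apply: eq_bigr => i _; rewrite linearZ.
apply: le_trans (HM a) _; rewrite -mulrA ler_pM2l // mulrC ler_pdivlMr //.
by rewrite mulrC.
Qed.

(** * Generalised eigenspaces of an operator given by its graph *)

Section GeneralizedEigenspaces.
Context (R : realType) (X : normedModType R).
Local Notation Z := (cplx X).
Context (A : set (Z * Z)%type).

Definition linear_graph :=
  [/\ A (0, 0),
      forall (a : R[i]) x y w v, A (x, w) -> A (y, v) -> A (a *: x + y, a *: w
        + v) &
      forall x w v, A (x, w) -> A (x, v) -> w = v].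

Definition invariant_subspace (Y : set Z) :=
  [/\ Y 0, forall (a : R[i]) u v, Y u -> Y v -> Y (a *: u + v) &
      forall x, Y x -> exists2 w, A (x, w) & Y w].

(** The value is 0 outside the domain of the operator; on an invariant subspace this default never
    occurs. *)
Definition graph_fun (x : Z) : Z := xget 0 [set w | A (x, w)].

(* [(T - l_1) ... (T - l_m) x], where [T] is the operator with graph [A]. *)
Fixpoint annihilator (s : seq R[i]) (x : Z) : Z :=
  if s is l :: s' then
    let y := annihilator s' x in graph_fun y - l *: y
  else x.

Context (hA : linear_graph).

Lemma linear_graphB (a : R[i]) x y w v :
  A (x, w) -> A (y, v) -> A (x - a *: y, w - a *: v).
Proof.
move=> Ax Ay; have [_ lin _] := hA.
rewrite [x - _]addrC [w - _]addrC -!scaleNr; exact: (lin _ _ _ _ _ Ay Ax).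
Qed.

Lemma graph_funE x w : A (x, w) -> graph_fun x = w.
Proof.
move=> Ax; have [_ _ fn] := hA; apply: (fn x) => //.
by apply: (@xgetPex _ 0 [set w | A (x, w)]); exists w.
Qed.

Lemma ker_pow_submod l k : ker_pow A l k 0 /\
  forall (a : R[i]) u v, ker_pow A l k u -> ker_pow A l k v ->
    ker_pow A l k (a *: u + v).
Proof.
have [A0 lin _] := hA.
elim: k => [|k [K0 Klin]] /=.
  by split=> // a u v -> ->; rewrite scaler0 addr0.
split; first by exists 0; rewrite // scaler0 subr0.
move=> a u v [u' Au Ku] [v' Av Kv]; exists (a *: u' + v'); first exact: lin.
have := Klin a _ _ Ku Kv; congr ker_pow.
by rewrite scalerBr scalerDr !scalerA [a * l]mulrC addrACA -opprD.
Qed.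

Lemma ker_powS l k x : ker_pow A l k x -> ker_pow A l k.+1 x.
Proof.
have [A0 _ _] := hA.
elim: k x => [|k IH] x /=; first by move=> ->; exists 0;
  rewrite // scaler0 subr0.
by move=> [w Aw Kw]; exists w => //; exact: IH.
Qed.

Lemma ker_pow_le l k m x : (k <= m)%N -> ker_pow A l k x -> ker_pow A l m x.
Proof.
by move=> /subnKC <-; elim: (m - k)%N => [|d IH]; rewrite ?addn0 // addnS =>
  /IH /ker_powS.
Qed.

Lemma gen_eigenspace_submod l : gen_eigenspace A l 0 /\
  forall (a : R[i]) u v, gen_eigenspace A l u -> gen_eigenspace A l v ->
    gen_eigenspace A l (a *: u + v).
Proof.
split; first by exists 0%N.
move=> a u v [k _ Ku] [m _ Kv]; exists (maxn k m) => //.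
have [_] := ker_pow_submod l (maxn k m); apply.
  exact: ker_pow_le (leq_maxl _ _) Ku.
exact: ker_pow_le (leq_maxr _ _) Kv.
Qed.

Lemma gen_eigenspaces_ind (S : set R[i]) (Q : Z -> Prop) :
  Q 0 -> (forall x y, Q x -> Q y -> Q (x + y)) ->
  (forall l x, S l -> gen_eigenspace A l x -> Q x) ->
  forall x, gen_eigenspaces A S x -> Q x.
Proof.
move=> Q0 QD Qg x [m [l [y [H ->]]]]; apply: (big_ind Q) => // i _.
by have [Sl] := H i; exact: Qg.
Qed.

Lemma gen_eigenspaces_gen (S : set R[i]) l x :
  S l -> gen_eigenspace A l x -> gen_eigenspaces A S x.
Proof.
move=> Sl gx; exists 1%N, (fun=> l), (fun=> x); split=> //.
by rewrite big_ord1.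
Qed.

Lemma gen_eigenspaces_submod (S : set R[i]) : gen_eigenspaces A S 0 /\
  forall (a : R[i]) u v, gen_eigenspaces A S u -> gen_eigenspaces A S v ->
    gen_eigenspaces A S (a *: u + v).
Proof.
have add u v : gen_eigenspaces A S u -> gen_eigenspaces A S v ->
    gen_eigenspaces A S (u + v).
  move=> [m [l [y [H ->]]]] [m' [l' [y' [H' ->]]]].
  exists (m + m')%N, (fun i => match fintype.split i with inl j =>
    l j | inr j => l' j end),
    (fun i => match fintype.split i with inl j => y j | inr j => y' j end);
      split.
    by move=> i; case: fintype.split => j; [exact: H|exact: H'].
  rewrite big_split_ord /=; congr (_ + _); apply: eq_bigr => i _.
    by rewrite (unsplitK (inl i)).
  by rewrite (unsplitK (inr i)).
have G0 : gen_eigenspaces A S 0.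
  exists 0%N, (fun=> 0), (fun=> 0); split; first by case.
  by rewrite big_ord0.
split=> // a u v [m [l [y [H ->]]]] Gv; apply: add => //.
exists m, l, (fun i => a *: y i); split; last by rewrite scaler_sumr.
move=> i; have [Sl gy] := H i; split=> //.
have [g0 /(_ a _ 0 gy)] := gen_eigenspace_submod (l i).
by rewrite addr0; apply.
Qed.

Lemma gen_eigenspacesU (S1 S2 : set R[i]) x : gen_eigenspaces A (S1 `|` S2) x ->
  exists x1 x2, [/\ gen_eigenspaces A S1 x1, gen_eigenspaces A S2 x2 & x = x1 +
    x2].
Proof.
have [z1 l1] := gen_eigenspaces_submod S1;
  have [z2 l2] := gen_eigenspaces_submod S2.
move: x; apply: gen_eigenspaces_ind.
- by exists 0, 0; rewrite addr0.
- move=> x y [x1 [x2 [gx1 gx2 ->]]] [y1 [y2 [gy1 gy2 ->]]].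
  exists (x1 + y1), (x2 + y2); split; last by rewrite addrACA.
    by have := l1 1 _ _ gx1 gy1; rewrite scale1r.
  by have := l2 1 _ _ gx2 gy2; rewrite scale1r.
- move=> l x [Sl|Sl] gx.
    by exists x, 0; rewrite addr0; split=> //; exact: gen_eigenspaces_gen Sl gx.
  by exists 0, x; rewrite add0r; split=> //; exact: gen_eigenspaces_gen Sl gx.
Qed.

(* [T - l] is onto up to the generalised eigenspace of [l], since
   [T - l = (T - m) + (m - l)] and [T - m] is nilpotent on that of [m]. *)
Lemma gen_eigenspaces_shift (S : set R[i]) l y : gen_eigenspaces A S y ->
  exists z n w, [/\ gen_eigenspaces A S z, gen_eigenspace A l n, A (z, w) &
    y = w - l *: z + n].
Proof.
have [A0 lin fn] := hA.
have [g0 gl] := gen_eigenspaces_submod S.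
have [e0 el] := gen_eigenspace_submod l.
move: y; apply: gen_eigenspaces_ind.
- by exists 0, 0, 0; rewrite scaler0 subr0 addr0.
- move=> x y [z [n [w [gz gn Az ->]]]] [z' [n' [w' [gz' gn' Az' ->]]]].
  exists (z + z'), (n + n'), (w + w'); split.
  + by have := gl 1 _ _ gz gz'; rewrite scale1r.
  + by have := el 1 _ _ gn gn'; rewrite scale1r.
  + by have := lin 1 _ _ _ _ Az Az'; rewrite !scale1r.
  + by rewrite scalerDr opprD [LHS]addrACA; congr (_ + _); rewrite addrACA.
move=> m x Sm gx; have [<-|ml] := eqVneq m l.
  by exists 0, x, 0; rewrite scaler0 subr0 add0r.
suff [z [w [gz Az xE]]] : exists z w, [/\ gen_eigenspace A m z, A (z, w) &
    x = w - l *: z].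
  exists z, 0, w; split=> //; last by rewrite addr0.
  exact: gen_eigenspaces_gen Sm gz.
have [k _ Kx] := gx; elim: k x {gx} Kx => [|k IH] x /=.
  move=> ->; exists 0, 0; rewrite scaler0 subr0; split=> //.
  by have [] := gen_eigenspace_submod m.
move=> [x' Ax Kx]; have [z [w [gz Az xE]]] := IH _ Kx.
have ml0 : m - l != 0 by rewrite subr_eq0.
have [_ em] := gen_eigenspace_submod m.
have gx : gen_eigenspace A m x by exists k.+1 => //=; exists x'.
(* By induction (T - m) x = (T - l) z, so (T - l)(x - z) = (m - l) x. *)
exists ((m - l)^-1 *: (x - z)), ((m - l)^-1 *: (x' - w)); split.
- have := em (m - l)^-1 (x - z) 0; rewrite addr0; apply.
    by rewrite addrC -scaleN1r; exact: em.
  by have [] := gen_eigenspace_submod m.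
- have := linear_graphB 1 Ax Az; rewrite !scale1r => h.
  by have := lin (m - l)^-1 _ _ _ _ h A0; rewrite !addr0.
have e1 : x' - w = m *: x - l *: z.
  by rewrite -(subrK (m *: x) x') xE addrC !addrA addNr add0r addrC.
have e2 : x' - w - l *: (x - z) = (m - l) *: x.
  by rewrite e1 scalerBr opprB addrA subrK scalerBl.
have -> : (m - l)^-1 *: (x' - w) - l *: ((m - l)^-1 *: (x - z)) =
    (m - l)^-1 *: (x' - w - l *: (x - z)).
  by rewrite [RHS]scalerBr !scalerA mulrC.
by rewrite e2 scalerA mulVf // scale1r.
Qed.

End GeneralizedEigenspaces.

(** * Products of shifted operators on an invariant subspace *)

Section Annihilators.
Context (R : realType) (X : normedModType R).
Local Notation Z := (cplx X).
Context (A : set (Z * Z)%type) (Y : set Z).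
Context (hA : linear_graph A) (hY : invariant_subspace A Y).

Local Notation T := (graph_fun A).

Lemma inv_submodB u v (a : R[i]) : Y u -> Y v -> Y (u - a *: v).
Proof.
by move=> Yu Yv; have [_ lin _] := hY; rewrite addrC -scaleNr; exact: lin.
Qed.

Lemma graph_funP x : Y x -> A (x, T x) /\ Y (T x).
Proof.
move=> Yx; have [_ _ /(_ x Yx) [w Aw Yw]] := hY.
by rewrite (graph_funE hA Aw).
Qed.

Lemma graph_fun_lin (a : R[i]) x y : Y x -> Y y ->
  T (a *: x + y) = a *: T x + T y.
Proof.
move=> /graph_funP[Ax _] /graph_funP[Ay _]; apply: (graph_funE hA).
by have [_ lin _] := hA; exact: lin.
Qed.

Lemma graph_fun_shift_lin l (a : R[i]) x y : Y x -> Y y ->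
  T (a *: x + y) - l *: (a *: x + y) = a *: (T x - l *: x) + (T y - l *: y).
Proof.
move=> Yx Yy; rewrite graph_fun_lin // scalerBr scalerDr opprD addrACA !scalerA.
by rewrite [l * a]mulrC.
Qed.

Lemma annihilator_in s x : Y x -> Y (annihilator A s x).
Proof.
elim: s => [|l s IH] //= Yx; apply: inv_submodB; last exact: IH.
by have [] := graph_funP (IH Yx).
Qed.

Lemma annihilator_lin s (a : R[i]) x y : Y x -> Y y ->
  annihilator A s (a *: x + y) = a *: annihilator A s x + annihilator A s y.
Proof.
move=> Yx Yy; elim: s => [|l s IH] //=; rewrite IH.
by rewrite graph_fun_shift_lin //; exact: annihilator_in.
Qed.

Lemma annihilator0 s : annihilator A s 0 = 0.
Proof.
have [Y0 _ _] := hY; have := annihilator_lin s (-1) Y0 Y0.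
by rewrite !scaleN1r !addNr.
Qed.

Lemma shift_comm l m x : Y x ->
  T (T x - m *: x) - l *: (T x - m *: x) = T (T x - l *: x) - m *: (T x - l *:
    x).
Proof.
move=> Yx; have [_ YT] := graph_funP Yx.
have E c : T (T x - c *: x) = T (T x) - c *: T x.
  rewrite addrC -scaleNr graph_fun_lin // scaleNr addrC; congr (_ + _).
rewrite !E !scalerBr !scalerA [m * l]mulrC.
by rewrite -!addrA; congr (_ + _); rewrite !opprB addrCA [LHS]addrA addrC
  addrCA !addrA addrAC.
Qed.

Lemma annihilator_shift s l x : Y x ->
  annihilator A s (T x - l *: x) =
  T (annihilator A s x) - l *: annihilator A s x.
Proof.
move=> Yx; elim: s => [|m s IH] //=; rewrite IH.
by apply: shift_comm; exact: annihilator_in.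
Qed.

Lemma annihilator_cat s t x :
  annihilator A (s ++ t) x = annihilator A s (annihilator A t x).
Proof. by elim: s => [|l s IH] //=; rewrite IH. Qed.

Lemma annihilator_comm s t x : Y x ->
  annihilator A s (annihilator A t x) = annihilator A t (annihilator A s x).
Proof.
move=> Yx; elim: t => [|l t IH] //=; rewrite -IH annihilator_shift //.
exact: annihilator_in.
Qed.

Lemma annihilator_ker_pow l k x : Y x -> ker_pow A l k x ->
  annihilator A (nseq k l) x = 0.
Proof.
elim: k x => [|k IH] x Yx //=; move=> [w Aw Kw].
rewrite -annihilator_shift // (graph_funE hA Aw); apply: IH => //.
apply: inv_submodB => //; rewrite -(graph_funE hA Aw).
by have [] := graph_funP Yx.
Qed.

(* Cayley-Hamilton for the operator restricted to [Y], with the characteristic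
   polynomial split into linear factors. *)
Lemma annihilator_exists k : has_dim Y k ->
  exists s, forall x, Y x -> annihilator A s x = 0.
Proof.
(* Dimension 0 is set apart because polynomials are evaluated at matrices of positive size. *)
case: k => [|k] [b [YE _]].
  by exists [::] => x; rewrite YE => -[a _ <-] /=; rewrite big_ord0.
pose lc (a : 'rV[R[i]]_k.+1) : Z := \sum_i a 0 i *: b i.
have YE' x : Y x <-> exists a, x = lc a.
  rewrite YE; split=> [[a _ <-]|[a ->]]; last by exists (a 0).
  by exists (\row_i a i); apply: eq_bigr => i _; rewrite mxE.
have lcP (c : R[i]) u v : lc (c *: u + v) = c *: lc u + lc v.
  rewrite /lc scaler_sumr -big_split; apply: eq_bigr => i _.
  by rewrite !mxE scalerDl scalerA.
have lc0 : lc 0 = 0 by rewrite /lc big1 // => i _; rewrite mxE scale0r.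
have Ylc a : Y (lc a) by apply/YE'; exists a.
have lc_delta i : lc (delta_mx 0 i) = b i.
  rewrite /lc (bigD1 i) //= mxE !eqxx scale1r big1 ?addr0 // => j ji.
  by rewrite mxE (negPf ji) andbF scale0r.
have ex i : exists a, T (b i) = lc a.
  by apply/YE'; rewrite -lc_delta; have [] := graph_funP (Ylc (delta_mx 0 i)).
have [c cP] := choice ex.
pose M : 'M[R[i]]_k.+1 := \matrix_(i, j) c i 0 j.
have rM i : row i M = c i by apply/rowP => j; rewrite !mxE.
have TM a : T (lc a) = lc (a *m M).
  have [r ->] : exists r : seq 'I_k.+1, a = \sum_(i <- r) a 0 i *: delta_mx 0 i.
    by exists (index_enum 'I_k.+1); exact: row_sum_delta.
  rewrite [in RHS]mulmx_suml; elim: r => [|i r IH].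
    by rewrite !big_nil lc0; apply: (graph_funE hA); case: hA.
  rewrite !big_cons lcP graph_fun_lin // IH -scalemxAl -rowE rM lcP.
  by rewrite lc_delta cP.
have [r rE] := closed_field_poly_normal (char_poly M).
have lead1 : lead_coef (char_poly M) = 1 by apply/monicP;
  exact: char_poly_monic.
rewrite lead1 scale1r in rE.
exists r => x /YE'[a ->].
suff -> : annihilator A r (lc a) =
    lc (a *m horner_mx M (\prod_(z <- r) ('X - z%:P))).
  by rewrite -rE Cayley_Hamilton mulmx0.
elim: r {rE} => [|z r IH]; first by rewrite big_nil rmorph1 mulmx1.
rewrite big_cons mulrC rmorphM /= IH rmorphB /= horner_mx_X horner_mx_C.
rewrite TM mulmxA; set u := a *m _.
have -> : u *m (M - z%:M) = - z *: u + u *m M.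
  by rewrite mulmxBr addrC mul_mx_scalar scaleNr.
by rewrite lcP scaleNr addrC.
Qed.

End Annihilators.

Lemma subrACA (V : zmodType) (a b c d : V) : (a - b) - (c - d) = (a - c) - (b -
  d).
Proof. by rewrite !opprB addrACA [RHS]addrACA [- b + _]addrC. Qed.

(** * Range and kernel of a spectral projection *)

Section SpectralProjection.
Context (R : realType) (X : normedModType R).
Local Notation Z := (cplx X).
Context (A : set (Z * Z)%type) (S : set R[i]) (P : {linear Z -> Z}).
Context (hA : linear_graph A) (hP : spectral_projection A S P).

Local Notation Y := (range P).
Local Notation T := (graph_fun A).

Lemma range_projP x : Y x <-> P x = x.
Proof.
have [[_ PP] _ _ _ _] := hP.
by split=> [[y _ <-]|<-]; [exact: PP|exists x].
Qed.

Lemma range_proj_invariant : invariant_subspace A Y.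
Proof.
have [[_ PP] Pc Pd _ _] := hP; split.
- by exists 0 => //; exact: linear0.
- by move=> a u v [u' _ <-] [v' _ <-]; exists (a *: u' + v') => //;
  exact: linearP.
move=> x /range_projP Px; have [w] := Pd x; rewrite Px => Aw.
exists w => //; apply/range_projP; have [_ _ fn] := hA.
by apply: (fn x) => //; rewrite -{1}Px; exact: Pc.
Qed.

Lemma resolvent_ker l : S l -> resolvent_set [set x | P x = 0] A l.
Proof.
move=> Sl; apply: contrapT => nr; have [_ _ _ _ [_ sE]] := hP.
have : spectrum [set x | P x = 0] A l by [].
by rewrite sE => -[].
Qed.

Lemma resolvent_range l : ~ S l -> resolvent_set Y A l.
Proof.
move=> Sl; apply: contrapT => nr; have [_ _ _ _ [sE _]] := hP.
by apply: Sl; rewrite -sE.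
Qed.

(** T - l is injective on the kernel of [P]. If (T - l) x lies in the range, then T - l kills the
    kernel component [x - P x], which is therefore 0. *)
Lemma gen_eigenspace_range l : S l -> gen_eigenspace A l `<=` Y.
Proof.
move=> Sl x [k _]; elim: k x => [|k IH] x /=.
  by move=> ->; have [] := range_proj_invariant.
move=> [w Aw /IH/range_projP yE]; have [[_ PP] Pc _ _ _] := hP.
have [_ [K HK]] := resolvent_ker Sl.
have Ax : A (x - P x, w - P w).
  by have := linear_graphB hA 1 Aw (Pc _ _ Aw); rewrite !scale1r.
have ker z : P (z - P z) = 0 by rewrite linearB PP subrr.
have := HK _ _ (And3 Ax (ker x) (ker w)).
have -> : l *: (x - P x) - (w - P w) = 0.
  have e : P w - l *: P x = w - l *: x by move: yE; rewrite linearB linearZ.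
  rewrite scalerBr subrACA -[l *: x - w]opprB -[l *: P x - P w]opprB e.
  by rewrite opprK addNr.
rewrite normr0 mulr0 normr_le0 subr_eq0 => /eqP xP.
by apply/range_projP.
Qed.

Lemma range_ker_pow l k x : ~ S l -> Y x -> ker_pow A l k x -> x = 0.
Proof.
move=> Sl; have [_ [K HK]] := resolvent_range Sl.
elim: k x => [|k IH] x Yx //= [w Aw Kw].
have Yw : Y w.
  rewrite -(graph_funE hA Aw).
  by have [] := graph_funP hA range_proj_invariant Yx.
have e : w - l *: x = 0.
  by apply: IH Kw; apply: (inv_submodB range_proj_invariant).
have := HK x w (And3 Aw Yx Yw).
by rewrite -opprB e oppr0 normr0 mulr0 normr_le0 => /eqP.
Qed.

(** Factors T - l with l outside [S] are injective on the range and can be cancelled from an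
    annihilating product. *)
Lemma annihilator_spectrum k : has_dim Y k -> exists s,
  (forall l, l \in s -> S l) /\ forall x, Y x -> annihilator A s x = 0.
Proof.
have iY := range_proj_invariant.
move=> /(annihilator_exists hA iY)[s sP].
exists [seq l <- s | `[< S l >] ]; split.
  by move=> l; rewrite mem_filter => /andP[/asboolP].
move=> x Yx; have {sP} := sP x Yx.
elim: s x Yx => [|l s IH] x Yx //=.
have Ys : Y (T x - l *: x).
  by apply: (inv_submodB iY) => //; have [] := graph_funP hA iY Yx.
rewrite -(annihilator_shift hA iY) // => /(IH _ Ys).
rewrite (annihilator_shift hA iY) //; set y := annihilator A _ x => e.
case: ifPn => [_ //|/asboolPn Sl].
have Yy : Y y by exact: (annihilator_in hA iY).
apply: (@range_ker_pow l 1) => //; exists (T y) => //.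
by have [] := graph_funP hA iY Yy.
Qed.

(** Induction on the annihilating product: (T - l) x is a sum of generalised eigenvectors by
    induction. Solving for it by some z, up to an error in the generalised eigenspace of l, puts x -
    z in that eigenspace. *)
Lemma range_proj_gen_eigenspaces k : has_dim Y k -> Y = gen_eigenspaces A S.
Proof.
have iY := range_proj_invariant; have [Y0 Ylin _] := iY.
move=> dY; apply/seteqP; split; last first.
  apply: gen_eigenspaces_ind => //.
    by move=> x y Yx Yy; have := Ylin 1 _ _ Yx Yy; rewrite scale1r.
  by move=> l x Sl; exact: gen_eigenspace_range.
have [s [sS sP]] := annihilator_spectrum dY.
move=> x Yx; have {sP} := sP x Yx; have [G0 Gl] := gen_eigenspaces_submod hA S.
elim: s sS x Yx => [|l s IH] sS x Yx; first by move=> /= ->.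
have Sl : S l by apply: sS; rewrite inE eqxx.
have Ys : Y (T x - l *: x).
  by apply: (inv_submodB iY) => //; have [] := graph_funP hA iY Yx.
rewrite /= -(annihilator_shift hA iY) // => /IH -/(_ _ Ys)[].
  by move=> m ms; apply: sS; rewrite inE ms orbT.
move=> m' [l' [y' [H' e']]].
have := @gen_eigenspaces_shift _ _ A hA S l (T x - l *: x).
case; first by exists m', l', y'.
move=> z [n [w [gz gn Aw xE]]].
have [Ax _] := graph_funP hA iY Yx.
have gd : gen_eigenspace A l (x - z).
  have [k' _ Kn] := gn; exists k'.+1 => //=; exists (T x - w).
    by have := linear_graphB hA 1 Ax Aw; rewrite !scale1r.
  have -> : T x - w - l *: (x - z) = n; last by [].
  by rewrite scalerBr subrACA xE [_ + n]addrC addrK.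
have := Gl 1 (x - z) z (gen_eigenspaces_gen Sl gd) gz.
by rewrite scale1r subrK.
Qed.

(** On the kernel of [P] each T - l with l in [S] is onto, so x is an annihilating product applied
    to some z. [Q] commutes with T and moves z into the range, where the product is zero. *)
Lemma spectral_ker_sub k (Q : Z -> Z) : has_dim Y k ->
  (forall (a : R[i]) x y, Q (a *: x + y) = a *: Q x + Q y) ->
  (forall x w, A (x, w) -> A (Q x, Q w)) -> (forall x, Y (Q x)) ->
  forall x, P x = 0 -> Q x = 0.
Proof.
have iY := range_proj_invariant.
move=> dY Ql Qc QY x Px; have [s [sS sP]] := annihilator_spectrum dY.
suff [z Pz ->] : exists2 z, P z = 0 & Q x = annihilator A s (Q z) by exact: sP.
elim: s sS {sP} => [|l s IH] sS; first by exists x.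
have Sl : S l by apply: sS; rewrite inE eqxx.
have [z Pz ->] := IH (fun m ms => sS m (mem_behead (s := l :: s) ms)).
have [/(_ z Pz)[z' [[w [Aw Pz' Pw] zE] _]] _] := resolvent_ker Sl.
(* The sign is due to the resolvent equation, which reads l z' - w = z. *)
exists (- z'); first by rewrite linearN Pz' oppr0.
have [A0 lin _] := hA.
have AN : A (- z', - w).
  by have := lin (-1) _ _ _ _ Aw A0; rewrite !addr0 !scaleN1r.
rewrite /= -(annihilator_shift hA iY) //; congr annihilator.
rewrite (graph_funE hA (Qc _ _ AN)) addrC -scaleNr -Ql -zE.
by rewrite scalerN scaleNr opprK.
Qed.

Lemma gen_eigenspaces_annihilated (S' : set R[i]) x : S' `<=` S ->
  gen_eigenspaces A S' x -> Y x /\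
  exists2 s, (forall l, l \in s -> S' l) & annihilator A s x = 0.
Proof.
have iY := range_proj_invariant; have [Y0 Ylin _] := iY.
move=> S'S; move: x; apply: gen_eigenspaces_ind.
- by split=> //; exists [::].
- move=> x y [Yx [s sS sx]] [Yy [t tS ty]]; split.
    by have := Ylin 1 _ _ Yx Yy; rewrite scale1r.
  exists (s ++ t); first by move=> l; rewrite mem_cat => /orP[/sS|/tS].
  rewrite -[x]scale1r (annihilator_lin hA iY) // annihilator_cat.
  rewrite (annihilator_comm hA iY) // sx annihilator_cat ty.
  by rewrite !(annihilator0 hA iY) scaler0 addr0.
move=> l x S'l gx; have Yx := gen_eigenspace_range (S'S _ S'l) gx.
split=> //; have [k _ Kx] := gx.
exists (nseq k l); first by move=> m; rewrite mem_nseq => /andP[_ /eqP ->].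
exact: (annihilator_ker_pow hA iY).
Qed.

(** On an eigenvector for [m] the product acts as multiplication by the nonzero factors m - l. *)
Lemma annihilator_eigen s m x : Y x -> T x = m *: x -> annihilator A s x = 0 ->
  (forall l, l \in s -> l != m) -> x = 0.
Proof.
have iY := range_proj_invariant; have [Y0 Ylin _] := iY.
move=> Yx Tx; elim: s => [|l s IH] //.
rewrite [annihilator _ _ _]/= -(annihilator_shift hA iY) // Tx -scalerBl =>
  e ns.
apply: IH => [|l' l's]; last by apply: ns; rewrite inE l's orbT.
have ml : m - l != 0 by rewrite subr_eq0 eq_sym ns // inE eqxx.
have := annihilator_lin hA iY s (m - l) Yx Y0; rewrite !addr0 e.
rewrite (annihilator0 hA iY) addr0 => /esym/eqP.
by rewrite scaler_eq0 (negPf ml) => /eqP.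
Qed.

(** Two products without common factor kill x. By induction on the second, (T - m) x = 0, so x is an
    eigenvector for a value m missing from the first product. *)
Lemma gen_eigenspaces_disjoint (S1 S2 : set R[i]) x :
  S1 `<=` S -> S2 `<=` S -> (forall l, S1 l -> S2 l -> False) ->
  gen_eigenspaces A S1 x -> gen_eigenspaces A S2 x -> x = 0.
Proof.
have iY := range_proj_invariant.
move=> S1S S2S dis /(gen_eigenspaces_annihilated S1S)[Yx [s sS sx]].
move=> /(gen_eigenspaces_annihilated S2S)[_ [t tS]].
elim: t tS x Yx sx => [|m t IH] tS x Yx sx //.
rewrite [annihilator _ _ _]/= -(annihilator_shift hA iY) // => e.
have YT := (graph_funP hA iY Yx).2.
have y0 : T x - m *: x = 0.
  apply: IH e.
  - by move=> l lt; apply: tS; rewrite inE lt orbT.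
  - exact: (inv_submodB iY).
  - rewrite (annihilator_shift hA iY) // sx scaler0 subr0.
    by apply: (graph_funE hA); case: hA.
apply: (@annihilator_eigen s m) => //; first by apply/eqP; rewrite -subr_eq0 y0.
move=> l ls; apply/eqP => lm; apply: (dis l); first exact: sS.
by apply: tS; rewrite lm inE eqxx.
Qed.

End SpectralProjection.

(** * Complex conjugation and real parts *)

Section Realification.
Context (R : realType) (X : normedModType R).
Local Notation Z := (cplx X).

Definition cconj (z : Z) : Z := (z.1, - z.2).

Lemma cconjK : involutive cconj.
Proof. by move=> [x y]; rewrite /cconj /= opprK. Qed.

Lemma cconj_semilinear (a : R[i]) x y :
  cconj (a *: x + y) = conjc a *: cconj x + cconj y.
Proof.
case: a x y => [a b] [x x'] [y y']; congr (_, _) => /=.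
  by rewrite scalerN !scaleNr opprK.
by rewrite scalerN scaleNr !opprD.
Qed.

Lemma norm_cconj z : `|cconj z| = `|z|.
Proof. by case: z => x y; rewrite !prod_normE /= normrN. Qed.

Context (A : set (Z * Z)%type) (hA : linear_graph A).
Context (hR : forall x w, A (x, w) -> A (cconj x, cconj w)).

Lemma cconjBZ l (w x : Z) : cconj (w - l *: x) = cconj w - conjc l *: cconj x.
Proof.
rewrite addrC -scaleNr cconj_semilinear addrC; congr (_ + _).
by rewrite raddfN /= scaleNr.
Qed.

Lemma cconjZB l (w x : Z) : cconj (l *: x - w) = conjc l *: cconj x - cconj w.
Proof.
by rewrite cconj_semilinear; congr (_ + _).
Qed.

Lemma ker_pow_conj l k x : ker_pow A l k x -> ker_pow A (conjc l) k (cconj x).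
Proof.
elim: k x => [|k IH] x /=.
  by move=> ->; rewrite /cconj /= oppr0.
move=> [w Aw Kw]; exists (cconj w); first exact: hR.
by rewrite -cconjBZ; exact: IH.
Qed.

Lemma gen_eigenspaces_conj (S : set R[i]) x :
  (forall l, S l -> S (conjc l)) ->
  gen_eigenspaces A S x -> gen_eigenspaces A S (cconj x).
Proof.
move=> SC; have [G0 Gl] := gen_eigenspaces_submod hA S.
move: x; apply: gen_eigenspaces_ind.
- by rewrite /cconj /= oppr0.
- move=> x y gx gy.
  have -> : cconj (x + y) = 1 *: cconj x + cconj y.
    by rewrite -[x]scale1r cconj_semilinear conjc1 !scale1r.
  exact: Gl.
move=> l x Sl [k _ Kx]; apply: (gen_eigenspaces_gen (SC _ Sl)).
by exists k => //; exact: ker_pow_conj.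
Qed.

(** The real part is the mean of [z] and its conjugate. *)
Lemma gen_eigenspaces_re (S : set R[i]) (z : Z) :
  (forall l, S l -> S (conjc l)) ->
  gen_eigenspaces A S z -> gen_eigenspaces A S (z.1, 0).
Proof.
move=> SC gz; have [G0 Gl] := gen_eigenspaces_submod hA S.
have gz' := gen_eigenspaces_conj SC gz.
have g2 : gen_eigenspaces A S (1 *: z + cconj z) by exact: Gl.
have := Gl (Complex 2^-1 0) _ _ g2 G0; congr (gen_eigenspaces _ _).
case: z {gz gz' g2} => x y; rewrite addr0 scale1r; congr (_, _) => /=.
  rewrite scale0r subr0 -[x in x + x]scale1r -scalerDl scalerA.
  by rewrite -[1 + 1]/(2%:R) mulVf ?scale1r // pnatr_eq0.
by rewrite subrr scaler0 scale0r addr0.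
Qed.

Lemma resolvent_conj l : resolvent_set setT A l -> resolvent_set setT A (conjc
  l).
Proof.
move=> [H1 [K HK]]; split; last first.
  exists K => x w [Aw _ _].
  have := HK (cconj x) (cconj w) (And3 (hR Aw) Logic.I Logic.I).
  by rewrite norm_cconj -[X in _ <= K * X]norm_cconj cconjZB !cconjK.
move=> y _; have [x [[w [Aw _ _] xE] xU]] := H1 (cconj y) Logic.I.
exists (cconj x); split.
  exists (cconj w); first by split=> //; exact: hR.
  by rewrite -[x in l^*%C *: cconj x]cconjK -[l in l^*%C]conjcK -cconjZB conjcK
    cconjK xE cconjK.
move=> x' [w' [Aw' _ _] x'E].
rewrite -[x']cconjK; congr cconj; apply: xU.
exists (cconj w'); first by split=> //; exact: hR.
by rewrite -x'E cconjZB conjcK.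
Qed.

Lemma spectrum_conj l : spectrum setT A l -> spectrum setT A (conjc l).
Proof. by move=> nl /resolvent_conj; rewrite conjcK. Qed.

Context (S : set R[i]) (P : {linear Z -> Z}) (k : nat).
Context (hP : spectral_projection A S P) (dY : has_dim (range P) k).
Context (SC : forall l, S l -> S (conjc l)).

(* The conjugate of [P] is a projection onto the same range and commutes with
   [A], hence it has the same kernel. *)
Lemma spectral_projection_real (x : X) : (P (x, 0)).2 = 0.
Proof.
have YE := range_proj_gen_eigenspaces hA hP dY.
have rP z : range P z <-> P z = z by exact: range_projP hP z.
have Yc z : range P z -> range P (cconj z).
  by rewrite YE; exact: gen_eigenspaces_conj.
pose Q z := cconj (P (cconj z)).
have QY z : range P (Q z) by apply: Yc; exists (cconj z).
have Ql (a : R[i]) u v : Q (a *: u + v) = a *: Q u + Q v.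
  by rewrite /Q cconj_semilinear linearP cconj_semilinear conjcK.
have Qc u w : A (u, w) -> A (Q u, Q w).
  by have [_ Pc _ _ _] := hP; move=> /hR /Pc /hR.
have Qfix z : range P z -> Q z = z.
  by move=> /Yc /rP Pz; rewrite /Q Pz cconjK.
have ker z : P (z - P z) = 0.
  by rewrite linearB; have [[_ ->] _ _ _ _] := hP; rewrite subrr.
pose z : Z := (x, 0).
(* [Q] kills z - P z and fixes P z, so Q z = P z; for real z this says that P z is its own
   conjugate. *)
have := spectral_ker_sub hA hP dY Ql Qc QY (ker z).
have -> : z - P z = -1 *: P z + z by rewrite scaleN1r addrC.
rewrite Ql Qfix; last by exists z.
rewrite scaleN1r addrC => /eqP; rewrite subr_eq0 => /eqP.
rewrite /Q (_ : cconj z = z) ?/z /cconj /= ?oppr0 //.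
move=> /(congr1 snd) /= e.
have : (P (x, 0)).2 + (P (x, 0)).2 = 0 by rewrite -{1}e addNr.
rewrite -[X in X + X]scale1r -scalerDl => /eqP; rewrite scaler_eq0 =>
  /orP[|/eqP //].
by rewrite -[1 + 1]/(2%:R) pnatr_eq0.
Qed.

End Realification.

Lemma complexify_linear_graph (R : realType) (X : normedModType R)
    (A : set (X * X)%type) :
  A (0, 0) ->
  (forall (a : R) x y w v, A (x, w) -> A (y, v) -> A (a *: x + y, a *: w + v))
    ->
  (forall x w v, A (x, w) -> A (x, v) -> w = v) ->
  linear_graph (complexify A) /\
  (forall x w, complexify A (x, w) -> complexify A (cconj x, cconj w)).
Proof.
move=> A0 lin fn.
have linN (a : R) x y w v : A (x, w) -> A (y, v) -> A (x - a *: y, w - a *: v).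
  move=> Ax Ay; rewrite [x - _]addrC [w - _]addrC -!scaleNr.
  exact: (lin _ _ _ _ _ Ay Ax).
have linD x y w v : A (x, w) -> A (y, v) -> A (x + y, w + v).
  by move=> Ax Ay; have := lin 1 _ _ _ _ Ax Ay; rewrite !scale1r.
have linZ (a : R) x w : A (x, w) -> A (a *: x, a *: w).
  by move=> Ax; have := lin a _ _ _ _ Ax A0; rewrite !addr0.
split; first split.
- by split.
- move=> [a b] [x x'] [y y'] [w w'] [v v'] [/= A1 A2] [/= A3 A4]; split=> /=.
    by apply: (linD _ _ _ _) => //; apply: (linN _ _ _ _ _) => //;
      exact: (linZ _ _ _).
  by apply: (linD _ _ _ _) => //; apply: (linD _ _ _ _); exact: (linZ _ _ _).
- move=> [x x'] [w w'] [v v'] [/= A1 A2] [/= A3 A4].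
  by rewrite (fn _ _ _ A1 A3) (fn _ _ _ A2 A4).
move=> [x x'] [w w'] [/= A1 A2]; split=> //=.
by have := linN 1 _ _ _ _ A0 A2; rewrite !scale1r !sub0r.
Qed.

(** * The delay equation *)

Section DelaySpace.
Context (R : realType) (h : {posnum R}) (E : normedModType R).
Local Notation C := (Cspace h E).
Local Notation C1 := (C1space h E).

(** The difference quotients are one-sided at the end points, which [local_lipschitz_increment]
    accommodates. *)
Lemma C1_increment (chi : C1) (K a b : R) :
  - h%:num <= a -> a <= b -> b <= 0 -> (forall s, `|C1deriv chi s| <= K) ->
  `|chi b - chi a| <= K * (b - a).
Proof.
move=> ha ab b0 HK; apply/ler_addgt0Pr => e e0.
(* The 1 keeps the divisor positive when [a = b]. *)
pose e' := e / (b - a + 1).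
have ba1 : 0 < b - a + 1 by lra.
have e'0 : 0 < e' by rewrite divr_gt0.
have : `|chi b - chi a| <= (K + e') * (b - a).
  apply: local_lipschitz_increment => // t /andP[at_ tb].
  have tI : `[- h%:num, 0]%classic t by rewrite /= in_itv /=; apply/andP;
    split; lra.
  have /asboolP/(_ t tI) D := C1val_subproof chi.
  have FF : Filter (within [set r | `[- h%:num, 0]%classic (t + r)] 0^').
    exact: within_filter.
  have /cvgrPdist_lt /(_ _ e'0) := D.
  rewrite /within /= => -[d /= d0 Hd].
  exists d => // t' /andP[at' tb'] tt'.
  have [->|nt] := eqVneq t' t; first by rewrite !subrr !normr0 mulr0.
  have r0 : t' - t != 0 by rewrite subr_eq0.
  have := Hd (t' - t); rewrite /= sub0r normrN => /(_ tt' r0).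
  rewrite addrC subrK in_itv /= => /(_ ltac:(apply/andP; split; lra)).
  rewrite -/(C1deriv chi) -/(C1incl chi) => H.
  have r1 : 0 < `|t' - t| by rewrite normr_gt0.
  rewrite -ler_pdivrMr // mulrC -normfV -normrZ.
  have := HK t; have := ler_normB (C1deriv chi t) (C1deriv chi t - (t' - t)^-1
    *: (chi t' - chi t)).
  rewrite subKr; lra.
move=> /le_trans; apply; rewrite mulrDl lerD2l /e' mulrAC ler_pdivrMr //.
by rewrite ler_pM2l //; lra.
Qed.

(** Every point lies at most one mesh width to the right of a grid point, where [chi] vanishes. *)
Lemma grid_bound (chi : C1) (q : nat) (K : R) : (0 < q)%N ->
  (forall j, (j <= q)%N -> chi (- h%:num + j%:R * (h%:num / q%:R)) = 0) ->
  (forall s, `|C1deriv chi s| <= K) ->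
  `|chi : C| <= K * (h%:num / q%:R).
Proof.
move=> q0 H HK; apply: Cnorm_le => s; rewrite Cspace_clamp.
have := clamp_itv h s; rewrite /= in_itv /=; move: (clamp h s) =>
  {}s /andP[hs s0].
have qR : 0 < q%:R :> R by rewrite ltr0n.
have h0 : 0 < h%:num by [].
set d := h%:num / q%:R; have d0 : 0 < d by rewrite divr_gt0.
pose x := (s + h%:num) / d.
have x0 : 0 <= x by apply: divr_ge0; [lra|exact: ltW].
pose j := Num.truncn x.
have /andP[jx xj] := truncn_itv x0; rewrite -/j in jx xj.
have sE : x * d = s + h%:num by rewrite /x divfK // gt_eqF.
have jq : (j <= q)%N.
  rewrite -(ler_nat R); apply: le_trans jx _.
  rewrite /x ler_pdivrMr // /d mulrCA mulfV ?gt_eqF //; lra.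
have K0 : 0 <= K by apply: le_trans (HK 0).
have js : j%:R * d <= x * d by rewrite ler_pM2r.
have sj : x * d <= j.+1%:R * d by rewrite ler_pM2r // ltW.
rewrite -natr1 mulrDl mul1r in sj.
have jd : 0 <= j%:R * d by apply: mulr_ge0; [exact: ler0n|exact: ltW].
have := @C1_increment chi K (- h%:num + j%:R * d) s ltac:(lra) ltac:(lra) s0 HK.
rewrite H // subr0 => /le_trans; apply; apply: ler_wpM2l => //; lra.
Qed.

End DelaySpace.

(** * Finite dimension of the spectral range by sampling on a grid *)

Section DelayGrid.
Context (R : realType) (h : {posnum R}) (n : nat) (N : vnorm R n).
Local Notation E := (Rn N).
Local Notation C := (Cspace h E).
Local Notation C1 := (C1space h E).

Definition grid_eval (q : nat) (phi : C) : 'rV[R]_(q.+1 * n) :=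
  mxvec (\matrix_(j, i)
    ((phi (- h%:num + (j : nat)%:R * (h%:num / q%:R)) : 'rV[R]_n) 0 i)).

Fact grid_eval_linear q : linear (grid_eval q).
Proof.
move=> a u v; rewrite /grid_eval -linearP; congr mxvec; apply/matrixP => j i.
by rewrite !mxE.
Qed.

HB.instance Definition _ q :=
  GRing.isLinear.Build R C 'rV[R]_(q.+1 * n) *:%R (grid_eval q)
    (grid_eval_linear q).

Lemma grid_eval_eq0 q (phi : C) : grid_eval q phi = 0 ->
  forall j, (j <= q)%N -> phi (- h%:num + j%:R * (h%:num / q%:R)) = 0.
Proof.
move=> /eqP; rewrite mxvec_eq0 => /eqP/matrixP H j jq.
apply/rowP => i; have := H (Ordinal (jq : (j < q.+1)%N)) i.
by rewrite !mxE.
Qed.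

Definition cgrid_eval q (z : cplx C) : 'rV[R[i]]_(q.+1 * n) :=
  \row_j Complex (grid_eval q z.1 0 j) (grid_eval q z.2 0 j).

Fact cgrid_eval_linear q : linear (cgrid_eval q).
Proof.
move=> [a b] [x x'] [y y']; apply/rowP => j; rewrite !mxE; congr Complex.
  rewrite -[_.1]/(a *: x - b *: x' + y).
  by rewrite linearD linearB !linearZ /= !mxE.
rewrite -[_.2]/(b *: x + a *: x' + y').
by rewrite linearD linearD !linearZ /= !mxE addrC [in RHS]addrC [a * _ +
  _]addrC.
Qed.

HB.instance Definition _ q :=
  GRing.isLinear.Build R[i] (cplx C) 'rV[R[i]]_(q.+1 * n) *:%R (cgrid_eval q)
    (cgrid_eval_linear q).

Lemma cgrid_eval_eq0 q z : cgrid_eval q z = 0 ->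
  grid_eval q z.1 = 0 /\ grid_eval q z.2 = 0.
Proof.
move=> /rowP H; split; apply/rowP => j; have := H j; rewrite !mxE => -[e1 e2].
  by [].
by [].
Qed.

Context (L : {linear C -> E}).
Local Notation A := (generator L).

Lemma generator_graph : linear_graph A /\
  (forall x w, A (x, w) -> A (cconj x, cconj w)).
Proof.
apply: complexify_linear_graph.
- by exists 0; split; [rewrite linear0|].
- move=> a x y w v [chi [chiL [-> ->]]] [psi [psiL [-> ->]]].
  exists (a *: chi + psi); split; last by [].
  rewrite [RHS]linearP -chiL -psiL; by [].
(* An element of C^1 is determined by its underlying function, so the graph is single-valued. *)
- by move=> x w v [chi [_ [-> ->]]] [psi [_ [/C1val_fst_inj -> ->]]].
Qed.

Context (S : set R[i]) (P : {linear cplx C -> cplx C}).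
Context (hP : spectral_projection A S P).

Lemma range_proj_C1 (z : cplx C) : range P z -> exists chi psi : C1,
  [/\ z = ((chi : C), (psi : C)), C1deriv chi 0 = L chi & C1deriv psi 0 = L
    psi].
Proof.
have [hA _] := generator_graph.
move=> Yz; have [_ _ /(_ z Yz)[w]] := range_proj_invariant hA hP.
case: z {Yz} => z z'; case: w => w w' [[chi [e [/= -> _]]] [psi [e' [/= ->
  _]]]] _.
by exists chi, psi.
Qed.

Lemma range_proj_deriv_bound : exists2 K, 0 < K & forall chi psi : C1,
  C1deriv chi 0 = L chi -> C1deriv psi 0 = L psi ->
  range P ((chi : C), (psi : C)) ->
  `|C1deriv chi| <= K * `|((chi : C), (psi : C))| /\
  `|C1deriv psi| <= K * `|((chi : C), (psi : C))|.
Proof.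
have [hA _] := generator_graph; have [_ _ _ [K HK] _] := hP.
exists (`|K| + 1); first by rewrite ltr_wpDl.
move=> chi psi e1 e2 /(range_projP hP) Pz.
have Az : A (((chi : C), (psi : C)), (C1deriv chi, C1deriv psi)).
  by split; [exists chi|exists psi].
have := HK ((chi : C), (psi : C)); rewrite Pz => /(_ _ Az).
set z := ((chi : C), (psi : C)); have z0 := normr_ge0 z.
have KK : K * `|z| <= (`|K| + 1) * `|z|.
  by apply: ler_wpM2r => //; have := ler_norm K; lra.
rewrite {1}prod_normE /= ge_max => /andP[h1 h2].
by split; [exact: le_trans h1 KK|exact: le_trans h2 KK].
Qed.

Lemma grid_eval_inj_range : exists q, forall z : cplx C, range P z ->
  grid_eval q z.1 = 0 -> grid_eval q z.2 = 0 -> z = 0.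
Proof.
have [K K0 HK] := range_proj_deriv_bound.
(* With [q > K h] the factor K h / q in the estimate |z| <= (K h / q) |z| is below 1. *)
pose q := (Num.truncn (K * h%:num)).+1.
have qK : K * h%:num < q%:R by exact: truncnS_gt.
have h0 : 0 < h%:num by [].
exists q => z Yz; have [chi [psi [zE e1 e2]]] := range_proj_C1 Yz.
move: Yz; rewrite zE => Yz /= g1 g2.
have [b1 b2] := HK chi psi e1 e2 Yz.
have H1 := grid_bound (chi := chi) (q := q) isT (grid_eval_eq0 g1)
  (fun s => le_trans (Cnorm_ub _ s) b1).
have H2 := grid_bound (chi := psi) (q := q) isT (grid_eval_eq0 g2)
  (fun s => le_trans (Cnorm_ub _ s) b2).
set z' := ((chi : C), (psi : C)) in Yz b1 b2 H1 H2 *.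
have q0 : 0 < q%:R :> R by rewrite ltr0n.
have : `|z'| <= K * `|z'| * (h%:num / q%:R) by rewrite {1}prod_normE ge_max H1
  H2.
have -> : K * `|z'| * (h%:num / q%:R) = (K * h%:num / q%:R) * `|z'| by ring.
have : K * h%:num / q%:R < 1 by rewrite ltr_pdivrMr // mul1r.
move: (K * h%:num / q%:R) => c c1 zc.
apply/eqP; rewrite -normr_le0; have := normr_ge0 z'; nra.
Qed.

Lemma range_proj_has_dim : exists k, has_dim (range P) k.
Proof.
have [hA _] := generator_graph; have [q Hq] := grid_eval_inj_range.
have [Y0 Ylin _] := range_proj_invariant hA hP.
apply: (has_dim_of_injective (ev := cgrid_eval q)) => // z Yz /cgrid_eval_eq0[].
exact: Hq.
Qed.

(** The real spaces need a count over the reals; the same grid separates their elements. *)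
Lemma real_range_proj_has_dim (M : set C1) :
  M 0 -> (forall (a : R) u v, M u -> M v -> M (a *: u + v)) ->
  (forall x : C1, M x -> range P ((x : C), 0)) -> exists k, has_dim M k.
Proof.
move=> M0 Mlin MY; have [q Hq] := grid_eval_inj_range.
have lev : linear (fun x : C1 => grid_eval q (x : C)).
  by move=> a u v; exact: (linearP (grid_eval q)).
pose ev : {linear C1 -> 'rV[R]_(q.+1 * n)} := HB.pack (fun x : C1 =>
  grid_eval q (x : C))
  (GRing.isLinear.Build _ _ _ _ _ lev).
apply: (has_dim_of_injective (ev := ev)) => // x Mx ex.
have := Hq _ (MY x Mx) ex (linear0 _) => -[e].
exact: C1val_fst_inj.
Qed.

End DelayGrid.

(** * The real splitting of C^1 and its continuous projections *)

Section Splitting.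
Context (R : realType) (h : {posnum R}) (n : nat) (N : vnorm R n).
Local Notation E := (Rn N).
Local Notation C := (Cspace h E).
Local Notation C1 := (C1space h E).
Context (L : {linear C -> E}) (P : {linear cplx C -> cplx C}).
Context (hP : spectral_projection (generator L) (sigma_cu L) P).

Local Notation A := (generator L).
Local Notation Su := [set l | sigma_gen L l /\ 0 < complex.Re l].
Local Notation Sc := [set l | sigma_gen L l /\ complex.Re l = 0].

Lemma real_trace_submod (X : normedModType R) (V : lmodType R)
    (f : {linear V -> X}) (M : set (cplx X)) :
  M 0 -> (forall (a : R[i]) u v, M u -> M v -> M (a *: u + v)) ->
  (f @^-1` realify M) 0 /\
  forall (a : R) u v, (f @^-1` realify M) u -> (f @^-1` realify M) v ->
    (f @^-1` realify M) (a *: u + v).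
Proof.
move=> M0 Ml; split; first by rewrite /realify /= linear0.
move=> a u v Mu Mv; have := Ml (Complex a 0) _ _ Mu Mv.
rewrite /realify /= linearP; congr M; congr (_, _) => /=.
  by rewrite scale0r subr0.
by rewrite scaler0 addr0 scale0r addr0.
Qed.

Let lincl : linear (@C1incl R h E). Proof. by []. Qed.
Let incl : {linear C1 -> C} := HB.pack (@C1incl R h E)
  (GRing.isLinear.Build _ _ _ _ _ lincl).

Lemma unstable_submod : unstable_space L 0 /\
  forall (a : R) u v, unstable_space L u -> unstable_space L v ->
    unstable_space L (a *: u + v).
Proof.
have [hA _] := generator_graph L.
have [G0 Gl] := gen_eigenspaces_submod hA Su.
exact: (real_trace_submod incl G0 Gl).
Qed.

Lemma center_submod : center_space L 0 /\
  forall (a : R) u v, center_space L u -> center_space L v ->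
    center_space L (a *: u + v).
Proof.
have [hA _] := generator_graph L.
have [G0 Gl] := gen_eigenspaces_submod hA Sc.
exact: (real_trace_submod incl G0 Gl).
Qed.

Lemma stable_submod : stable_space1 P 0 /\
  forall (a : R) u v, stable_space1 P u -> stable_space1 P v ->
    stable_space1 P (a *: u + v).
Proof.
apply: (real_trace_submod incl (M := [set z | P z = 0])); first exact: linear0.
by move=> a u v /= Pu Pv; rewrite linearP Pu Pv scaler0 addr0.
Qed.

Lemma sigma_cuE : sigma_cu L = Su `|` Sc.
Proof.
apply/seteqP; split=> [l [sl]|l [[sl rl]|[sl rl]]].
- rewrite le_eqVlt => /orP[/eqP e|rl]; [right|left] => //.
- by split=> //; exact: ltW.
- by split=> //; rewrite rl.
Qed.

Lemma sigma_gen_conj l : sigma_gen L l -> sigma_gen L (conjc l).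
Proof. by have [_ hR] := generator_graph L; exact: spectrum_conj. Qed.

Lemma Re_conjc (l : R[i]) : complex.Re (conjc l) = complex.Re l.
Proof. by case: l. Qed.

Lemma Su_conj l : Su l -> Su (conjc l).
Proof. by move=> [/sigma_gen_conj ? ?]; rewrite /= Re_conjc. Qed.

Lemma Sc_conj l : Sc l -> Sc (conjc l).
Proof. by move=> [/sigma_gen_conj ? ?]; rewrite /= Re_conjc. Qed.

Lemma Su_sub : Su `<=` sigma_cu L.
Proof. by rewrite sigma_cuE; exact: subsetUl. Qed.

Lemma Sc_sub : Sc `<=` sigma_cu L.
Proof. by rewrite sigma_cuE; exact: subsetUr. Qed.

Lemma gen_eigenspaces_range (S : set R[i]) z : S `<=` sigma_cu L ->
  gen_eigenspaces A S z -> range P z.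
Proof.
have [hA _] := generator_graph L; move=> SS.
by move=> /(gen_eigenspaces_annihilated hA hP SS)[].
Qed.

Lemma range_tangent (x : C1) : range P ((x : C), 0) -> C1deriv x 0 = L x.
Proof.
move=> /(range_proj_C1 hP)[chi [psi [[e _] eL _]]].
by rewrite (C1val_fst_inj e).
Qed.

Lemma unstable_center_disjoint x : unstable_space L x -> center_space L x -> x
  = 0.
Proof.
have [hA _] := generator_graph L.
move=> ux cx; have := gen_eigenspaces_disjoint hA hP Su_sub Sc_sub _ ux cx.
move=> H; have [e] : ((x : C), 0) = (0, 0) :> cplx C.
  by apply: H => l [_ lp] [_ l0]; move: lp; rewrite l0 ltxx.
exact: C1val_fst_inj.
Qed.

Lemma range_stable_disjoint (x : C1) : range P ((x : C), 0) ->
  stable_space1 P x -> x = 0.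
Proof.
have [hA _] := generator_graph L.
move=> /(range_projP hP) e s.
have [e'] : ((x : C), 0) = (0, 0) :> cplx C by rewrite -e; exact: s.
exact: C1val_fst_inj.
Qed.

(** [P (x, 0)] is real. It splits into generalised eigenvectors for [Su] and [Sc], whose real parts
    stay in the same spaces because both sets are closed under conjugation. *)
Lemma spectral_decomposition (x : C1) : exists u c,
  [/\ unstable_space L u, center_space L c, stable_space1 P (x - u - c) &
      ((u + c : C1) : C) = (P ((x : C), 0)).1].
Proof.
have [hA hR] := generator_graph L; have [k dY] := range_proj_has_dim hP.
have SC l : sigma_cu L l -> sigma_cu L (conjc l).
  by move=> [/sigma_gen_conj ? ?]; split=> //=; rewrite Re_conjc.
have P2 := spectral_projection_real hA hR hP dY SC (x : C).
pose z : cplx C := ((x : C), 0).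
have Yz : range P (P z) by exists z.
have := Yz; rewrite (range_proj_gen_eigenspaces hA hP dY) sigma_cuE.
move=> /gen_eigenspacesU -/(_ hA)[zu [zc [gu gc zE]]].
have gu' := gen_eigenspaces_re hA hR Su_conj gu.
have gc' := gen_eigenspaces_re hA hR Sc_conj gc.
have [u [u0 [[uE _] _ _]]] := range_proj_C1 hP (gen_eigenspaces_range Su_sub
  gu').
have [c [c0 [[cE _] _ _]]] := range_proj_C1 hP (gen_eigenspaces_range Sc_sub
  gc').
(* [zu] and [zc] may be complex, but their first components add up to that of [P z]. *)
have E1 : ((u + c : C1) : C) = (P z).1.
  by rewrite zE -[LHS]/((u : C) + (c : C)) -uE -cE.
exists u, c; split=> //.
- by rewrite /unstable_space /realify /= -uE.
- by rewrite /center_space /realify /= -cE.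
have PzE : P z = (((u + c : C1) : C), 0) by rewrite E1 -P2; case: (P z).
rewrite /stable_space1 /realify /=.
have -> : ((C1incl (x - u - c), 0) : cplx C) = z - P z.
  have e : x - u - c = x - (u + c) by rewrite opprD addrA.
  have PE1 : (P z).1 = C1incl (u + c) by rewrite PzE.
  have PE2 : (P z).2 = 0 by rewrite PzE.
  rewrite e [RHS]surjective_pairing; congr (_, _).
    by rewrite -[RHS]/(C1incl x - (P z).1) PE1.
  by rewrite -[RHS]/(0 - (P z).2) PE2 subrr.
by have [[_ PP] _ _ _ _] := hP; rewrite linearB PP subrr.
Qed.

(** The projections come from algebra alone. Their continuity in the C^1 norm, while [P] is
    continuous in the sup norm, uses the derivative bound on the range of [P]. *)
Theorem spectral_splitting : exists piu pic : {linear C1 -> C1},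
  [/\ continuous piu /\ continuous pic,
      (forall x, piu (piu x) = piu x) /\ (forall x, pic (pic x) = pic x),
      (forall x, piu (pic x) = 0) /\ (forall x, pic (piu x) = 0),
      [/\ unstable_space L = range piu, center_space L = range pic &
          stable_space1 P = [set x | piu x = 0 /\ pic x = 0]] &
      [/\ forall x, C1deriv (piu x) 0 = L (piu x),
          forall x, C1deriv (pic x) 0 = L (pic x) &
          exists k, has_dim (center_space L) k]].
Proof.
have [hA _] := generator_graph L.
have [u0 ul] := unstable_submod; have [c0 cl] := center_submod.
have [s0 sl] := stable_submod.
pose Cu := unstable_space L; pose Cc := center_space L;
  pose Cs := stable_space1 P.
have subD (M : set C1) x y : (forall (a : R) u v, M u -> M v -> M (a *: u + v))
  ->
    M x -> M y -> M (x + y).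
  by move=> Ml Mx My; have := Ml 1 _ _ Mx My; rewrite scale1r.
have subN (M : set C1) x : M 0 -> (forall (a : R) u v, M u -> M v -> M (a *: u
  + v)) ->
    M x -> M (- x).
  by move=> M0 Ml Mx; have := Ml (-1) _ _ Mx M0; rewrite scaleN1r addr0.
have sum_submod (M M' : set C1) : M 0 -> M' 0 ->
    (forall (a : R) u v, M u -> M v -> M (a *: u + v)) ->
    (forall (a : R) u v, M' u -> M' v -> M' (a *: u + v)) ->
    sumset M M' 0 /\ forall (a : R) u v, sumset M M' u -> sumset M M' v ->
      sumset M M' (a *: u + v).
  move=> M0 M0' Ml Ml'; split; first by exists 0 => //; exists 0;
    rewrite ?addr0.
  move=> a _ _ [x Mx [y My <-]] [x' Mx' [y' My' <-]].
  exists (a *: x + x'); first exact: Ml.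
  exists (a *: y + y'); first exact: Ml'.
  by rewrite scalerDr addrACA.
have YRu x : Cu x -> range P ((x : C), 0) by exact: gen_eigenspaces_range
  Su_sub.
have YRc x : Cc x -> range P ((x : C), 0) by exact: gen_eigenspaces_range
  Sc_sub.
have [Y0 Yl _] := range_proj_invariant hA hP.
pose YR := [set x : C1 | range P ((x : C), 0)].
have [YR0 YRl] : YR 0 /\ forall (a : R) u v, YR u -> YR v -> YR (a *: u + v).
  exact: (real_trace_submod incl Y0 Yl).
have YRD x y : YR x -> YR y -> YR (x + y) by exact: (subD YR).
have YRN x : YR x -> YR (- x) by exact: (subN YR).
have YRs x : YR x -> Cs x -> x = 0.
  by move=> Yx sx; exact: range_stable_disjoint.
have [cs0 csl] := sum_submod Cc Cs c0 s0 cl sl.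
have [us0 usl] := sum_submod Cu Cs u0 s0 ul sl.
(* The stable summand is a difference of elements of the range of [P], hence 0, and [x] is both
   unstable and central. *)
have dis_u x : Cu x -> sumset Cc Cs x -> x = 0.
  move=> ux [c cc [s ss xE]].
  have s0' : s = 0.
    apply: YRs ss; have -> : s = - c + x by rewrite -xE addKr.
    by apply: YRD; [apply: YRN; exact: YRc|exact: YRu].
  by apply: unstable_center_disjoint => //; rewrite -xE s0' addr0.
have dis_c x : Cc x -> sumset Cu Cs x -> x = 0.
  move=> cx [u uu [s ss xE]].
  have s0' : s = 0.
    apply: YRs ss; have -> : s = - u + x by rewrite -xE addKr.
    by apply: YRD; [apply: YRN; exact: YRu|exact: YRc].
  by apply: unstable_center_disjoint => //; rewrite -xE s0' addr0.
have [|piu piuP] := complement_projection u0 cs0 ul csl dis_u.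
  move=> x; have [u [c [uu cc ss _]]] := spectral_decomposition x.
  by exists u => //; exists c => //; exists (x - u - c) => //;
    rewrite addrC subrK.
have [|pic picP] := complement_projection c0 us0 cl usl dis_c.
  move=> x; have [u [c [uu cc ss _]]] := spectral_decomposition x.
  exists c => //; exists u => //; exists (x - u - c) => //.
  by rewrite addrAC [LHS]addrC subrK.
have fixP (M M' : set C1) (pi : {linear C1 -> C1}) :
    M 0 -> (forall (a : R) u v, M u -> M v -> M (a *: u + v)) ->
    M' 0 -> (forall (a : R) u v, M' u -> M' v -> M' (a *: u + v)) ->
    (forall x, M x -> M' x -> x = 0) -> (forall x, M (pi x) /\ M' (x - pi x)) ->
    (forall x, M x -> pi x = x) /\ (forall x, M' x -> pi x = 0).
  move=> M0 Ml M0' Ml' dis piP; split=> x Mx; have [Mp Mx'] := piP x.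
    apply/esym/eqP; rewrite -subr_eq0; apply/eqP/(dis _ _ Mx').
    by apply: (subD M) => //; exact: (subN M).
  apply: dis => //; rewrite -[pi x](subKr x); apply: (subD M') => //.
  exact: (subN M').
have [fixu keru] := fixP _ _ piu u0 ul cs0 csl dis_u piuP.
have [fixc kerc] := fixP _ _ pic c0 cl us0 usl dis_c picP.
have cs_c x : Cc x -> sumset Cc Cs x by exists x => //; exists 0;
  rewrite ?addr0.
have cs_s x : Cs x -> sumset Cc Cs x by exists 0 => //; exists x;
  rewrite ?add0r.
have us_u x : Cu x -> sumset Cu Cs x by exists x => //; exists 0;
  rewrite ?addr0.
have us_s x : Cs x -> sumset Cu Cs x by exists 0 => //; exists x;
  rewrite ?add0r.
have dec x u c : Cu u -> Cc c -> Cs (x - u - c) -> piu x = u /\ pic x = c.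
  move=> uu cc; have : x = u + (c + (x - u - c)).
    by rewrite [c + _]addrC subrK [RHS]addrC subrK.
  move: (x - u - c) => s -> ss.
  rewrite !linearD; split.
    by rewrite (fixu u uu) (keru c (cs_c _ cc)) (keru s (cs_s _ ss)) !addr0.
  by rewrite (kerc u (us_u _ uu)) (fixc c cc) (kerc s (us_s _ ss)) addr0 add0r.
have [k dYR] : exists k, has_dim YR k by exact: (real_range_proj_has_dim hP YR0
  YRl).
have wE x : ((piu x + pic x : C1) : C) = (P ((x : C), 0)).1.
  have [u [c [uu cc ss <-]]] := spectral_decomposition x.
  by have [-> ->] := dec x u c uu cc ss.
have wY x : YR (piu x + pic x).
  by apply: YRD; [apply: YRu|apply: YRc]; [have [] := piuP x|have [] := picP x].
have [K1 K10 HK1] : exists2 K, 0 < K & forall phi : C, `|(P (phi, 0)).1| <= K *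
  `|phi|.
  have lp : linear (fun phi : C => (P (phi, 0)).1).
    move=> a x y; have := linearP P (Complex a 0) (x, 0) (y, 0).
    have -> : Complex a 0 *: ((x, 0) : cplx C) + (y, 0) = (a *: x + y, 0).
      by congr (_, _) => /=; rewrite scale0r ?subr0 // scaler0 !addr0.
    by move=> ->; rewrite /= scale0r subr0.
  pose p : {linear C -> C} := HB.pack (fun phi : C => (P (phi, 0)).1)
    (GRing.isLinear.Build _ _ _ _ _ lp).
  apply: (@linear_lipschitz _ _ _ p); have [[cP _] _ _ _ _] := hP.
  move=> x; apply: (@continuous_comp _ _ _ (fun phi : C => P (phi, 0)) fst);
    last first.
    exact: cvg_fst.
  apply: (@continuous_comp _ (cplx C) _ (fun phi : C => (phi, 0)) P);
    last exact: cP.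
  have cp : continuous (fun phi : C => (phi, 0 : C)).
    move=> y; apply: (@cvg_pair _ _ _ (nbhs y) (nbhs y) (nbhs (0 : C)) _ _ _ id
      (fun=> 0)).
      exact: cvg_id.
    exact: cvg_cst.
  exact: cp.
have [K2 K20 HK2] := range_proj_deriv_bound hP.
(* [K1] bounds the function in the sup norm and [K2] its derivative in terms of the function. *)
have wB x : `|piu x + pic x| <= (1 + K2) * K1 * `|x|.
  set w := piu x + pic x.
  have hw : `|w : C| <= K1 * `|x|.
    rewrite wE; apply: le_trans (HK1 _) _; rewrite ler_pM2l //.
    by rewrite [leRHS]/(`|(x : C)| + `|C1deriv x|) lerDl.
  have [hd _] := HK2 w 0 (range_tangent (wY x)) ltac:(by rewrite linear0) (wY
    x).
  have e : `|((w : C), (0 : C))| = `|w : C|.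
    by rewrite prod_normE /= normr0 max_l.
  have hd' : `|C1deriv w| <= K2 * `|w : C| by rewrite -e.
  rewrite [leLHS]/(`|(w : C)| + `|C1deriv w|).
  apply: le_trans (_ : (1 + K2) * `|w : C| <= _);
    first by rewrite mulrDl mul1r lerD2l.
  by rewrite -mulrA ler_pM2l // addr_gt0.
(* Such a [pi] factors through [piu + pic], whose values lie in the finite-dimensional [YR], where
   linear maps are bounded. *)
have contP (pi : {linear C1 -> C1}) : (forall x, pi x = pi (piu x + pic x)) ->
    continuous pi.
  move=> piE; have [M M0 HM] := has_dim_linear_bounded pi dYR.
  apply: bounded_linear_continuous; apply/linear_boundedP.
  exists (M * ((1 + K2) * K1)); split=> [|r /ltW Kr x]; first exact: num_real.
  rewrite piE; apply: le_trans (HM _ (wY x)) _.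
  apply: (@le_trans _ _ (M * ((1 + K2) * K1 * `|x|)));
    first by rewrite ler_pM2l.
  by rewrite mulrA; apply: ler_wpM2r.
have uu x : piu (piu x) = piu x by apply: fixu; have [] := piuP x.
have cc x : pic (pic x) = pic x by apply: fixc; have [] := picP x.
have uc x : piu (pic x) = 0 by apply: keru; apply: cs_c; have [] := picP x.
have cu x : pic (piu x) = 0 by apply: kerc; apply: us_u; have [] := piuP x.
exists piu, pic; split=> //.
- split; apply: contP => x; rewrite linearD.
    by rewrite uu uc addr0.
  by rewrite cc cu add0r.
- split.
  + by apply/seteqP; split=> [x /fixu <-|_ [x _ <-]];
    [exists x|have [] := piuP x].
  + by apply/seteqP; split=> [x /fixc <-|_ [x _ <-]];
    [exists x|have [] := picP x].
  + apply/seteqP; split=> x; first by move=> sx; split;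
    [exact/keru/cs_s|exact/kerc/us_s].
    move=> [px qx]; have [u [c [u' c' ss _]]] := spectral_decomposition x.
    have [eu ec] := dec x u c u' c' ss.
    by move: ss; rewrite -eu -ec px qx !subr0.
- split=> [x|x|].
  + by apply: range_tangent; apply: YRu; have [] := piuP x.
  + by apply: range_tangent; apply: YRc; have [] := picP x.
  + exact: (real_range_proj_has_dim hP c0 cl YRc).
Qed.

End Splitting.

(** * Curves in the solution manifold, trajectories, and the conclusion *)

Lemma diff_near_eq (R : realType) (V W : normedModType R) (F G : V -> W) x :
  (\forall y \near x, F y = G y) -> differentiable F x ->
  forall v, 'd G x v = 'd F x v.
Proof.
move=> /near_ballP[d d0 Hd] dF.
have [|||_ //] := @eps_differentiable _ _ _ G x ('d F x).
- by move=> a u v; exact: linearP.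
- by have [K _ HK] := diff_linear_bound dF; exists K.
move=> e e0; have [d' d'0 Hd'] := differentiable_eps dF e0.
exists (Num.min d d'); first by rewrite lt_min d0.
move=> v; rewrite lt_min => /andP[vd vd'].
rewrite -!Hd ?subrr ?normr0 //; first exact: Hd'.
by rewrite [x + v]addrC addrK.
Qed.

(** The equation [C1deriv chi 0 = f chi] is differentiated along the curve; its left side is a
    continuous linear function of [chi] in C^1. *)
Lemma solution_manifold_curve (R : realType) (h : {posnum R}) (E :
  normedModType R)
    (U : set (C1space h E)) (f : C1space h E -> E) (c : R -> C1space h E) :
  c 0 = 0 -> differentiable f 0 ->
  (\forall t \near (0 : R), solution_manifold U f (c t)) ->
  differentiable c 0 -> tangent0 f ('d c 0 1).
Proof.
move=> c0 df HX dc; rewrite /tangent0 /=.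
have lev : linear (fun chi : C1space h E => C1deriv chi 0) by [].
pose ev : {linear C1space h E -> E} := HB.pack (fun chi : C1space h E =>
  C1deriv chi 0)
  (GRing.isLinear.Build _ _ _ _ _ lev).
have cev : continuous ev.
  apply: bounded_linear_continuous; apply/linear_boundedP.
  exists 1; split=> [|r /ltW r1 x]; first exact: num_real.
  apply: le_trans (Cnorm_ub (C1deriv x) 0) _.
  apply: (@le_trans _ _ (1 * `|x|)); last by apply: ler_wpM2r.
  by rewrite mul1r [leRHS]/(`|C1incl x| + `|C1deriv x|) lerDr.
have dev : differentiable ev (c 0) by exact: linear_differentiable.
have dfc : differentiable f (c 0) by rewrite c0.
have E0 : \forall t \near (0 : R), (ev \o c) t = (f \o c) t.
  by apply: filterS HX => t [].
have e1 : 'd (ev \o c) 0 1 = ev ('d c 0 1).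
  have ed := diff_lin (c 0) cev.
  by rewrite (diff_comp dc dev) /comp ed.
have e2 : 'd (f \o c) 0 1 = 'd f 0 ('d c 0 1).
  by rewrite (diff_comp dc dfc) /comp c0.
by have := diff_near_eq E0 (differentiable_comp dc dev) 1; rewrite e1 e2 => ->.
Qed.

(** The trajectory reaches [t + A] for every [A > 0], so [A] is below the escape time. *)
Lemma trajectory_t_plus (R : realType) (h : {posnum R}) (E : normedModType R)
    (U : set (C1space h E)) (f : C1space h E -> E) (gamma : R -> C1space h E) t
      :
  trajectory U f [set: R] gamma -> t_plus U f (gamma t) = +oo%E.
Proof.
move=> [_ H]; apply/eqyP => A A0.
have tA : t <= t + A by rewrite lerDl ltW.
have [+ _] := H t (t + A) Logic.I Logic.I tA.
by rewrite addrC addKr => /ltW.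
Qed.

Lemma trajectory_shift (R : realType) (h : {posnum R}) (E : normedModType R)
    (U : set (C1space h E)) (f : C1space h E -> E) (gamma : R -> C1space h E) t
      :
  trajectory U f [set: R] gamma ->
  trajectory U f `]-oo, 0] (fun s => gamma (t + s)).
Proof.
move=> [HX H]; split=> [s _|s s' _ _ ss']; first exact: HX.
have tss : t + s <= t + s' by rewrite lerD2l.
have := H (t + s) (t + s') Logic.I Logic.I tss.
by rewrite opprD addrACA subrr add0r.
Qed.

Theorem mainTheorem1 (R : realType) (n : nat) (N : vnorm R n) (h : {posnum R})
    (U : set (C1space h (Rn N))) (f : C1space h (Rn N) -> Rn N)
    (De : C1space h (Rn N) -> {linear Cspace h (Rn N) -> Rn N})
    (P : {linear cplx (Cspace h (Rn N)) -> cplx (Cspace h (Rn N))})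
    (Wcs Ncs Wcu Ncu : set (C1space h (Rn N))) :
  open U -> U 0 -> f 0 = 0 ->
  C1_map U f ->
  derivative_extends U f De ->
  let L := De 0 : Cspace h (Rn N) -> Rn N in
  spectral_projection (generator L) (sigma_cu L) P ->
  let Cu := unstable_space L in
  let Cc := center_space L in
  let Cs1 := stable_space1 P in
  (exists l, sigma_gen L l /\ complex.Re l = 0) ->
  local_center_stable U f (sumset Cc (Cs1 `&` tangent0 f)) Wcs Ncs ->
  local_center_unstable U f (sumset Cu Cc) Wcu Ncu ->
  exists (Cc0 Csu0 : set (C1space h (Rn N)))
      (wc : C1space h (Rn N) -> C1space h (Rn N))
      (Dwc : C1space h (Rn N) -> C1space h (Rn N) -> C1space h (Rn N)),
    let Nc := sumset Cc0 Csu0 in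
    let Wc := [set phi + wc phi | phi in Cc0] in
    [/\ open_nbhd0_in Cc Cc0, open_nbhd0_in (sumset Cs1 Cu) Csu0 & Nc `<=` U] /\
    [/\ forall phi, Cc0 phi -> Csu0 (wc phi),
        C1_map_in Cc Cc0 wc Dwc,
        wc 0 = 0 &
        forall chi, Cc chi -> Dwc 0 chi = 0] /\
    [/\ Wc `<=` Wcs `&` Wcu,
        Wc `<=` solution_manifold U f /\
          (exists2 k, has_dim Cc k &
             submanifold_dim k (solution_manifold U f) Wc),
        pos_invariant_rel U f Wc Nc &
        forall gamma, trajectory U f [set: R] gamma ->
          (forall t, Nc (gamma t)) -> forall t, Wc (gamma t)].
Proof.
move=> oU U0 f0 Cf [DeE _] L hP Cu Cc Cs1 _.
move=> [subs Ws0 Ts [oNs Ns0 NsU] [csI csA _]].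
move=> [[k0 dY subu] Wu0 Tu [oNu Nu0 NuU] [cuI cuA]].
have [piu [pic [[cu cc] [uu cc'] [uc cu'] [EU EC ES] [tu tc [k dC]]]]] :=
  spectral_splitting hP.
have LE (chi : C1space h (Rn N)) : De 0 chi = 'd f 0 chi by exact: DeE.
have [df _] := Cf 0 U0.
have sumE : sumset Cu Cc = [set x | piu x + pic x = x].
  rewrite /Cu /Cc EU EC; apply/seteqP; split=>
    [_ [_ [x _ <-] [_ [y _ <-] <-]]|x xE].
    by rewrite /= !linearD /= uu uc cu' cc' addr0 add0r.
  by exists (piu x); [exists x|exists (pic x); [exists x|]].
have TB (a : R) u v : tangent0 f u -> tangent0 f v -> tangent0 f (a *: u + v).
  by rewrite /tangent0 /= => eu ev; rewrite (linearP ('d f 0)) -eu -ev.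
have Tc x : tangent0 f (pic x) by rewrite /tangent0 /= -LE; exact: tc.
(* Center vectors are tangent, so [x - pic x] is tangent whenever [x] is. *)
have TsE : sumset Cc (Cs1 `&` tangent0 f) = [set x | piu x = 0 /\ tangent0 f x].
  rewrite /Cc /Cs1 EC ES; apply/seteqP.
  split=> [_ [_ [x _ <-] [s [[su sc] st] <-]]|x [xu xt]].
    split; first by rewrite linearD /= uc su addr0.
    by have := TB 1 _ _ (Tc x) st; rewrite scale1r.
  exists (pic x); first by exists x.
  exists (x - pic x); last by rewrite addrC subrK.
  split; first by rewrite /= !linearB /= uc xu cc' !subrr.
  by have := TB (-1) _ _ (Tc x) xt; rewrite scaleN1r addrC.
have suE : sumset Cs1 Cu = [set x | pic x = 0].
  rewrite /Cs1 /Cu ES EU; apply/seteqP.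
  split=> [_ [s [su sc] [_ [x _ <-] <-]]|x xc];
    first by rewrite /= linearD sc cu' addr0.
  exists (x - piu x); last by exists (piu x); [exists x|rewrite subrK].
  by rewrite /= !linearB /= uu cu' xc !subrr.
rewrite TsE in Ts; rewrite sumE in Tu dY.
have subu' : submanifold (solution_manifold U f) Wcu.
  have [WX H] := subu; split=> // p /H[M [M' [sM sM' _ ad]]].
  by exists M, M'.
(* The charts are confined to both [Ncs] and [Ncu], so that [Nc] will be too. *)
have [ O [ O' [Th [Ps [M [dg [ O0 ON Th0 dP] [sM Mc] HX HW]]]]]] :=
  transversal_flattening cu cc uu cc' uc cu' dY
    (fun c c0 HX dc => solution_manifold_curve c0 df HX dc)
    subs subu' Ws0 Wu0 Ts Tu (openI oNs oNu) (conj Ns0 Nu0).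
have [Cc0 [Csu0 [wc [Dwc]]]] :=
  center_graph cc cc' dg O0 ON Th0 dP sM Mc HX HW (fun x Wx => subs.1 x Wx).
move=> [[oC oCsu NcN] [[wcC Cwc wc0 Dwc0] [WcE [WcX subWc]]]].
exists Cc0, Csu0, wc, Dwc => Nc Wc.
rewrite -/Nc -/Wc in WcE WcX subWc NcN.
split; first split.
- by rewrite /Cc EC.
- by rewrite suE.
- by move=> x /NcN[/NsU].
split; first split.
- exact: wcC.
- by rewrite /Cc EC; exact: Cwc.
- exact: wc0.
- by move=> chi _; exact: Dwc0.
have WcI phi : Wc phi -> [/\ Wcs phi, Wcu phi & Nc phi] by rewrite WcE => -[[]].
split.
- by move=> x /WcI[].
- split=> //; exists k => //; split=> // p /subWc[M1 [M' [sM1 sM' eM ad]]].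
  by exists M1, M'; split=> //; rewrite eM -EC; exact: dC.
(* An orbit piece in [Nc] lies in [Ncs] and [Ncu]; (CS 1) and (CU 1) keep it in both manifolds, and
   inside [Nc] their intersection is [Wc]. *)
- move=> phi t /WcI[ws wu _] t0 tp HN s st; rewrite WcE; split; last exact: HN.
  split.
    by apply: (csI phi t) => // r rt; have [] := NcN _ (HN r rt).
  by apply: (cuI phi t) => // r rt; have [] := NcN _ (HN r rt).
- move=> gamma tg gN t; rewrite WcE; split; last exact: gN.
  have [gX gF] := tg; split.
    (* (CS 2) applied to the forward orbit of [gamma t]. *)
    apply: csA; [exact: gX|exact: trajectory_t_plus tg|move=> r r0].
    have tr : t <= t + r by rewrite lerDl.
    have [_ e] := gF t (t + r) Logic.I Logic.I tr.
    have {}e : gamma (t + r) = semiflow U f r (gamma t) by rewrite e addrC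
      addKr.
    by rewrite -e; have [] := NcN _ (gN (t + r)).
  (* (CU 2) applied to the past of [gamma t], shifted to end at time 0. *)
  have := cuA _ (trajectory_shift t tg) _ 0 (lexx 0); rewrite addr0; apply.
  by move=> s _; have [] := NcN _ (gN (t + s)).
Qed.
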